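(* Let $\Omega\subset\mathbb{R}^n$, $n\ge2$, be a convex domain with $C^2$ boundary, and let $p\in(1,\infty)$. For $\mathbf{x}\in\mathbb{R}^n\setminus\overline\Omega$ let $\delta(\mathbf{x})=\operatorname{dist}(\mathbf{x},\overline\Omega)$ and $$\tilde\kappa(\mathbf{x})=\sum_{i=1}^{n-1}\frac{\kappa_i}{1+\delta(\mathbf{x})\kappa_i}\ \ge 0,$$ where $\kappa_1,\dots,\kappa_{n-1}$ are the principal curvatures of $\partial\Omega$, with respect to the unit normal pointing into $\mathbb{R}^n\setminus\overline\Omega$, at the (unique) point $\mathbf{y}\in\partial\Omega$ with $|\mathbf{x}-\mathbf{y}|=\delta(\mathbf{x})$. Then for all $f\in C_0^\infty(\mathbb{R}^n\setminus\overline\Omega)$, $$\int_{\mathbb{R}^n\setminus\overline\Omega}|\nabla f(\mathbf{x})|^p\,d\mathbf{x}\ \ge\ \left(\frac{p-1}{p}\right)^p\int_{\mathbb{R}^n\setminus\overline\Omega}\left\{1-\frac{p\,\tilde\kappa\,\delta}{p-1}\right\}\frac{|f(\mathbf{x})|^p}{\delta(\mathbf{x})^p}\,d\mathbf{x}.$$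
   Context: A domain is an open connected set. $\partial\Omega\in C^2$ means that locally, after a rotation of coordinates, $\partial\Omega$ is the graph of a $C^2$ function of $n-1$ variables. Sign convention: if $\mathbf{n}$ is the unit normal to $\partial\Omega$ pointing into $\mathbb{R}^n\setminus\overline\Omega$ and $\mathbf{v}_i$ are orthonormal principal directions, then $\kappa_i$ is defined by $\partial_{\mathbf{v}_i}\mathbf{n}=\kappa_i\mathbf{v}_i$; with this convention the $\kappa_i$ are non-negative for convex $\Omega$ (e.g. $1/\rho$ when $\Omega$ is a ball of radius $\rho$). *)

(* Defs.v *)
From HB Require Import structures.
From mathcomp Require Import all_boot all_order all_algebra.
From mathcomp Require Import all_classical all_reals all_analysis.

Set Implicit Arguments.
Unset Strict Implicit.
Unset Printing Implicit Defensive.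

Import Order.TTheory GRing.Theory Num.Theory.
Import numFieldNormedType.Exports.

Local Open Scope classical_set_scope.
Local Open Scope ring_scope.

Definition rV_display : measure_display.
Proof. exact: default_measure_display. Qed.

Section rV_measurable.
Context (R : realType) (n : nat).

Definition rV_coord (i : 'I_n) (x : 'rV[R]_n) : measurableTypeR R := x 0 i.

Let rV_set0 : g_sigma_preimage rV_coord set0.
Proof. exact: sigma_algebra0. Qed.

Let rV_setC A : g_sigma_preimage rV_coord A -> g_sigma_preimage rV_coord (~` A).
Proof. exact: sigma_algebraC. Qed.

Let rV_bigcup (F : (set 'rV[R]_n)^nat) :
  (forall i, g_sigma_preimage rV_coord (F i)) ->
  g_sigma_preimage rV_coord (\bigcup_i (F i)).
Proof. exact: sigma_algebra_bigcup. Qed.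

(* The Borel sigma-algebra of R^n, presented as the one generated by the
   coordinate projections. *)
HB.instance Definition _ := @isMeasurable.Build rV_display
  'rV[R]_n (g_sigma_preimage rV_coord) rV_set0 rV_setC rV_bigcup.

Lemma measurable_rV_coord i : measurable_fun [set: 'rV[R]_n] (rV_coord i).
Proof.
move=> _ Y mY; rewrite setTI; apply: sub_sigma_algebra => /=.
rewrite -bigcup_seq/=; exists i => /=; first by rewrite mem_index_enum.
by exists Y => //; rewrite setTI.
Qed.

Lemma measurable_rVP d (T : measurableType d) (f : T -> 'rV[R]_n) :
  (forall i, measurable_fun setT (rV_coord i \o f)) -> measurable_fun setT f.
Proof.
move=> mf.
have H : g_sigma_preimage (fun i => rV_coord i \o f) `<=` measurable.
  apply: smallest_sub; first exact: sigma_algebra_measurable.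
  rewrite -bigcup_seq; apply: bigcup_sub => i _ A [B mB <-].
  exact: mf.
by rewrite g_sigma_preimage_comp in H => _ A mA; apply: H; exists A.
Qed.

End rV_measurable.

Definition rV_cons (R : realType) (n : nat)
    (z : measurableTypeR R * 'rV[R]_n) : 'rV[R]_n.+1 :=
  row_mx (z.1%:M : 'rV[R]_1) z.2.

Definition rV_uncons (R : realType) (n : nat) (x : 'rV[R]_n.+1) :
    measurableTypeR R * 'rV[R]_n :=
  (x 0 ord0, \row_i x 0 (lift ord0 i)).

Section lebesgue_rV_measure.
Context {R : realType}.

Lemma rV_cons0 n z : @rV_cons R n z 0 ord0 = z.1.
Proof.
rewrite -[RHS](_ : (z.1%:M : 'rV[R]_1) 0 0 = _); last by rewrite mxE mulr1n.
rewrite -(@row_mxEl R 1 1 n (z.1%:M) z.2 0 0).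
by congr (row_mx _ _ _ _); exact/val_inj.
Qed.

Lemma rV_consS n z i : @rV_cons R n z 0 (lift ord0 i) = z.2 0 i.
Proof.
rewrite -(@row_mxEr R 1 1 n (z.1%:M) z.2 0 i).
by congr (row_mx _ _ _ _); exact/val_inj.
Qed.

Lemma rV_consK n : cancel (@rV_cons R n) (@rV_uncons R n).
Proof.
move=> [x v]; rewrite /rV_uncons rV_cons0; congr pair.
by apply/rowP => i; rewrite mxE rV_consS.
Qed.

Lemma measurable_rV_cons n : measurable_fun setT (@rV_cons R n).
Proof.
apply: measurable_rVP => i; case: (unliftP ord0 i) => [j|] ->.
  rewrite (_ : _ \o _ = rV_coord j \o snd); last first.
    by apply/funext => z; rewrite /= /rV_coord rV_consS.
  by apply: measurableT_comp => //; exact: measurable_rV_coord.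
rewrite (_ : _ \o _ = fst); first exact: measurable_fst.
by apply/funext => z; rewrite /= /rV_coord rV_cons0.
Qed.

Lemma measurable_rV_uncons n : measurable_fun setT (@rV_uncons R n).
Proof.
apply/measurable_fun_pairP; split.
  exact: (@measurable_rV_coord R n.+1 ord0).
apply: measurable_rVP => i.
rewrite (_ : _ \o _ = rV_coord (lift ord0 i)); first exact: measurable_rV_coord.
by apply/funext => x; rewrite /= /rV_coord mxE.
Qed.

Section step.
Variables (n : nat) (mu : {sigma_finite_measure set 'rV[R]_n -> \bar R}).

Definition lebesgue_rV_step : set 'rV[R]_n.+1 -> \bar R :=
  pushforward (@lebesgue_measure R \x mu)%E (@rV_cons R n).

Local Notation nu := lebesgue_rV_step.

Let nu0 : nu set0 = 0%E.
Proof. by rewrite /nu /pushforward preimage_set0 measure0. Qed.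

Let nu_ge0 A : (0 <= nu A)%E.
Proof. exact: (measure_ge0 (@lebesgue_measure R \x mu)%E). Qed.

Let nu_additive : semi_sigma_additive nu.
Proof.
move=> F mF tF mUF; rewrite /nu /pushforward preimage_bigcup.
have mc A : measurable A -> measurable (@rV_cons R n @^-1` A).
  by move=> mA; rewrite -[X in measurable X]setTI; exact: measurable_rV_cons.
apply: measure_semi_sigma_additive => [k||]; first exact: mc.
  apply/trivIsetP => /= i j _ _ ij; rewrite -preimage_setI.
  by move/trivIsetP : tF => /(_ _ _ _ _ ij) ->//; rewrite preimage_set0.
by rewrite -preimage_bigcup; exact: mc.
Qed.

HB.instance Definition _ := isMeasure.Build _ _ _ nu nu0 nu_ge0 nu_additive.

Let nu_sigma_finite : sigma_finite setT nu.
Proof.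
have /sigma_finiteP[F [TF ndF Foo]] := sigma_finiteT (@lebesgue_measure R).
have /sigma_finiteP[G [TG ndG Goo]] := sigma_finiteT mu.
exists (fun k => @rV_uncons R n @^-1` (F k `*` G k)) => [|k].
  rewrite -preimage_bigcup (_ : \bigcup_k _ = setT) ?preimage_setT//.
  apply/seteqP; split => // -[x v] _.
  have [i _ Fi] : (\bigcup_i F i) x by rewrite -TF.
  have [j _ Gj] : (\bigcup_j G j) v by rewrite -TG.
  exists (maxn i j) => //; split => /=.
    by move: Fi; apply/subsetPset/ndF/leq_maxl.
  by move: Gj; apply/subsetPset/ndG/leq_maxr.
have [[mF Fk] [mG Gk]] := (Foo k, Goo k); split.
  rewrite -[X in measurable X]setTI; apply: measurable_rV_uncons => //.
  exact: measurableX.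
rewrite /nu /pushforward -comp_preimage (_ : _ \o _ = id) ?preimage_id//.
  by rewrite product_measure1E// lte_mul_pinfty// ge0_fin_numE.
by apply/funext => z /=; rewrite rV_consK.
Qed.

HB.instance Definition _ :=
  Measure_isSigmaFinite.Build _ _ _ nu nu_sigma_finite.

End step.

(* Iterated product of the one-dimensional Lebesgue measure, transported along
   R * R^m = R^(m+1); see lebesgue_rV_box. *)
Fixpoint lebesgue_rV n : {sigma_finite_measure set 'rV[R]_n -> \bar R} :=
  match n with
  | 0 => \d_(0 : 'rV[R]_0)
  | m.+1 => lebesgue_rV_step (lebesgue_rV m)
  end.

Lemma measurable_rV_box n (a b : 'rV[R]_n) :
  measurable [set x : 'rV[R]_n | forall i, x 0 i \in `[a 0 i, b 0 i]].
Proof.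
rewrite (_ : mkset _ =
    \bigcap_(i in [set: 'I_n]) (@rV_coord R n i @^-1` `[a 0 i, b 0 i])).
  apply: fin_bigcap_measurable => // i _; rewrite -[X in measurable X]setTI.
  exact: measurable_rV_coord.
by apply/seteqP; split => [x xab i _|x xab i]; [exact: xab|exact: xab].
Qed.

Lemma lebesgue_rV_box n (a b : 'rV[R]_n) : (forall i, a 0 i <= b 0 i) ->
  lebesgue_rV n [set x : 'rV[R]_n | forall i, x 0 i \in `[a 0 i, b 0 i]] =
  (\prod_i (b 0 i - a 0 i))%:E.
Proof.
elim: n => [|n ih] in a b *.
  by move=> _; rewrite big_ord0 /= diracE mem_set//; case.
move=> ab; rewrite -[LHS]/((@lebesgue_measure R \x lebesgue_rV n)%E
  (@rV_cons R n @^-1` [set x : 'rV[R]_n.+1 | forall i, x 0 i \in `[a 0 i, b 0 i]])).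
pose a' : 'rV[R]_n := \row_i a 0 (lift ord0 i).
pose b' : 'rV[R]_n := \row_i b 0 (lift ord0 i).
have -> : @rV_cons R n @^-1` [set x : 'rV[R]_n.+1 | forall i, x 0 i \in `[a 0 i, b 0 i]] =
    `[a 0 ord0, b 0 ord0]%classic `*`
    [set x : 'rV[R]_n | forall i, x 0 i \in `[a' 0 i, b' 0 i]].
  apply/seteqP; split => [z/= H|z/= [H0 H] i].
    split; first by have := H ord0; rewrite rV_cons0.
    by move=> i; have := H (lift ord0 i); rewrite rV_consS !mxE.
  case: (unliftP ord0 i) => [j|] ->; last by rewrite rV_cons0.
  by rewrite rV_consS; have := H j; rewrite !mxE.
rewrite product_measure1E//; last exact: measurable_rV_box.
rewrite [X in (_ * X)%E]ih => [|i]; last by rewrite !mxE.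
rewrite big_ord_recl EFinM; congr (_ * _)%E; last first.
  by congr EFin; apply: eq_bigr => i _; rewrite !mxE.
rewrite [LHS]lebesgue_measure_itv/= lte_fin.
case: ltP => // ba; have /eqP -> : a 0 ord0 == b 0 ord0 by rewrite eq_le ab.
by rewrite subrr.
Qed.

End lebesgue_rV_measure.
Arguments lebesgue_rV : clear implicits.

Section euclidean.
Context {R : realType}.

(* The library's norm on row vectors is the sup norm; it induces the same
   topology as [enorm]. *)
Definition dotp n (u v : 'rV[R]_n) : R := \sum_i u 0 i * v 0 i.

Definition enorm n (u : 'rV[R]_n) : R := Num.sqrt (dotp u u).

Definition partial n (i : 'I_n) (f : 'rV[R]_n -> R) : 'rV[R]_n -> R :=
  fun x => 'D_(delta_mx 0 i) f x.

Definition gradient n (f : 'rV[R]_n -> R) (x : 'rV[R]_n) : 'rV[R]_n :=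
  \row_i partial i f x.

(* f is of class C^k on the open set U. *)
Fixpoint Ck_on n (k : nat) (U : set 'rV[R]_n) (f : 'rV[R]_n -> R) : Prop :=
  (forall x, U x -> {for x, continuous f}) /\
  match k with
  | 0 => True
  | k'.+1 => forall i : 'I_n,
      (forall x, U x -> derivable f x (delta_mx 0 i)) /\
      Ck_on k' U (partial i f)
  end.

(* C_0^oo(U); functions are extended by 0 outside of U. *)
Definition Cc_infty n (U : set 'rV[R]_n) (f : 'rV[R]_n -> R) : Prop :=
  let supp := closure [set x | f x != 0] in
  [/\ forall k, Ck_on k setT f, compact supp & supp `<=` U].

Definition is_domain n (Omega : set 'rV[R]_n) : Prop :=
  [/\ Omega !=set0, open Omega & connected Omega].

Definition is_convex n (Omega : set 'rV[R]_n) : Prop :=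
  convex_set (Omega : set (convex_lmodType 'rV[R]_n)).

Definition exterior n (Omega : set 'rV[R]_n) : set 'rV[R]_n := ~` closure Omega.

Definition boundary n (Omega : set 'rV[R]_n) : set 'rV[R]_n :=
  closure Omega `\` interior Omega.

Definition is_rotation n (Q : 'M[R]_n) : Prop := Q *m Q^T = 1%:M /\ \det Q = 1.

(* [col' j z] is z with its j-th coordinate removed, so that in the rotated
   coordinates z = x *m Q the boundary is, near y, the graph
   z_j = phi (z_i, i != j). *)
Definition C2_boundary n (Omega : set 'rV[R]_n) : Prop :=
  forall y, boundary Omega y ->
  exists (Q : 'M[R]_n) (j : 'I_n)
         (V : set 'rV[R]_n.-1) (phi : 'rV[R]_n.-1 -> R),
    [/\ is_rotation Q, open V, V (col' j (y *m Q)), Ck_on 2 V phi &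
      \forall x \near y,
        boundary Omega x <-> (x *m Q) 0 j = phi (col' j (x *m Q))].

Definition is_curve n (S : set 'rV[R]_n) (y v : 'rV[R]_n) (g : R -> 'rV[R]_n)
    : Prop :=
  [/\ g 0 = y, \forall t \near 0, S (g t) & is_derive (0 : R) (1 : R) g v].

Definition tangent n (S : set 'rV[R]_n) (y v : 'rV[R]_n) : Prop :=
  exists g, is_curve S y v g.

(* For a vector field N on the hypersurface S and v tangent to S at y:
   the derivative of N at y in the direction v exists and equals w. *)
Definition is_deriv_along n (S : set 'rV[R]_n) (N : 'rV[R]_n -> 'rV[R]_n)
    (y v w : 'rV[R]_n) : Prop :=
  tangent S y v /\
  forall g, is_curve S y v g -> is_derive (0 : R) (1 : R) (N \o g) w.

Definition is_outer_normal n (Omega : set 'rV[R]_n) (y nu : 'rV[R]_n) : Prop :=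
  [/\ enorm nu = 1,
      forall v, tangent (boundary Omega) y v -> dotp nu v = 0 &
      \forall t \near 0^'+, exterior Omega (y + t *: nu)].

(* Unique when the boundary is C^2; junk value 0 if there is none. *)
Definition outer_normal n (Omega : set 'rV[R]_n) (y : 'rV[R]_n) : 'rV[R]_n :=
  xget 0 [set nu | is_outer_normal Omega y nu].

Definition is_principal_curvatures n (Omega : set 'rV[R]_n) (y : 'rV[R]_n)
    (kappa : 'rV[R]_n.-1) : Prop :=
  exists v : 'I_n.-1 -> 'rV[R]_n,
    (forall i j, dotp (v i) (v j) = (i == j)%:R) /\
    (forall i, is_deriv_along (boundary Omega) (outer_normal Omega) y
                 (v i) (kappa 0 i *: v i)).

(* Well defined up to the order of the entries, which is irrelevant in
   kappa_tilde. *)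
Definition principal_curvatures n (Omega : set 'rV[R]_n) (y : 'rV[R]_n)
    : 'rV[R]_n.-1 :=
  xget 0 [set kappa | is_principal_curvatures Omega y kappa].

Definition delta n (Omega : set 'rV[R]_n) (x : 'rV[R]_n) : R :=
  inf [set enorm (x - z) | z in closure Omega].

Definition is_nearest n (Omega : set 'rV[R]_n) (x y : 'rV[R]_n) : Prop :=
  boundary Omega y /\ enorm (x - y) = delta Omega x.

Definition nearest n (Omega : set 'rV[R]_n) (x : 'rV[R]_n) : 'rV[R]_n :=
  xget 0 [set y | is_nearest Omega x y].

Definition kappa_tilde n (Omega : set 'rV[R]_n) (x : 'rV[R]_n) : R :=
  let kappa := principal_curvatures Omega (nearest Omega x) in
  \sum_i kappa 0 i / (1 + delta Omega x * kappa 0 i).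

End euclidean.

(* Main.v *)
(* The field |f|^p delta^(1-p) grad delta is compactly supported in the exterior,
   so its divergence has integral zero.  As |grad delta| = 1 and
   Laplacian delta = kappa_tilde, this divergence equals
     kappa_tilde |f|^p delta^(1-p) + p |f|^(p-1) sgn(f) <grad f, grad delta> delta^(1-p)
     - (p-1) |f|^p delta^(-p),
   and Young's inequality applied to the middle term gives the claim.

   The gradient of delta at x is the outer normal N at the nearest point y of x;
   by convexity the nearest point is a 1-Lipschitz function of x.  The C^2
   hypothesis yields a symmetric B with N(z) - N(y) = (z - y) B + o(|z - y|) on
   the boundary, and together with x = y + delta N(y) this determines the
   derivative of grad delta at x: its eigenvalues are kappa_i / (1 + delta kappa_i),
   and 0 in the direction N(y).

   The partial derivatives of the field are thereby bounded, and no continuity of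
   them is needed: the integrals of the difference quotients vanish because
   Lebesgue measure is translation invariant, and dominated convergence passes to
   the limit. *)

(* The nearest point, the outer normal and the curvatures are values of a choice operator, so
   existence and uniqueness must be settled before anything is known about them. For the nearest
   point, convexity does this through obtuse-angle inequalities, which also yield the Lipschitz
   bounds and the first-order expansion of the distance. The [C^2] hypothesis enters through the
   outer normal: graph coordinates leave a single normal line, and the Hessian of the graph function
   gives the differential of the normal.

   The constant comes from multiplying the divergence by [lambda ^ (p - 1)] before Young's
   inequality with exponents [p] and [p / (p - 1)]. The curvature term aside, there remains [(p - 1)
   * (1 - lambda) * lambda ^ (p - 1)] times [|f| ^ p / delta ^ p]; this factor is largest at
   [lambda = (p - 1) / p], where it equals [lambda ^ p].

   As the curvatures are chosen point by point, measurability of [kappa_tilde] is not obvious; it is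
   read off the formula for the divergence, whose partial derivatives are limits of difference
   quotients. *)
Require Import Defs.
From mathcomp Require Import all_boot all_order all_algebra.
From mathcomp Require Import all_classical all_reals all_analysis.
From mathcomp Require Import measurable_realfun.
From mathcomp Require Import ring lra.

Import Order.TTheory GRing.Theory Num.Theory.
Import numFieldNormedType.Exports.

Local Open Scope classical_set_scope.
Local Open Scope ring_scope.

Set Implicit Arguments.
Unset Strict Implicit.
Unset Printing Implicit Defensive.

(** * Euclidean geometry of row vectors *)

Section euclid.
Context {R : realType} {n : nat}.
Implicit Types u v w : 'rV[R]_n.

Lemma dotpE u v : dotp u v = (u *m v^T) 0 0.
Proof. by rewrite mxE; apply: eq_bigr => i _; rewrite mxE. Qed.

Lemma dotpC u v : dotp u v = dotp v u.
Proof. by apply: eq_bigr => i _; rewrite mulrC. Qed.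

Lemma dotpDl u v w : dotp (u + v) w = dotp u w + dotp v w.
Proof. by rewrite -big_split/=; apply: eq_bigr => i _; rewrite mxE mulrDl. Qed.

Lemma dotpZl a u v : dotp (a *: u) v = a * dotp u v.
Proof. by rewrite mulr_sumr; apply: eq_bigr => i _; rewrite mxE mulrA. Qed.

Lemma dotpNl u v : dotp (- u) v = - dotp u v.
Proof. by rewrite -scaleN1r dotpZl mulN1r. Qed.

Lemma dotpBl u v w : dotp (u - v) w = dotp u w - dotp v w.
Proof. by rewrite dotpDl dotpNl. Qed.

Lemma dotpDr u v w : dotp u (v + w) = dotp u v + dotp u w.
Proof. by rewrite dotpC dotpDl !(dotpC u). Qed.

Lemma dotpZr a u v : dotp u (a *: v) = a * dotp u v.
Proof. by rewrite dotpC dotpZl (dotpC u). Qed.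

Lemma dotpNr u v : dotp u (- v) = - dotp u v.
Proof. by rewrite dotpC dotpNl (dotpC u). Qed.

Lemma dotpBr u v w : dotp u (v - w) = dotp u v - dotp u w.
Proof. by rewrite dotpDr dotpNr. Qed.

Lemma dotp0r u : dotp u 0 = 0.
Proof. by rewrite -(scale0r u) dotpZr mul0r. Qed.

Lemma dotp0l u : dotp 0 u = 0.
Proof. by rewrite dotpC dotp0r. Qed.

Lemma dotp_ge0 u : 0 <= dotp u u.
Proof. by apply: sumr_ge0 => i _; rewrite -expr2 sqr_ge0. Qed.

Lemma dotp_eq0 u : dotp u u = 0 -> u = 0.
Proof.
move=> /eqP; rewrite psumr_eq0 => [/allP h|i _]; last by rewrite -expr2 sqr_ge0.
apply/rowP => i; rewrite mxE; have := h i; rewrite mem_index_enum => /(_ isT).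
by rewrite mulf_eq0 orbb => /eqP.
Qed.

Lemma enorm_ge0 u : 0 <= enorm u. Proof. exact: sqrtr_ge0. Qed.

Lemma enorm_sqr u : enorm u ^+ 2 = dotp u u.
Proof. by rewrite sqr_sqrtr// dotp_ge0. Qed.

Lemma enorm_eq0 u : enorm u = 0 -> u = 0.
Proof. by move=> h; apply: dotp_eq0; rewrite -enorm_sqr h expr0n. Qed.

Lemma enorm0 : enorm (0 : 'rV[R]_n) = 0.
Proof. by rewrite /enorm dotp0r sqrtr0. Qed.

Lemma enorm_gt0 u : u != 0 -> 0 < enorm u.
Proof.
by move=> u0; rewrite lt_neqAle enorm_ge0 andbT; apply: contra_neq u0 => /esym/enorm_eq0.
Qed.

Lemma enormZ a u : enorm (a *: u) = `|a| * enorm u.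
Proof.
by rewrite /enorm dotpZl dotpZr mulrA -expr2 sqrtrM ?sqr_ge0// sqrtr_sqr.
Qed.

Lemma enormN u : enorm (- u) = enorm u.
Proof. by rewrite -scaleN1r enormZ normrN1 mul1r. Qed.

Lemma enormC u v : enorm (u - v) = enorm (v - u).
Proof. by rewrite -enormN opprB. Qed.

Lemma enorm_le u v : dotp u u <= dotp v v -> enorm u <= enorm v.
Proof. by move=> h; rewrite ler_sqrt ?dotp_ge0. Qed.

Lemma enorm_dotp1 u : dotp u u = 1 -> enorm u = 1.
Proof. by rewrite /enorm => ->; rewrite sqrtr1. Qed.

Lemma cauchy_schwarz u v : dotp u v <= enorm u * enorm v.
Proof.
have [->|u0] := eqVneq u 0; first by rewrite dotp0l enorm0 mul0r.
have [->|v0] := eqVneq v 0; first by rewrite dotp0r enorm0 mulr0.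
have := dotp_ge0 ((enorm v) *: u - (enorm u) *: v).
rewrite !(dotpBl, dotpBr, dotpZl, dotpZr) -!enorm_sqr (dotpC v u).
have := enorm_gt0 u0; have := enorm_gt0 v0; set a := enorm u; set b := enorm v.
move=> b0 a0 h; have ab : 0 < a * b by rewrite mulr_gt0.
have : 0 <= 2 * (a * b) * (a * b - dotp u v) by move: h; congr (_ <= _); ring.
by rewrite pmulr_rge0 ?mulr_gt0// subr_ge0.
Qed.

Lemma cauchy_schwarz_norm u v : `|dotp u v| <= enorm u * enorm v.
Proof.
rewrite ler_norml cauchy_schwarz andbT -lerN2 opprK -dotpNl.
by rewrite (le_trans (cauchy_schwarz _ _))// enormN.
Qed.

Lemma enormD u v : enorm (u + v) <= enorm u + enorm v.
Proof.
rewrite -(@ler_pXn2r _ 2)// ?nnegrE ?addr_ge0 ?enorm_ge0//.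
rewrite sqrrD !enorm_sqr dotpDl !dotpDr (dotpC v u).
have := cauchy_schwarz u v; lra.
Qed.

Lemma enormB u v : enorm (u - v) <= enorm u + enorm v.
Proof. by rewrite (le_trans (enormD _ _))// enormN. Qed.

Lemma enorm_triangle v u w : enorm (u - w) <= enorm (u - v) + enorm (v - w).
Proof. by rewrite (le_trans _ (enormD _ _))// addrA subrK. Qed.

Lemma enorm_dist u v : `|enorm u - enorm v| <= enorm (u - v).
Proof.
have := enormD (u - v) v; have := enormD (v - u) u; rewrite !subrK (enormC v u).
by rewrite ler_norml; lra.
Qed.

Lemma coord_le_enorm u i : `|u 0 i| <= enorm u.
Proof.
rewrite -sqrtr_sqr ler_sqrt ?dotp_ge0// expr2 /dotp (bigD1 i)//= lerDl.
by apply: sumr_ge0 => j _; rewrite -expr2 sqr_ge0.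
Qed.

Lemma coord_le_norm u i : `|u 0 i| <= `|u|.
Proof.
rewrite [leRHS]/Num.Def.normr/= mx_normrE.
by apply/bigmax_geP; right => /=; exists (0, i).
Qed.

Lemma norm_le_enorm u : `|u| <= enorm u.
Proof.
rewrite [leLHS]/Num.Def.normr/= mx_normrE (bigmax_le _ (enorm_ge0 _))//= => -[j i] _.
by rewrite (ord1 j) coord_le_enorm.
Qed.

Lemma enorm_le_norm u : enorm u <= n%:R * `|u|.
Proof.
rewrite -(@ler_pXn2r _ 2)// ?nnegrE ?mulr_ge0 ?enorm_ge0//.
rewrite enorm_sqr exprMn.
have : dotp u u <= n%:R * `|u| ^+ 2.
  have -> : n%:R * `|u| ^+ 2 = \sum_(i < n) `|u| ^+ 2.
    by rewrite sumr_const card_ord mulr_natl.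
  apply: ler_sum => i _; rewrite -expr2 -real_normK ?num_real//.
  by rewrite ler_pXn2r ?nnegrE// coord_le_norm.
move=> /le_trans; apply; apply: ler_wpM2r; first by rewrite sqr_ge0.
rewrite -natrX ler_nat; by case: (n) => // k; rewrite -mulnn leq_pmull.
Qed.

(** This is where the sup norm of the library is traded for the Euclidean one. Dividing by
    [n.+1%:R], here and below, keeps the radius positive when [n = 0]. *)
Lemma near_enormP (y : 'rV[R]_n) (P : set 'rV[R]_n) :
  (\forall x \near y, P x) <->
  exists2 e, 0 < e & forall x, enorm (x - y) < e -> P x.
Proof.
split.
  move=> /nbhs_normP[e /= e0 h]; exists e => // x xe; apply: h => /=.
  by rewrite distrC (le_lt_trans (norm_le_enorm _)).
move=> [e e0 h]; apply/nbhs_normP; exists (e / n.+1%:R); first by rewrite /= divr_gt0.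
move=> x /= xe; apply: h; rewrite (le_lt_trans (enorm_le_norm _))//.
move: xe; rewrite distrC ltr_pdivlMr// mulrC; apply: le_lt_trans.
by rewrite ler_wpM2r// ler_nat.
Qed.

Lemma open_enormP (U : set 'rV[R]_n) : open U <->
  forall y, U y -> exists2 e, 0 < e & forall x, enorm (x - y) < e -> U x.
Proof.
split.
  by move=> oU y Uy; apply/near_enormP; exact: open_nbhs_nbhs.
move=> h; rewrite openE => y Uy; exact/near_enormP/h.
Qed.

Lemma closure_enormP (A : set 'rV[R]_n) y : closure A y <->
  forall e, 0 < e -> exists2 x, A x & enorm (x - y) < e.
Proof.
split.
  move=> cA e e0; have [|x [Ax xe]] := cA [set x | enorm (x - y) < e].
    by apply/near_enormP; exists e.
  by exists x.
move=> h B /near_enormP[e e0 eB]; have [x Ax xe] := h e e0.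
by exists x; split => //; exact: eB.
Qed.

Lemma continuous_enormP (f : 'rV[R]_n -> R) (x : 'rV[R]_n) :
  {for x, continuous f} <->
  forall e, 0 < e -> exists2 d, 0 < d & forall z, enorm (z - x) < d -> `|f z - f x| < e.
Proof.
split.
  move=> cf e e0; apply/near_enormP; move/cvgrPdist_lt: cf => /(_ e e0).
  by apply: filterS => z; rewrite distrC.
move=> h; apply: (proj2 (@cvgrPdist_lt R R^o 'rV[R]_n (nbhs x) _ f (f x))) => e e0; have [d d0 hd] := h e e0.
by apply/near_enormP; exists d => // z /hd; rewrite distrC.
Qed.

Lemma continuous_dotp u : continuous (dotp u).
Proof.
move=> x; apply/continuous_enormP => e e0; exists (e / (enorm u + 1)).
  by rewrite divr_gt0// ltr_wpDl ?enorm_ge0.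
move=> z; rewrite ltr_pdivlMr ?ltr_wpDl ?enorm_ge0// => h.
rewrite -dotpBr (le_lt_trans (cauchy_schwarz_norm _ _))//.
rewrite (le_lt_trans _ h)// mulrC ler_wpM2l ?enorm_ge0//; lra.
Qed.

Lemma continuous_enorm : continuous (@enorm R n).
Proof.
move=> x; apply/continuous_enormP => e e0; exists e => // z.
exact/le_lt_trans/enorm_dist.
Qed.

Lemma compact_enorm (A : set 'rV[R]_n) M : closed A ->
  (forall x, A x -> enorm x <= M) -> compact A.
Proof.
move=> cA AM; apply: bounded_closed_compact => //; exists M; split.
  exact: num_real.
by move=> x Mx y /= /AM yM; rewrite (le_trans (norm_le_enorm _))// (le_trans yM)// ltW.
Qed.

Lemma dotp_delta u i : dotp u (delta_mx 0 i) = u 0 i.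
Proof.
rewrite /dotp (bigD1 i)//= mxE !eqxx mulr1 big1 ?addr0// => j ji.
by rewrite mxE (negbTE ji) andbF mulr0.
Qed.

Lemma enorm_delta i : enorm (delta_mx 0 i : 'rV[R]_n) = 1.
Proof. by apply: enorm_dotp1; rewrite dotp_delta mxE !eqxx. Qed.

Lemma coord_continuous1 i (x : 'rV[R]_n) : {for x, continuous (fun z : 'rV[R]_n => z 0 i)}.
Proof.
apply/continuous_enormP => e e0; exists e => // z.
apply: le_lt_trans; have := coord_le_enorm (z - x) i.
by rewrite !mxE.
Qed.

End euclid.

Lemma dotp_mulmx {R : realType} m n (u : 'rV[R]_m) (A : 'M[R]_(m, n)) (v : 'rV[R]_n) :
  dotp (u *m A) v = dotp u (v *m A^T).
Proof. by rewrite !dotpE trmx_mul trmxK mulmxA. Qed.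

Lemma mulmx_enorm_bound {R : realType} n m (B : 'M[R]_(n, m)) :
  exists2 K, 0 < K & forall u : 'rV[R]_n, enorm (u *m B) <= K * enorm u.
Proof.
pose K := \sum_(i < n) enorm (row i B) + 1.
exists K; first by rewrite ltr_wpDl// sumr_ge0// => i _; exact: enorm_ge0.
move=> u; rewrite mulmx_sum_row.
apply: (@le_trans _ _ (\sum_(i < n) enorm (u 0 i *: row i B))).
  elim/big_ind2 : _ => [|a b c d h1 h2|//]; first by rewrite enorm0.
  by rewrite (le_trans (enormD _ _))// lerD.
rewrite mulrDl mul1r -[leLHS]addr0 lerD ?enorm_ge0// mulr_suml.
apply: ler_sum => i _; rewrite enormZ mulrC ler_wpM2l ?enorm_ge0//.
exact: coord_le_enorm.
Qed.

Lemma continuous_sum_fin {R : realType} (T : topologicalType) (I : finType)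
    (F : I -> T -> R) (x : T) :
  (forall i, {for x, continuous (F i)}) ->
  {for x, continuous (fun z => \sum_i F i z)}.
Proof.
move=> cF; exact: (@cvg_big R I +%R 0 xpredT add_continuous T (nbhs x)
  (index_enum I) F (fun i => F i x) _ (fun i _ => cF i)).
Qed.

Section pointwise_continuity.
Context {R : realType} (T : topologicalType).
Implicit Types (f g : T -> R) (x : T).

Lemma continuous_mulf f g x : {for x, continuous f} -> {for x, continuous g} ->
  {for x, continuous (fun z => f z * g z)}.
Proof. by move=> cf cg; exact: (cvgM cf cg). Qed.

Lemma continuous_invf f x : f x != 0 -> {for x, continuous f} ->
  {for x, continuous (fun z => (f z)^-1)}.
Proof. by move=> f0 cf; exact: (cvgV f0 cf). Qed.

End pointwise_continuity.

(** * Orthonormal eigenvectors of symmetric matrices *)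

Section spectral.
Context {R : realType}.

(** First-order condition at a maximum: for small [t] of the sign of [a] the linear term dominates,
    and [t = a / (|c - b| + 1)] is small enough. *)
Lemma quad_vanish (a b c : R) : (forall t, 2 * t * a + t ^+ 2 * b <= t ^+ 2 * c) -> a = 0.
Proof.
move=> h; apply/eqP; apply: contraT => a0.
have d0 : 0 < `|c - b| + 1 by rewrite ltr_wpDl.
have := h (a / (`|c - b| + 1)); set d := `|c - b| + 1 in d0 *.
have cb : c - b <= d - 1 by rewrite /d addrK ler_norm.
have -> : 2 * (a / d) * a = 2 * d * (a / d) ^+ 2 by field; rewrite gt_eqF.
have : 0 < (a / d) ^+ 2 by rewrite exprn_even_gt0//= mulf_neq0// invr_eq0 gt_eqF.
by set q := (_ ^+ 2) => q0 hh; nra.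
Qed.

(* [u] maximizes the quadratic form of [B] on the unit sphere of the orthogonal
   complement of the row space of [V]. *)
Lemma exists_eigenvector m k (B : 'M[R]_m) (V : 'M[R]_(k, m)) :
  B^T = B -> (k < m)%N -> (V *m B <= V)%MS ->
  exists u : 'rV[R]_m, [/\ dotp u u = 1, V *m u^T = 0 & exists a, u *m B = a *: u].
Proof.
move=> symB km VB.
have orth_invar (w : 'rV[R]_m) : V *m w^T = 0 -> V *m (w *m B)^T = 0.
  by move=> Vw; rewrite trmx_mul symB mulmxA; have /submxP[D ->] := VB; rewrite -mulmxA Vw mulmx0.
have [w0 w00 Vw0] : exists2 w : 'rV[R]_m, w != 0 & V *m w^T = 0.
  have r0 : kermx V^T != 0.
    rewrite -mxrank_eq0 mxrank_ker mxrank_tr -lt0n subn_gt0.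
    exact: leq_ltn_trans (rank_leq_row _) km.
  have /rowV0Pn[w /sub_kermxP wV w0] := r0.
  by exists w => //; apply: trmx_inj; rewrite trmx_mul trmxK wV trmx0.
pose A := [set w : 'rV[R]_m | dotp w w = 1 /\ V *m w^T = 0].
have A0 : A !=set0.
  exists ((enorm w0)^-1 *: w0); split.
    rewrite dotpZl dotpZr -enorm_sqr; field.
    by rewrite gt_eqF// enorm_gt0.
  by rewrite linearZ/= -scalemxAr Vw0 scaler0.
have cA : compact A.
  apply: (@compact_enorm _ _ _ 1); last by move=> x [/enorm_dotp1 ->].
  have -> : A = [set w | enorm w = 1] `&` \bigcap_(i in [set: 'I_k]) [set w | dotp (row i V) w = 0].
    apply/seteqP; split => w [h1 h2]; split.
    - exact: enorm_dotp1.
    - by move=> i _ /=; rewrite dotpE -row_mul h2 !mxE.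
    - by rewrite -enorm_sqr h1 expr1n.
    - apply/matrixP => i j; rewrite (ord1 j) [RHS]mxE.
      by have := h2 i I; rewrite /= dotpE -row_mul mxE.
  apply: closedI.
    by apply: (@closed_comp _ _ (@enorm R m) [set 1]) => [x _|]; [exact: continuous_enorm|exact: closed_eq].
  apply: closed_bigI => i _.
  by apply: (@closed_comp _ _ (dotp (row i V)) [set 0]) => [x _|]; [exact: continuous_dotp|exact: closed_eq].
have cq : continuous (fun w : 'rV[R]_m => dotp (w *m B) w).
  move=> x; rewrite /dotp; apply: continuous_sum_fin => i.
  apply: continuous_mulf; last exact: coord_continuous1.
  rewrite (_ : (fun w : 'rV_m => (w *m B) 0 i) = dotp (row i B^T)); first exact: continuous_dotp.
  apply/funext => w; rewrite mxE /dotp; apply: eq_bigr => j _.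
  by rewrite !mxE mulrC.
have [u + umax] := EVT_max_rV A0 cA (continuous_subspaceT cq).
rewrite inE => -[u1 Vu]; exists u; split => //.
exists (dotp (u *m B) u); apply/eqP; rewrite -subr_eq0; apply/eqP.
have [r rE] : exists r : 'rV[R]_m, r = u *m B - dotp (u *m B) u *: u by eexists.
rewrite -rE; apply: dotp_eq0.
have Vr : V *m r^T = 0.
  rewrite rE linearB/= linearZ/= mulmxBr orth_invar// -scalemxAr Vu scaler0 subr0//.
have ur : dotp u r = 0 by rewrite rE dotpBr dotpZr u1 mulr1 dotpC subrr.
suff : dotp (u *m B) r = 0.
  by move=> h; rewrite {1}rE dotpBl dotpZl ur mulr0 h subrr.
have BC x y : dotp (x *m B) y = dotp (y *m B) x.
  by rewrite dotp_mulmx symB dotpC.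
(* Maximality of [u] is tested on the normalized vector [u + t *: r]. Clearing its squared length
   [1 + t ^+ 2 * dotp r r] gives exactly the hypothesis of [quad_vanish]. *)
apply: (@quad_vanish _ (dotp (r *m B) r) (dotp (u *m B) u * dotp r r)) => t.
set q := dotp (u *m B) u in umax *.
pose x := u + t *: r.
have xx : dotp x x = 1 + t ^+ 2 * dotp r r.
  by rewrite /x !(dotpDl, dotpDr, dotpZl, dotpZr) u1 (dotpC r u) ur; ring.
have x0 : 0 < dotp x x by rewrite xx ltr_wpDr// mulr_ge0 ?sqr_ge0 ?dotp_ge0.
have := umax ((enorm x)^-1 *: x); rewrite inE => /(_ _)/wrap[].
  split.
    rewrite dotpZl dotpZr -enorm_sqr; field; rewrite gt_eqF// enorm_gt0//.
    by apply: contraTneq x0 => ->; rewrite dotp0l ltxx.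
  by rewrite linearZ/= -scalemxAr linearD/= linearZ/= mulmxDr Vu -scalemxAr Vr scaler0 addr0 scaler0.
rewrite -scalemxAl dotpZl dotpZr mulrA -expr2 exprVn enorm_sqr.
rewrite ler_pdivrMl// xx /x mulmxDl -scalemxAl.
rewrite !(dotpDl, dotpDr, dotpZl, dotpZr) (BC r u) -/q.
by move=> h; lra.
Qed.

(** By induction on [k]: [N] and the eigenvectors already found span a [B]-invariant space, so
    another one exists in its orthogonal complement. The direction [N] takes up one dimension,
    whence [k < m]. *)
Lemma spectral_orthonormal m k (B : 'M[R]_m) (N : 'rV[R]_m) :
  B^T = B -> N *m B = 0 -> dotp N N = 1 -> (k < m)%N ->
  exists (V : 'M[R]_(k, m)) (d : 'I_k -> R),
    [/\ V *m V^T = 1%:M, V *m N^T = 0 &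
        forall i, row i V *m B = d i *: row i V].
Proof.
move=> symB NB NN; elim: k => [_|k ih km].
  by exists 0, (fun=> 0); split => [||[]//]; apply/matrixP => -[].
have [V [d [VV VN Vd]]] := ih (ltnW km).
have stab : (col_mx N V *m B <= col_mx N V)%MS.
  rewrite mul_col_mx col_mx_sub NB sub0mx/=.
  apply: (@submx_trans _ _ _ _ _ _ V).
    by apply/row_subP => i; rewrite row_mul Vd scalemx_sub// row_sub.
  by rewrite -addsmxE addsmxSr.
have [u [uu Wu [a ua]]] := @exists_eigenvector m (1 + k) B (col_mx N V) symB km stab.
have Nu : N *m u^T = 0.
  by move/(congr1 usubmx): (Wu); rewrite mul_col_mx col_mxKu linear0.
have Vu : V *m u^T = 0.
  by move/(congr1 dsubmx): (Wu); rewrite mul_col_mx col_mxKd linear0.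
have uV : u *m V^T = 0 by rewrite -[u]trmxK -trmx_mul Vu trmx0.
have uN : u *m N^T = 0 by rewrite -[u]trmxK -trmx_mul Nu trmx0.
have uu1 : u *m u^T = 1%:M.
  by apply/matrixP => i j; rewrite !ord1 -dotpE uu mxE.
pose W : 'M[R]_(1 + k, m) := col_mx u V.
pose e (i : 'I_(1 + k)) := match fintype.split i with inl _ => a | inr j => d j end.
have WW : W *m W^T = 1%:M.
  by rewrite tr_col_mx mul_col_row uu1 uV Vu VV (scalar_mx_block 1 k 1).
have WN : W *m N^T = 0 by rewrite mul_col_mx uN VN col_mx0.
have We (i : 'I_(1 + k)) : row i W *m B = e i *: row i W.
  rewrite /e; case: (splitP i) => j ij.
    have -> : i = lshift k j by exact/val_inj.
    rewrite rowKu (_ : row j u = u) ?ua//.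
    by apply/rowP => l; rewrite !mxE (ord1 j).
  have -> : i = rshift 1 j by exact/val_inj.
  by rewrite rowKd.
by exists W, e; split; [exact: WW|exact: WN|exact: We].
Qed.

(** The square matrix [W] with rows [N] and [V i] satisfies [W *m W^T = 1], hence also
    [W^T *m W = 1]; the conclusion is the entry [(a, b)] of the latter. *)
Lemma orthonormal_complete m (V : 'I_m -> 'rV[R]_m.+1) (N : 'rV[R]_m.+1) :
  (forall i j, dotp (V i) (V j) = (i == j)%:R) -> (forall i, dotp (V i) N = 0) ->
  dotp N N = 1 ->
  forall a b, N 0 a * N 0 b + \sum_i V i 0 a * V i 0 b = (a == b)%:R.
Proof.
move=> VV VN NN a b.
pose W : 'M[R]_(1 + m, 1 + m) := col_mx N (\matrix_i V i).
have WW : W *m W^T = 1%:M.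
  rewrite tr_col_mx mul_col_row (scalar_mx_block 1 m 1); congr block_mx.
  - by apply/matrixP => i j; rewrite !ord1 -dotpE NN mxE.
  - apply/matrixP => i j; rewrite !ord1 [RHS]mxE.
    rewrite -[RHS](VN j) dotpC dotpE !mxE; apply: eq_bigr => k _.
    by rewrite !mxE.
  - apply/matrixP => i j; rewrite !ord1 [RHS]mxE.
    rewrite -[RHS](VN i) dotpE !mxE; apply: eq_bigr => k _.
    by rewrite !mxE.
  - apply/matrixP => i j; rewrite [RHS]mxE -mulr_natl mulr1 -VV dotpE !mxE.
    by apply: eq_bigr => k _; rewrite !mxE.
have /matrixP/(_ a b) := mulmx1C WW.
rewrite /W tr_col_mx mul_row_col !mxE big_ord1 !mxE => <-; congr (_ + _).
by apply: eq_bigr => k _; rewrite !mxE.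
Qed.

End spectral.

(** * Derivatives along lines and C^k functions *)

Section line_derivative.
Context {R : realType} {V W : normedModType R}.
Implicit Types (f : V -> W) (x v : V).

Lemma line_quotientE f x v (t : R) :
  (fun h : R => h^-1 *: (((fun s : R => f (x + s *: v)) \o shift t) (h *: (1 : R)) - f (x + t *: v))) =
  (fun h => h^-1 *: ((f \o shift (x + t *: v)) (h *: v) - f (x + t *: v))).
Proof.
apply/funext => h /=; congr (_ *: (f _ - _)).
by rewrite scalerDl [h *: 1]mulr1 addrCA.
Qed.

Lemma derivable_line f x v (t : R) :
  derivable f (x + t *: v) v -> derivable (fun s : R => f (x + s *: v)) t 1.
Proof. by rewrite /derivable line_quotientE. Qed.

Lemma derive_line f x v (t : R) :
  'D_1 (fun s : R => f (x + s *: v)) t = 'D_v f (x + t *: v).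
Proof. by rewrite /derive line_quotientE. Qed.

Lemma is_derive_line f x v (t : R) : derivable f (x + t *: v) v ->
  is_derive t (1 : R) (fun s : R => f (x + s *: v)) ('D_v f (x + t *: v)).
Proof. by move=> df; apply: DeriveDef; [exact: derivable_line|exact: derive_line]. Qed.

(** Through this equivalence the chain and product rules of one real variable apply to partial
    derivatives. *)
Lemma is_derive_line0 f x v l : is_derive x v f l <->
  is_derive (0 : R) (1 : R) (fun s : R => f (x + s *: v)) l.
Proof.
have x0 : x + (0 : R) *: v = x by rewrite scale0r addr0.
split=> -[df dfl].
  by rewrite -dfl -{2}x0; apply: is_derive_line; rewrite x0.
apply: DeriveDef; last by rewrite -dfl derive_line x0.
by move: df; rewrite /derivable line_quotientE x0.
Qed.

End line_derivative.

Lemma is_derive1P {R : realType} {W : normedModType R} (g : R -> W) (l : W) :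
  is_derive (0 : R) (1 : R) g l <->
  forall e, 0 < e -> exists2 d, 0 < d & forall t, 0 < `|t| -> `|t| < d ->
    `|g t - g 0 - t *: l| <= e * `|t|.
Proof.
have key : is_derive (0 : R) (1 : R) g l <->
    (fun h : R => h^-1 *: (g (h *: (1 : R) + 0) - g 0)) @ 0^' --> l.
  split=> [[dg dgl]|cg]; first by rewrite -dgl; exact: dg.
  by apply: DeriveDef; [apply/cvg_ex; exists l|exact/cvg_lim].
have quotE (t : R) : t != 0 -> `|l - t^-1 *: (g (t *: (1 : R) + 0) - g 0)| = `|g t - g 0 - t *: l| / `|t|.
  move=> t0; rewrite addr0 [t *: 1]mulr1.
  rewrite -(normfV t) mulrC -normrZ -normrN opprB; congr (`| _ |).
  by rewrite [RHS]scalerBr scalerA mulVf// scale1r.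
split.
  move=> /key/cvgrPdist_le h e e0.
  have : nbhs (0 : R) [set t | t != 0 -> `|l - t^-1 *: (g (t *: (1 : R) + 0) - g 0)| <= e].
    exact: (h e e0).
  move=> /nbhs_normP[d /= d0 hd]; exists d => // t t0 td.
  have tn0 : t != 0 by rewrite -normr_gt0.
  have := hd t; rewrite /= sub0r normrN => /(_ td tn0).
  by rewrite quotE// ler_pdivrMr.
move=> h; apply/key/cvgrPdist_le => e e0; have [d d0 hd] := h e e0.
suff : nbhs (0 : R) [set t | t != 0 -> `|l - t^-1 *: (g (t *: (1 : R) + 0) - g 0)| <= e] by [].
apply/nbhs_normP; exists d => // t /=; rewrite sub0r normrN => td tn0.
by rewrite quotE// ler_pdivrMr ?normr_gt0//; apply: hd => //; rewrite normr_gt0.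
Qed.

Lemma MVT_abs {R : realType} (g dg : R -> R) (s : R) :
  (forall t, `|t| <= `|s| -> is_derive t (1 : R) g (dg t)) ->
  exists2 t, `|t| <= `|s| & g s - g 0 = s * dg t.
Proof.
move=> h; have hc a b : (forall t, t \in `[a, b] -> `|t| <= `|s|) ->
    {within `[a, b], continuous g}.
  move=> ab; apply: derivable_within_continuous => t /ab /h dt.
  exact: ex_derive.
have [s0|s0] := leP 0 s.
  have b t : t \in `[0, s] -> `|t| <= `|s|.
    by rewrite in_itv/= => /andP[t0 ts]; rewrite !ger0_norm.
  have [t ts ->] := MVT_segment s0 (fun t ht => h t (b t (subset_itv_oo_cc ht))) (hc _ _ b).
  by exists t; [exact: b|rewrite subr0 mulrC].
have b t : t \in `[s, 0] -> `|t| <= `|s|.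
  by rewrite in_itv/= => /andP[st t0]; rewrite !ler0_norm ?lerN2// ltW.
have [t ts e] := MVT_segment (ltW s0) (fun t ht => h t (b t (subset_itv_oo_cc ht))) (hc _ _ b).
exists t; first exact: b.
by rewrite -opprB e sub0r mulrN opprK mulrC.
Qed.

(** * First-order expansion and symmetry of second partial derivatives *)

Section Ck.
Context {R : realType} {n : nat}.
Implicit Types (f : 'rV[R]_n -> R) (U : set 'rV[R]_n) (x w : 'rV[R]_n).

Lemma partial_MVT f x i (s : R) :
  (forall t, `|t| <= `|s| -> derivable f (x + t *: delta_mx 0 i) (delta_mx 0 i)) ->
  exists2 t, `|t| <= `|s| &
    f (x + s *: delta_mx 0 i) - f x = s * partial i f (x + t *: delta_mx 0 i).
Proof.
move=> df; have [t ts e] := MVT_abs (fun t ts => is_derive_line (df t ts)).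
by exists t => //; rewrite -e scale0r addr0.
Qed.

Lemma Ck_onW U f k : Ck_on k.+1 U f -> Ck_on k U f.
Proof.
elim: k f => [f [cf _]|k ih f [cf h]]; first by [].
by split => // i; have [di ci] := h i; split => //; exact: ih.
Qed.

(** From [x] to [x + w] one coordinate is changed at a time. The mean value theorem applies to each
    move, and continuity of the partial derivatives replaces their values on the way by those at
    [x]. *)
Lemma Ck_on1_expand U f x : open U -> U x -> Ck_on 1 U f ->
  forall e, 0 < e -> exists2 d, 0 < d & forall w, enorm w < d ->
    U (x + w) /\ `|f (x + w) - f x - dotp (gradient f x) w| <= e * enorm w.
Proof.
move=> oU Ux [cf h] e e0.
have e'0 : 0 < e / n.+1%:R by rewrite divr_gt0.
have : \forall z \near x, U z /\ forall i, `|partial i f z - partial i f x| < e / n.+1%:R.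
  near=> z; split; first by near: z; exact: open_nbhs_nbhs.
  near: z; apply: filter_forall => i; apply/near_enormP.
  by have [_ [/(_ _ Ux)/continuous_enormP/(_ _ e'0)]] := h i.
move=> /near_enormP[d d0 hd]; exists d => // w wd.
have xw : x + w - x = w by rewrite addrC addKr.
split; first by apply: (hd (x + w) _).1; rewrite xw.
(* [wk k] retains the first [k] coordinates of [w]; these are the corners of the path. *)
pose wk k : 'rV[R]_n := \row_i if (i < k)%N then w 0 i else 0.
have wk0 : wk 0 = 0 by apply/rowP => i; rewrite !mxE.
have wkn : wk n = w by apply/rowP => i; rewrite !mxE ltn_ord.
have wkS (k : 'I_n) : wk k.+1 = wk k + w 0 k *: delta_mx 0 k.
  apply/rowP => i; rewrite !mxE eqxx/= ltnS leq_eqVlt.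
  have [->|ik] := eqVneq i k; first by rewrite eqxx ltnn/= mulr1 add0r.
  by rewrite (inj_eq val_inj) (negbTE ik)/= mulr0 addr0.
have small (k : 'I_n) (t : R) : `|t| <= `|w 0 k| -> enorm (wk k + t *: delta_mx 0 k) <= enorm w.
  move=> tw; apply: enorm_le; apply: ler_sum => i _.
  rewrite -!expr2 -[leLHS]real_normK ?num_real// -[leRHS]real_normK ?num_real//.
  rewrite ler_pXn2r ?nnegrE// !mxE eqxx/=.
  have [->|ik] := eqVneq i k; first by rewrite ltnn mulr1 add0r.
  by rewrite mulr0 addr0; case: ifP => // _; rewrite normr0.
have step (k : 'I_n) : `|f (x + wk k.+1) - f (x + wk k) - w 0 k * partial k f x| <= e / n.+1%:R * enorm w.
  have near_x t : `|t| <= `|w 0 k| -> enorm (x + wk k + t *: delta_mx 0 k - x) < d.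
    have -> : x + wk k + t *: delta_mx 0 k - x = wk k + t *: delta_mx 0 k.
      by rewrite -(addrA x) (addrC x) addrK.
    by move=> /small tw; rewrite (le_lt_trans tw).
  have [t tw|t tw e1] := @partial_MVT f (x + wk k) k (w 0 k).
    by apply: (h k).1; apply: (hd _ (near_x t tw)).1.
  rewrite wkS addrA e1 -mulrBr normrM mulrC ler_pM//; last exact: coord_le_enorm.
  exact/ltW/(hd _ (near_x t tw)).2.
have -> : f (x + w) - f x = \sum_(k < n) (f (x + wk k.+1) - f (x + wk k)).
  rewrite -(big_mkord xpredT (fun k => f (x + wk k.+1) - f (x + wk k))).
  by rewrite (@telescope_sumr _ 0 n (fun k => f (x + wk k)))// wkn wk0 addr0.
rewrite -sumrB.
apply: (le_trans (ler_norm_sum _ _ _)).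
apply: (@le_trans _ _ (\sum_(i < n) e / n.+1%:R * enorm w)).
  by apply: ler_sum => i _; rewrite mxE [partial _ _ _ * _]mulrC; exact: step.
rewrite sumr_const card_ord -[leLHS]mulr_natl mulrA ler_wpM2r ?enorm_ge0//.
rewrite mulrCA ger_pMr// ler_pdivrMr// mul1r ler_nat//.
Unshelve. all: by end_near. Qed.

(** Here [a], [b], [c] stand for the values of [partial i f] at [x + t e_i], [x + s e_j + t e_i] and
    [x], and [p], [q] for its partial derivatives at [x] in the directions [i] and [j]. *)
Lemma second_difference_arith (s a b c p q t e : R) : 0 < s ->
  `|a - c - t * p| <= e / 3 * s -> `|b - c - (s * q + t * p)| <= e / 3 * (2 * s) ->
  `|s * (b - a) - s ^+ 2 * q| <= e * s ^+ 2.
Proof.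
move=> s0 h1 h2.
have -> : s * (b - a) - s ^+ 2 * q =
    s * ((b - c - (s * q + t * p)) - (a - c - t * p)) by ring.
rewrite normrM (gtr0_norm s0) expr2 mulrA (mulrC e) -mulrA ler_pM2l//.
apply: (le_trans (ler_normB _ _)); apply: (le_trans (lerD h2 h1)); lra.
Qed.

(** The second difference is the increment of [g] over [[0, s]]. The mean value theorem turns it
    into a difference of two values of [partial i f], to which the first-order expansion at [x]
    applies. *)
Lemma second_difference U f x i j : open U -> U x -> Ck_on 2 U f ->
  forall e, 0 < e -> exists2 d, 0 < d & forall s, 0 < s -> s < d ->
   `|f (x + s *: delta_mx 0 i + s *: delta_mx 0 j) - f (x + s *: delta_mx 0 i)
     - f (x + s *: delta_mx 0 j) + f x - s ^+ 2 * partial j (partial i f) x| <= e * s ^+ 2.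
Proof.
move=> oU Ux [cf h] e e0; have [dfi Ci] := h i.
have e4 : 0 < e / 3 by rewrite divr_gt0.
have [d d0 hd] := Ck_on1_expand oU Ux Ci e4.
exists (d / 2); first by rewrite divr_gt0.
move=> s s0 sd; set ei := delta_mx 0 i; set ej := delta_mx 0 j.
pose g (t : R) := f (x + s *: ej + t *: ei) - f (x + t *: ei).
have nei (t : R) : `|t| <= s -> enorm (t *: ei) <= s.
  by rewrite enormZ enorm_delta mulr1.
have nej : enorm (s *: ej) = s by rewrite enormZ enorm_delta mulr1 gtr0_norm.
have nij (t : R) : `|t| <= s -> enorm (s *: ej + t *: ei) <= 2 * s.
  by move=> /nei ts; rewrite (le_trans (enormD _ _))// nej; lra.
have Uij (t : R) : `|t| <= s -> enorm (s *: ej + t *: ei) < d by move/nij; lra.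
have Ui (t : R) : `|t| <= s -> enorm (t *: ei) < d by move/nei; lra.
have [t|t ts gs] := @MVT_abs _ g (fun t => partial i f (x + s *: ej + t *: ei) - partial i f (x + t *: ei)) s.
  rewrite (gtr0_norm s0) => ts; apply: is_deriveB; apply: is_derive_line; apply: dfi.
    by rewrite -addrA; exact: (hd _ (Uij _ ts)).1.
  exact: (hd _ (Ui _ ts)).1.
rewrite (gtr0_norm s0) in ts.
have -> : f (x + s *: ei + s *: ej) - f (x + s *: ei) - f (x + s *: ej) + f x = g s - g 0.
  by rewrite /g scale0r !addr0 (addrAC x); ring.
rewrite gs; have := (hd _ (Uij _ ts)).2; have := (hd _ (Ui _ ts)).2.
rewrite addrA dotpDr !dotpZr !dotp_delta !mxE.
set a := partial i f (x + t *: ei); set b := partial i f (x + s *: ej + t *: ei); set c := partial i f x.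
move=> h1 h2.
have {}h1 := le_trans h1 (ler_wpM2l (ltW e4) (nei _ ts)).
have {}h2 := le_trans h2 (ler_wpM2l (ltW e4) (nij _ ts)).
exact: second_difference_arith h1 h2.
Qed.

Lemma partialC_arith (A B C D a b e q : R) :
  `|A - C - B + D - q * a| <= e / 2 * q -> `|A - B - C + D - q * b| <= e / 2 * q ->
  `|q * (a - b)| <= q * e.
Proof.
move=> h1 h2.
have -> : q * (a - b) = (A - B - C + D - q * b) - (A - C - B + D - q * a) by ring.
apply: (le_trans (ler_normB _ _)); apply: (le_trans (lerD h2 h1)).
by rewrite -mulrDl -splitr mulrC.
Qed.

(** The second difference is symmetric in [i] and [j], while its leading coefficient is one or the
    other mixed derivative according to the order in which it is computed. *)
Lemma partialC U f x i j : open U -> U x -> Ck_on 2 U f ->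
  partial j (partial i f) x = partial i (partial j f) x.
Proof.
move=> oU Ux Cf; apply/eqP; rewrite -subr_eq0 -normr_le0; apply/ler_addgt0Pl => e e0.
rewrite addr0; have e2 : 0 < e / 2 by rewrite divr_gt0.
have [d1 d10 h1] := second_difference i j oU Ux Cf e2.
have [d2 d20 h2] := second_difference j i oU Ux Cf e2.
pose s := Num.min d1 d2 / 2.
have m0 : 0 < Num.min d1 d2 by rewrite lt_min d10.
have s0 : 0 < s by rewrite divr_gt0.
have sm : s < Num.min d1 d2 by rewrite /s ltr_pdivrMr// ltr_pMr// ltrDl.
move: (sm); rewrite lt_min => /andP[sd1 sd2].
have {h1}:= h1 s s0 sd1; have {h2} := h2 s s0 sd2.
rewrite (addrAC x (s *: delta_mx 0 j)).
set A := f _; set B := f _; set C := f _; set D := f _.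
set a := partial j _ x; set b := partial i _ x => h2 h1.
have s20 : 0 < s ^+ 2 by rewrite exprn_gt0.
rewrite -(ler_pM2l s20) -{1}(gtr0_norm s20) -normrM.
exact: partialC_arith h1 h2.
Qed.

End Ck.

(** * Projection onto a convex set and the distance function *)

Ltac vring := apply/rowP => ?; rewrite !mxE; ring.

Section convex.
Context {R : realType} {n : nat}.
Implicit Types (Omega C : set 'rV[R]_n) (x y z w : 'rV[R]_n).

Definition segment_closed C := forall x y (t : R), C x -> C y -> 0 <= t -> t <= 1 ->
  C (x + t *: (y - x)).

Lemma is_convex_segment Omega : is_convex Omega -> segment_closed Omega.
Proof.
move=> cO x y t Ox Oy t0 t1.
have := cO y x (Itv01 t0 t1); rewrite !inE => /(_ Oy Ox).
suff -> : conv (Itv01 t0 t1) (y : convex_lmodType 'rV[R]_n) x = x + t *: (y - x) by [].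
rewrite /conv/= /unstable.onem scalerBl scale1r scalerBr.
by rewrite addrC addrAC addrA.
Qed.

Lemma le_max_id (a b : R) : a <= Num.max a b /\ b <= Num.max a b.
Proof. by rewrite !le_max !lexx orbT. Qed.

Lemma closure_segment C : segment_closed C -> segment_closed (closure C).
Proof.
move=> cC x y t /closure_enormP cx /closure_enormP cy t0 t1.
apply/closure_enormP => e e0; have e2 : 0 < e / 2 by rewrite divr_gt0.
have [x' Cx' xx'] := cx _ e2; have [y' Cy' yy'] := cy _ e2.
exists (x' + t *: (y' - x')); first exact: cC.
have -> : x' + t *: (y' - x') - (x + t *: (y - x)) = (1 - t) *: (x' - x) + t *: (y' - y).
  by vring.
rewrite (le_lt_trans (enormD _ _))// !enormZ (ger0_norm t0) ger0_norm ?subr_ge0//.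
rewrite (@le_lt_trans _ _ (Num.max (enorm (x' - x)) (enorm (y' - y))))//; last first.
  have ee : e / 2 < e by rewrite ltr_pdivrMr// ltr_pMr// ltr1n.
  by rewrite gt_max (lt_trans xx' ee) (lt_trans yy' ee).
move: (Num.max _ _) (le_max_id (enorm (x' - x)) (enorm (y' - y))) => m [hl hr].
have -> : m = (1 - t) * m + t * m by ring.
apply: lerD; first by rewrite ler_wpM2l ?subr_ge0.
by rewrite ler_wpM2l.
Qed.

Definition is_proj C x y := C y /\ forall z, C z -> enorm (x - y) <= enorm (x - z).

Lemma proj_exists C x : closed C -> C !=set0 -> exists y, is_proj C x y.
Proof.
move=> cC [c0 Cc0].
pose A := C `&` [set z | enorm (x - z) <= enorm (x - c0)].
have cont : continuous (fun z => enorm (x - z)).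
  move=> z; apply/continuous_enormP => e e0; exists e => // z'.
  apply: le_lt_trans; rewrite (le_trans (enorm_dist _ _))//.
  have -> : x - z' - (x - z) = z - z' by vring.
  by rewrite enormC.
have cA : compact A.
  apply: (@compact_enorm _ _ _ (enorm (x - c0) + enorm x)).
    apply: closedI => //.
    by apply: (@closed_comp _ _ (fun z => enorm (x - z)) [set r | r <= enorm (x - c0)]) => [z _|]; [exact: cont|exact: closed_le].
  move=> z [_ /= h]; rewrite -(subrK x z) (le_trans (enormD _ _))// lerD2r.
  by rewrite (enormC z x).
have A0 : A !=set0 by exists c0; split => //=.
have [y + ymin] := EVT_min_rV A0 cA (continuous_subspaceT cont).
rewrite inE => -[Cy yc0]; exists y; split => // z Cz.
have [zc|zc] := leP (enorm (x - z)) (enorm (x - c0)).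
  by apply: ymin; rewrite inE.
by apply: (le_trans yc0); exact: ltW.
Qed.

Lemma le0_of_small (a b : R) :
  (forall t, 0 < t -> t <= 1 -> 2 * t * a <= t ^+ 2 * b) -> a <= 0.
Proof.
move=> h; rewrite leNgt; apply/negP => a0.
have b0 : 0 < b by have := h 1 ltr01 (lexx _); rewrite expr1n; nra.
have ab : 0 < a / b by rewrite divr_gt0.
pose t := Num.min 1 (a / b).
have t0 : 0 < t by rewrite lt_min ltr01.
have t1 : t <= 1 by rewrite ge_min lexx.
have tb : t * b <= a by rewrite -ler_pdivlMr// ge_min lexx orbT.
by have := h t t0 t1; clearbody t; nra.
Qed.

Lemma enorm_le_dotp (u v : 'rV[R]_n) : enorm u <= enorm v -> dotp u u <= dotp v v.
Proof. by rewrite -!enorm_sqr => h; rewrite ler_pXn2r ?nnegrE ?enorm_ge0. Qed.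

(** Moving [y] slightly towards [z] stays in [C] and cannot shorten the distance to [x], so the
    first-order term has a sign. *)
Lemma proj_obtuse C x y : segment_closed C -> is_proj C x y ->
  forall z, C z -> dotp (x - y) (z - y) <= 0.
Proof.
move=> cC [Cy ymin] z Cz; apply: (@le0_of_small _ (dotp (z - y) (z - y))) => t t0 t1.
have := ymin _ (cC _ _ _ Cy Cz (ltW t0) t1); move/enorm_le_dotp.
rewrite opprD addrA; move: (x - y) (z - y) => u v.
rewrite dotpBl !dotpBr !dotpZl !dotpZr (dotpC v u) => h; lra.
Qed.

End convex.

Local Opaque nearest.

(** * Distance, nearest point and unit normal field in the exterior *)

Section exterior_geometry.
Context {R : realType} {n : nat} (Omega : set 'rV[R]_n).
Hypotheses (Omega_open : open Omega) (Omega0 : Omega !=set0)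
  (Omega_convex : is_convex Omega).
Implicit Types (x y z w : 'rV[R]_n).

Let C_convex : segment_closed (closure Omega).
Proof. by apply: closure_segment; exact: is_convex_segment. Qed.

Let C0 : closure Omega !=set0.
Proof. by have [w Ow] := Omega0; exists w; exact: subset_closure. Qed.

Lemma boundaryE y : boundary Omega y <-> closure Omega y /\ ~ Omega y.
Proof. by have e : interior Omega = Omega by [apply/interior_id|rewrite -interior_id]; rewrite /boundary e. Qed.

Lemma delta_proj x y : is_proj (closure Omega) x y -> enorm (x - y) = delta Omega x.
Proof.
move=> [Cy ymin]; apply/eqP; rewrite eq_le; apply/andP; split.
  apply: lb_le_inf; first by exists (enorm (x - y)); exists y.
  by move=> _ [z Cz <-]; exact: ymin.
apply: ge_inf; last by exists y.
by exists 0 => _ [z Cz <-]; exact: enorm_ge0.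
Qed.

Lemma delta_le x z : closure Omega z -> delta Omega x <= enorm (x - z).
Proof.
move=> Cz; apply: ge_inf; last by exists z.
by exists 0 => _ [w Cw <-]; exact: enorm_ge0.
Qed.

Local Opaque delta.

Lemma delta_gt0 x : exterior Omega x -> 0 < delta Omega x.
Proof.
move=> ex; have [y yP] := proj_exists x (@closed_closure _ Omega) C0.
rewrite -(delta_proj yP) enorm_gt0//; apply/eqP => /eqP; rewrite subr_eq0 => /eqP xy.
by apply: ex; rewrite xy; case: yP.
Qed.

Lemma is_nearest_proj x y : is_nearest Omega x y -> is_proj (closure Omega) x y.
Proof. by move=> [[Cy _] xy]; split => // z Cz; rewrite xy delta_le. Qed.

Lemma is_nearest_obtuse x y z : is_nearest Omega x y -> closure Omega z ->
  dotp (x - y) (z - y) <= 0.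
Proof. by move=> /is_nearest_proj h; exact: proj_obtuse. Qed.

(** The obtuse-angle inequalities at [y] and at [y'] add up to [dotp (y - y') (y - y') <= 0]. *)
Lemma is_nearest_uniq x y y' : is_nearest Omega x y -> is_nearest Omega x y' -> y = y'.
Proof.
move=> h h'; apply/eqP; rewrite -subr_eq0; apply/eqP/dotp_eq0/eqP.
rewrite eq_le dotp_ge0 andbT.
have := is_nearest_obtuse h h'.1.1; have := is_nearest_obtuse h' h.1.1.
rewrite -(opprB y y') dotpNr; move: (lexx (dotp (y - y') (y - y'))).
have -> : x - y' = (x - y) + (y - y') by rewrite addrA subrK.
by rewrite (dotpDl (x - y)); lra.
Qed.

(** A closest point of the closure exists by compactness. It is not in [Omega]: otherwise a short
    step from it towards [x] would stay in [Omega] and violate [proj_obtuse]. *)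
Lemma nearest_exists x : exterior Omega x -> exists y, is_nearest Omega x y.
Proof.
move=> ex; have [y yP] := proj_exists x (@closed_closure _ Omega) C0.
exists y; split; last exact: delta_proj.
apply/boundaryE; split; first by case: yP.
move=> Oy; move/open_enormP : (Omega_open) => /(_ _ Oy)[e e0 he].
have xy : enorm (x - y) = delta Omega x by exact: delta_proj.
have d0 := delta_gt0 ex.
pose t := e / 2 / delta Omega x.
have t0 : 0 < t by rewrite !divr_gt0.
have Ct : closure Omega (t *: (x - y) + y).
  apply: subset_closure; apply: he; rewrite addrK enormZ xy gtr0_norm//.
  by rewrite /t divfK ?gt_eqF// ltr_pdivrMr// ltr_pMr// ltr1n.
have := proj_obtuse C_convex yP Ct.
by rewrite addrK dotpZr -enorm_sqr xy leNgt mulr_gt0// exprn_gt0.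
Qed.

Lemma nearestP x : exterior Omega x -> is_nearest Omega x (nearest Omega x).
Proof. by move=> /nearest_exists h; exact: (xgetPex 0 h). Qed.

Lemma delta_lipschitz x z : `|delta Omega x - delta Omega z| <= enorm (x - z).
Proof.
have h x' z' : delta Omega x' - delta Omega z' <= enorm (x' - z').
  have [y yP] := proj_exists z' (@closed_closure _ Omega) C0.
  rewrite -(delta_proj yP) lerBlDr (le_trans _ (enorm_triangle z' x' y))//.
  by apply: delta_le; case: yP.
by rewrite ler_norml lerNl opprB h enormC h.
Qed.

(** It will turn out to be both the gradient of [delta Omega] ([delta_derivative]) and the outer
    normal at the nearest point ([unit_normal_fieldP]). *)
Definition unit_normal_field x : 'rV[R]_n := (delta Omega x)^-1 *: (x - nearest Omega x).
Local Notation nu := unit_normal_field.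

Lemma unit_normal_fieldE x : exterior Omega x -> x = nearest Omega x + delta Omega x *: nu x.
Proof.
move=> ex; rewrite /nu scalerA divff ?gt_eqF ?delta_gt0// scale1r.
by rewrite addrC subrK.
Qed.

Lemma enorm_nu x : exterior Omega x -> enorm (nu x) = 1.
Proof.
move=> ex; have d0 := delta_gt0 ex; have [_ e] := nearestP ex.
by rewrite enormZ e gtr0_norm ?invr_gt0// mulVf// gt_eqF.
Qed.

Lemma nu_obtuse x z : exterior Omega x -> closure Omega z ->
  dotp (nu x) (z - nearest Omega x) <= 0.
Proof.
move=> ex Cz; rewrite dotpZl pmulr_rle0 ?invr_gt0 ?delta_gt0//.
exact: is_nearest_obtuse (nearestP ex) Cz.
Qed.

(** With [p], [q] the two nearest points, the obtuse-angle inequalities add up to [dotp (p - q) (p -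
    q) <= dotp (x - z) (p - q)]; Cauchy-Schwarz concludes. *)
Lemma nearest_lipschitz x z : exterior Omega x -> exterior Omega z ->
  enorm (nearest Omega x - nearest Omega z) <= enorm (x - z).
Proof.
move=> ex ez; have hx := nearestP ex; have hz := nearestP ez.
move: (is_nearest_obtuse hx hz.1.1) (is_nearest_obtuse hz hx.1.1) => {hx hz}.
move: (nearest Omega x) (nearest Omega z) => p q h1 h2.
have [->|pq] := eqVneq p q; first by rewrite subrr enorm0 enorm_ge0.
have pq0 : 0 < enorm (p - q) by rewrite enorm_gt0// subr_eq0.
rewrite -(ler_pM2r pq0) -expr2 enorm_sqr (le_trans _ (cauchy_schwarz _ _))//.
rewrite -subr_ge0 -dotpBl.
have -> : x - z - (p - q) = (x - p) - (z - q) by vring.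
rewrite dotpBl subr_ge0 (le_trans h2)//.
by rewrite -(opprB q p) dotpNr oppr_ge0.
Qed.

Local Opaque unit_normal_field.

(** The 3 counts the terms into which [delta Omega x *: (nu z - nu x)] splits: the increments of the
    distance, of the point and of the nearest point, each at most [enorm (z - x)]. *)
Lemma nu_lipschitz x z : exterior Omega x -> exterior Omega z ->
  enorm (nu z - nu x) <= 3 / delta Omega x * enorm (z - x).
Proof.
move=> ex ez; have d0 := delta_gt0 ex.
rewrite mulrAC ler_pdivlMr// mulrC -[X in X * _](gtr0_norm d0) -enormZ.
have -> : delta Omega x *: (nu z - nu x) =
    (delta Omega x - delta Omega z) *: nu z + (z - x) - (nearest Omega z - nearest Omega x).
  have gen (p q a b : 'rV[R]_n) (s t : R) :
    s *: (b - a) = (s - t) *: b + (q + t *: b - (p + s *: a)) - (q - p) by vring.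
  by rewrite (gen (nearest Omega x) (nearest Omega z) _ _ _ (delta Omega z)) -!unit_normal_fieldE.
apply: (le_trans (enormB _ _)).
have := nearest_lipschitz ez ex; have := delta_lipschitz x z.
have := enormD ((delta Omega x - delta Omega z) *: nu z) (z - x).
by rewrite enormZ enorm_nu// mulr1 (enormC x z); lra.
Qed.

Lemma support_arith (u w v : 'rV[R]_n) (d D : R) : dotp u u = 1 ->
  dotp u (d *: u + w - v) <= D -> dotp u v <= 0 -> dotp u w <= D - d.
Proof. by move=> uu; rewrite dotpBr dotpDr dotpZr uu; lra. Qed.

Lemma delta_expand_arith (a b c d e : R) :
  - d <= b - a -> d - c <= e -> a - b - c <= e.
Proof. lra. Qed.

(** The closure lies behind the hyperplane through the nearest point, so the distance has an affine
    minorant at each exterior point ([lower]). Used at [x] and at [x + w], it encloses the increment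
    between [dotp (nu x) w] and [dotp (nu (x + w)) w], and [nu_lipschitz] makes the gap
    quadratic. *)
Lemma delta_expand x w : exterior Omega x -> exterior Omega (x + w) ->
  `|delta Omega (x + w) - delta Omega x - dotp (nu x) w| <= 3 / delta Omega x * enorm w ^+ 2.
Proof.
have lower x' w' : exterior Omega x' -> exterior Omega (x' + w') ->
    dotp (nu x') w' <= delta Omega (x' + w') - delta Omega x'.
  move=> ex ez; have [yb ye] := nearestP ez; set y := nearest _ _ in yb ye.
  have := nu_obtuse ex yb.1; have [_ e'] := nearestP ex.
  have := cauchy_schwarz (nu x') (x' + w' - y); rewrite enorm_nu// mul1r ye.
  have -> : x' + w' - y = delta Omega x' *: nu x' + w' - (y - nearest Omega x').
    have gen (p a : 'rV[R]_n) (s : R) : p + s *: a + w' - y = s *: a + w' - (y - p) by vring.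
    by rewrite -gen -unit_normal_fieldE.
  have nn : dotp (nu x') (nu x') = 1 by rewrite -enorm_sqr enorm_nu// expr1n.
  exact: support_arith.
move=> ex ez; have h1 := lower _ _ ex ez.
have h2 : dotp (nu (x + w)) (- w) <= delta Omega (x + w - w) - delta Omega (x + w).
  by apply: (lower _ _ ez); rewrite addrK; exact: ex.
rewrite addrK dotpNr in h2.
rewrite ger0_norm ?subr_ge0//.
have : dotp (nu (x + w) - nu x) w <= 3 / delta Omega x * enorm w ^+ 2.
  apply: (le_trans (cauchy_schwarz _ _)); rewrite expr2 mulrA ler_wpM2r ?enorm_ge0//.
  by rewrite (le_trans (nu_lipschitz ex ez))// addrC addKr.
rewrite (dotpBl (nu (x + w))) => h3; exact: (delta_expand_arith h2 h3).
Qed.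

Lemma exterior_open : open (exterior Omega).
Proof. exact/closed_openC/closed_closure. Qed.

End exterior_geometry.

(** * Normals of a C^2 boundary *)

Section graph_coordinates.
Context {R : realType} {m : nat} (j : 'I_m.+1).
Implicit Types (a : 'rV[R]_m) (x : 'rV[R]_m.+1).

(** Deletion of the coordinate [j] in matrix form: its transpose reinserts a zero, and the
    differential of the normal becomes a matrix product. *)
Definition graph_embedding : 'M[R]_(m.+1, m) := col' j 1%:M.
Local Notation E := graph_embedding.

Lemma mul_graph_embedding x : x *m E = col' j x.
Proof.
rewrite -{2}(mulmx1 x); apply/matrixP => p q; rewrite !mxE.
by apply: eq_bigr => k _; rewrite !mxE.
Qed.

Lemma tr_graph_embedding_lift a k : (a *m E^T) 0 (lift j k) = a 0 k.
Proof.
rewrite mxE (bigD1 k)//= big1 ?addr0.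
  by rewrite !mxE eqxx mulr1.
by move=> l lk; rewrite !mxE (inj_eq (@lift_inj _ j)) eq_sym (negbTE lk) mulr0.
Qed.

Lemma tr_graph_embedding_j a : (a *m E^T) 0 j = 0.
Proof. by rewrite mxE big1// => l _; rewrite !mxE (negbTE (neq_lift j l)) mulr0. Qed.

Definition graph_point a (t : R) : 'rV[R]_m.+1 := a *m E^T + t *: delta_mx 0 j.
Local Notation pt := graph_point.

Lemma graph_point_lift a t k : pt a t 0 (lift j k) = a 0 k.
Proof.
by rewrite /graph_point mxE tr_graph_embedding_lift !mxE [lift j k == j]eq_sym (negbTE (neq_lift j k)) mulr0 addr0.
Qed.

Lemma graph_point_j a t : pt a t 0 j = t.
Proof. by rewrite /graph_point mxE tr_graph_embedding_j !mxE !eqxx mulr1 add0r. Qed.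

Lemma graph_pointB a b t s : pt a t - pt b s = pt (a - b) (t - s).
Proof. by rewrite /graph_point mulmxBl scalerBl opprD addrACA. Qed.

Lemma graph_pointZ a t s : s *: pt a t = pt (s *: a) (s * t).
Proof. by rewrite /graph_point scalerDr scalemxAl scalerA. Qed.

Lemma graph_point0 t : pt 0 t = t *: delta_mx 0 j.
Proof. by rewrite /graph_point mul0mx add0r. Qed.

Lemma col'_graph_point a t : col' j (pt a t) = a.
Proof. by apply/rowP => k; rewrite mxE graph_point_lift. Qed.

Lemma graph_pointK x : pt (col' j x) (x 0 j) = x.
Proof.
apply/rowP => i; case: (unliftP j i) => [k|] ->; last by rewrite graph_point_j.
by rewrite graph_point_lift mxE.
Qed.

Lemma dotp_graph_point x a t : dotp x (pt a t) = dotp (col' j x) a + t * x 0 j.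
Proof.
rewrite /pt dotpDr dotpZr dotp_delta; congr (_ + _).
by rewrite dotpC dotp_mulmx trmxK mul_graph_embedding dotpC.
Qed.

Lemma enorm_graph_point0 a : enorm (pt a 0) = enorm a.
Proof.
by rewrite /enorm dotp_graph_point col'_graph_point mul0r addr0.
Qed.

Lemma enorm_col' x : enorm (col' j x) <= enorm x.
Proof.
rewrite /enorm ler_sqrt ?dotp_ge0//.
have -> : dotp x x = dotp (col' j x) (col' j x) + x 0 j ^+ 2.
  by rewrite -{2}(graph_pointK x) dotp_graph_point expr2.
by rewrite lerDl sqr_ge0.
Qed.

End graph_coordinates.

Lemma is_derive1_enormP {R : realType} n (g : R -> 'rV[R]_n) (l : 'rV[R]_n) :
  is_derive (0 : R) (1 : R) g l <->
  forall e, 0 < e -> exists2 d, 0 < d & forall t, `|t| < d ->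
    enorm (g t - g 0 - t *: l) <= e * `|t|.
Proof.
split=> [/is_derive1P h e e0|h].
  have e'0 : 0 < e / n.+1%:R by rewrite divr_gt0.
  have [d d0 hd] := h _ e'0; exists d => // t td.
  have [->|t0] := eqVneq t 0; first by rewrite subrr scale0r subr0 enorm0 normr0 mulr0.
  apply: (le_trans (enorm_le_norm _)).
  have := hd t; rewrite normr_gt0 => /(_ t0 td) hh.
  apply: (le_trans (ler_wpM2l _ hh)) => //.
  rewrite mulrA ler_wpM2r// mulrCA ger_pMr// ler_pdivrMr// mul1r ler_nat//.
apply/is_derive1P => e e0; have [d d0 hd] := h e e0; exists d => // t _ td.
exact: (le_trans (norm_le_enorm _) (hd t td)).
Qed.

Lemma near_forall_fin (T : topologicalType) (I : finType) (P : I -> set T) (x : T) :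
  (forall i, \forall z \near x, P i z) -> \forall z \near x, forall i, P i z.
Proof. by move=> h; apply: filter_forall. Qed.

Lemma near0P {R : realType} (P : set R) :
  (\forall t \near 0, P t) <-> exists2 d, 0 < d & forall t, `|t| < d -> P t.
Proof.
split=> [/nbhs_normP[d /= d0 h]|[d d0 h]].
  by exists d => // t td; apply: h; rewrite /= sub0r normrN.
by apply/nbhs_normP; exists d => //= t /=; rewrite sub0r normrN; exact: h.
Qed.

Section boundary_graph.
Context {R : realType} {m : nat} (Omega : set 'rV[R]_m.+1).
Hypothesis Omega_C2 : C2_boundary Omega.
Local Notation S := (boundary Omega).

(* [M] is the gradient of [z_j - phi (z_i, i != j)] in the coordinates of
   [C2_boundary], and [H] its derivative at [y]. *)
Lemma boundary_normal_field (y : 'rV[R]_m.+1) : S y ->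
  exists (M : 'rV[R]_m.+1 -> 'rV[R]_m.+1) (H : 'M[R]_m.+1) (d : R),
  [/\ 0 < d, H^T = H,
   forall e, 0 < e -> exists2 d', 0 < d' & forall z, enorm (z - y) < d' ->
     enorm (M z - M y - (z - y) *m H) <= e * enorm (z - y),
   forall z, S z -> enorm (z - y) < d -> M z != 0 /\
     (forall N, (forall v, tangent S z v -> dotp N v = 0) -> exists c, N = c *: M z) &
   forall u, dotp (M y) u = 0 -> tangent S y u].
Proof.
move=> Sy; have [Q [j [V [phi [[QQ _] oV Vy Cphi nearS]]]]] := Omega_C2 Sy.
have QtQ : Q^T *m Q = 1%:M := mulmx1C QQ.
move/near_enormP : nearS => [d0 d00 hS].
move/open_enormP : (oV) => /(_ _ Vy)[d1 d10 hV].
(* [L] forgets the height in the rotated coordinates; [K a t] is the point over [a] at height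
   [t]. *)
pose L (x : 'rV[R]_m.+1) : 'rV[R]_m := col' j (x *m Q).
pose K (a : 'rV[R]_m) (t : R) : 'rV[R]_m.+1 := graph_point j a t *m Q^T.
have enormQ x : enorm (x *m Q) = enorm x.
  by rewrite /enorm dotp_mulmx -mulmxA QQ mulmx1.
have enormQt x : enorm (x *m Q^T) = enorm x.
  by rewrite /enorm dotp_mulmx trmxK -mulmxA QtQ mulmx1.
have LB x z : L x - L z = L (x - z).
  by rewrite /L mulmxBl; apply/rowP => i; rewrite !mxE.
have Lle x : enorm (L x) <= enorm x.
  by rewrite -(enormQ x); exact: enorm_col'.
have LK a t : L (K a t) = a by rewrite /L /K -mulmxA QtQ mulmx1 col'_graph_point.
have KL x : K (L x) ((x *m Q) 0 j) = x.
  by rewrite /K graph_pointK -mulmxA QQ mulmx1.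
have Kj a t : (K a t *m Q) 0 j = t.
  by rewrite /K -mulmxA QtQ mulmx1 graph_point_j.
pose G a := gradient phi a.
pose M x := K (- G (L x)) 1.
pose Hs : 'M[R]_m := \matrix_(l, k) partial l (partial k phi) (L y).
pose E : 'M[R]_(m.+1, m) := graph_embedding j.
(* [M x] depends on [x] only through [L x], so its differential is minus the Hessian of [phi]
   carried back by the chart. *)
pose H : 'M[R]_m.+1 := - (Q *m E *m Hs *m E^T *m Q^T).
have C1phi : Ck_on 1 V phi by exact: Ck_onW.
have HsT : Hs^T = Hs by apply/matrixP => l k; rewrite !mxE; exact: partialC oV _ Cphi.
pose d := Num.min d0 d1.
have dpos : 0 < d by rewrite lt_min d00.
have VL z : enorm (z - y) < d -> V (L z).
  rewrite lt_min => /andP[_ zd]; apply: hV; rewrite LB.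
  exact: le_lt_trans (Lle _) zd.
have SL z : enorm (z - y) < d -> S z <-> (z *m Q) 0 j = phi (L z).
  by rewrite lt_min => /andP[zd _]; exact: hS.
have tanK z a : S z -> enorm (z - y) < d -> tangent S z (K a (dotp (G (L z)) a)).
  move=> Sz zd; pose g (t : R) := K (L z + t *: a) (phi (L z + t *: a)).
  have g0 : g 0 = z by rewrite /g scale0r addr0 -((SL z zd).1 Sz) KL.
  have gd : is_derive (0 : R) (1 : R) g (K a (dotp (G (L z)) a)).
    apply/is_derive1_enormP => e e0.
    have e'0 : 0 < e / (enorm a + 1) by rewrite divr_gt0// ltr_wpDl ?enorm_ge0.
    have [r r0 hr] := Ck_on1_expand oV (VL _ zd) C1phi e'0.
    exists (r / (enorm a + 1)); first by rewrite divr_gt0// ltr_wpDl ?enorm_ge0.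
    move=> t; rewrite ltr_pdivlMr ?ltr_wpDl ?enorm_ge0// => tr.
    have ta : enorm (t *: a) <= `|t| * (enorm a + 1).
      by rewrite enormZ ler_wpM2l// lerDl.
    have [_] := hr _ (le_lt_trans ta tr).
    rewrite dotpZr => h.
    have -> : g t - g 0 - t *: K a (dotp (G (L z)) a) =
        ((phi (L z + t *: a) - phi (L z) - t * dotp (G (L z)) a) *: delta_mx 0 j) *m Q^T.
      rewrite /g /K scale0r addr0 -mulmxBl scalemxAl -mulmxBl graph_pointZ !graph_pointB.
      by rewrite (addrC (L z)) addrK subrr graph_point0.
    rewrite enormQt enormZ enorm_delta mulr1 (le_trans h)//.
    apply: (le_trans (ler_wpM2l (ltW e'0) ta)).
    by rewrite mulrCA mulrC divfK// gt_eqF// ltr_wpDl ?enorm_ge0.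
  (* The curve [g] follows the graph of [phi], which is known to be the boundary only within
     distance [d] of [y]. The bound [enorm (g t - z) <= |t| * B] keeps it there for small [t]. *)
  exists g; split => //.
  have zdx : 0 < d - enorm (z - y) by rewrite subr_gt0.
  have [r r0 hr] := Ck_on1_expand oV (VL _ zd) C1phi ltr01.
  move: (gd) => /is_derive1_enormP /(_ _ ltr01)[r1 r10 hr1].
  pose B := enorm (K a (dotp (G (L z)) a)) + 1.
  have B0 : 0 < B by rewrite ltr_wpDl ?enorm_ge0.
  apply/near0P; exists (Num.min r1 ((d - enorm (z - y)) / B)).
    by rewrite lt_min r10 divr_gt0.
  move=> t; rewrite lt_min => /andP[tr1 tB].
  have gtd : enorm (g t - y) < d.
    apply: (le_lt_trans (enorm_triangle z _ _)); rewrite -ltrBrDr.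
    have := hr1 _ tr1; rewrite g0 mul1r => h.
    have -> : g t - z = g t - z - t *: K a (dotp (G (L z)) a) + t *: K a (dotp (G (L z)) a).
      by rewrite subrK.
    apply: (le_lt_trans (enormD _ _)); rewrite enormZ.
    apply: (le_lt_trans (lerD h (lexx _))).
    by rewrite -{1}(mulr1 `|t|) -mulrDr (addrC 1) -ltr_pdivlMr.
  apply/(SL _ gtd); rewrite /g Kj; congr (phi _).
  by rewrite LK.
have MQ x u : dotp (M x) u = (u *m Q) 0 j - dotp (G (L x)) (col' j (u *m Q)).
  rewrite /M /K dotp_mulmx trmxK dotpC dotp_graph_point dotpNr mul1r addrC.
  by rewrite (dotpC (G (L x))).
exists M, H, d; split => //.
- by rewrite /H linearN/= !trmx_mul !trmxK HsT !mulmxA.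
- move=> e e0.
  have e'0 : 0 < e / m.+1%:R by rewrite divr_gt0.
  have : \forall a \near L y, forall k, `|partial k phi a - partial k phi (L y) - dotp (gradient (partial k phi) (L y)) (a - L y)| <= e / m.+1%:R * enorm (a - L y).
    apply: near_forall_fin => k; apply/near_enormP.
    have [_ /(_ k)[_ Ck]] := Cphi.
    have [r r0 hr] := Ck_on1_expand oV Vy Ck e'0; exists r => // a ar.
    have aL : L y + (a - L y) = a by rewrite addrC subrK.
    by have [_] := hr _ ar; rewrite -/(L y) aL.
  move=> /near_enormP[r r0 hr]; exists r => // z zr.
  have LLr : enorm (L z - L y) < r by rewrite LB (le_lt_trans (Lle _)).
  have -> : M z - M y - (z - y) *m H =
      graph_point j (- (G (L z) - G (L y) - (L z - L y) *m Hs)) 0 *m Q^T.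
    rewrite /H mulmxN opprK !mulmxA mul_graph_embedding -/(L (z - y)) -LB.
    rewrite /M /K -mulmxBl graph_pointB subrr -mulmxDl; congr (_ *m _).
    rewrite /graph_point !scale0r !addr0 -mulmxDl; congr (_ *m _).
    by rewrite !opprD !opprK.
  rewrite enormQt enorm_graph_point0 enormN.
  apply: (le_trans (enorm_le_norm _)).
  have -> : e * enorm (z - y) = m.+1%:R * (e / m.+1%:R * enorm (z - y)).
    by rewrite mulrA mulrCA divff ?mulr1.
  have h : `|G (L z) - G (L y) - (L z - L y) *m Hs| <= e / m.+1%:R * enorm (z - y).
    have ee0 : 0 <= e / m.+1%:R * enorm (z - y) by rewrite mulr_ge0 ?enorm_ge0// ltW.
    rewrite [leLHS]/Num.Def.normr/= mx_normrE (bigmax_le _ ee0)//= => -[i k] _.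
    rewrite (ord1 i) /=.
    have -> : (G (L z) - G (L y) - (L z - L y) *m Hs) 0 k =
       partial k phi (L z) - partial k phi (L y) - dotp (gradient (partial k phi) (L y)) (L z - L y).
      rewrite !mxE; congr (_ - _); rewrite dotpC; apply: eq_bigr => l _.
      by rewrite !mxE.
    apply: (le_trans (hr _ LLr k)); rewrite ler_wpM2l ?(ltW e'0)//.
    by rewrite LB.
  by apply: ler_pM => //; rewrite ler_nat.
- move=> z Sz zd; split.
    apply/eqP => Mz0.
    have := MQ z (K 0 1); rewrite Mz0 dotp0l Kj -/(L _) LK dotp0r subr0.
    by move/esym/eqP; rewrite oner_eq0.
  (* Orthogonality to the curves over the coordinate directions fixes every rotated coordinate of
     [N] in terms of the [j]-th one. *)
  move=> N hN; exists ((N *m Q) 0 j).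
  have hG k : (N *m Q) 0 (lift j k) = - ((N *m Q) 0 j * G (L z) 0 k).
    have := hN _ (tanK z (delta_mx 0 k) Sz zd).
    rewrite /K dotpC dotp_mulmx trmxK dotpC dotp_graph_point !dotp_delta mxE.
    by move/eqP; rewrite addr_eq0 mulrC => /eqP.
  rewrite /M /K scalemxAl graph_pointZ mulr1.
  rewrite -[LHS](mulmx1) -QQ mulmxA; congr (_ *m _).
  rewrite -[LHS](graph_pointK j); congr graph_point.
  by apply/rowP => k; rewrite mxE hG !mxE mulrN.
- move=> u; rewrite MQ => /eqP; rewrite subr_eq0 => /eqP uj.
  have -> : u = K (col' j (u *m Q)) (dotp (G (L y)) (col' j (u *m Q))) by rewrite -uj KL.
  by apply: tanK => //; rewrite subrr enorm0.
Qed.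

End boundary_graph.

Local Opaque delta nearest unit_normal_field.

(** * Supporting normals of an open convex set *)

Section supporting_normals.
Context {R : realType} {n : nat} (Omega : set 'rV[R]_n).
Hypotheses (Omega_open : open Omega) (Omega0 : Omega !=set0)
  (Omega_convex : is_convex Omega).
Implicit Types (x y z w N : 'rV[R]_n).
Local Notation S := (boundary Omega).
Local Notation nu := (unit_normal_field Omega).

(** The unit vectors of the normal cone at [y]. Unlike [is_outer_normal], this condition passes to
    limits and yields global inequalities. *)
Definition supporting y N := enorm N = 1 /\
  forall z, closure Omega z -> dotp N (z - y) <= 0.

(** A point [x'] of [Omega] near [x] is used in place of [x]; the error is absorbed by moving [w] to
    [w'], within the ball around [w] contained in [Omega]. *)
Lemma interior_segment w x (t : R) : Omega w -> closure Omega x -> 0 <= t -> t < 1 ->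
  Omega (w + t *: (x - w)).
Proof.
move=> Ow /closure_enormP cx t0 t1.
move/open_enormP : (Omega_open) => /(_ _ Ow)[r r0 hr].
have t1' : 0 < 1 - t by rewrite subr_gt0.
have e0 : 0 < r * (1 - t) by rewrite mulr_gt0.
have [x' Ox' xx'] := cx _ e0.
pose w' := w + (t / (1 - t)) *: (x - x').
have Ow' : Omega w'.
  apply: hr; rewrite /w' addrC addKr enormZ ger0_norm ?divr_ge0// ?ltW// enormC.
  rewrite mulrAC ltr_pdivrMr// (le_lt_trans _ xx')// ler_piMl ?enorm_ge0// ltW//.
have -> : w + t *: (x - w) = w' + t *: (x' - w').
  apply/rowP => i; rewrite !mxE; field.
  by rewrite gt_eqF.
by apply: (is_convex_segment Omega_convex) => //; exact: ltW.
Qed.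

Lemma supporting_interior y N w : supporting y N -> Omega w -> dotp N (w - y) < 0.
Proof.
move=> [N1 hN] Ow; move/open_enormP : (Omega_open) => /(_ _ Ow)[r r0 hr].
have C : closure Omega (w + (r / 2) *: N).
  apply: subset_closure; apply: hr; rewrite addrC addKr enormZ N1 mulr1 gtr0_norm ?divr_gt0//.
  by rewrite ltr_pdivrMr// ltr_pMr// ltr1n.
have := hN _ C; rewrite addrAC (dotpDr N (w - y)) dotpZr -enorm_sqr N1 expr1n mulr1.
have : 0 < r / 2 by rewrite divr_gt0.
lra.
Qed.

(** Otherwise [y] would lie strictly between [w] and a point of the closure, hence in [Omega] by
    [interior_segment]. *)
Lemma boundary_ray w y (s : R) : Omega w -> S y -> 0 < s -> exterior Omega (y + s *: (y - w)).
Proof.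
move=> Ow Sy s0 cx; have /(boundaryE Omega_open)[_] := Sy; apply.
have s1 : 0 < 1 + s by rewrite addr_gt0.
have -> : y = w + (1 + s)^-1 *: (y + s *: (y - w) - w).
  apply/rowP => i; rewrite !mxE; field.
  by rewrite gt_eqF.
apply: interior_segment => //; first by rewrite invr_ge0 ltW.
by rewrite invf_lt1// ltrDl.
Qed.

(* [N] is a cluster point of the unit normal field along exterior points
   converging to [y]. *)
Lemma supporting_exists y : S y -> exists N, supporting y N.
Proof.
move=> Sy; have [w Ow] := Omega0.
pose x (k : nat) := y + k.+1%:R^-1 *: (y - w).
have xe k : exterior Omega (x k) by apply: boundary_ray => //; rewrite invr_gt0.
pose Nk k := nu (x k).
pose A : set 'rV[R]_n := [set N | enorm N = 1].
have cA : compact A.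
  apply: (@compact_enorm _ _ _ 1); last by move=> N ->.
  by apply: (@closed_comp _ _ (@enorm R n) [set 1]) => [z _|]; [exact: continuous_enorm|exact: closed_eq].
have FA : \forall k \near \oo, A (Nk k).
  by apply: filterE => k; exact: enorm_nu.
have [N [N1 clN]] := cA (Nk @ \oo) _ FA.
exists N; split => // z Cz; rewrite leNgt; apply/negP => c0.
set c := dotp N (z - y) in c0.
pose W : set 'rV[R]_n := [set M | c / 2 < dotp M (z - y)].
have nW : nbhs N W.
  have c2 : 0 < c / 2 by rewrite divr_gt0.
  have /continuous_enormP/(_ _ c2)[d d0 hd] : {for N, continuous (dotp (z - y))} by exact: continuous_dotp.
  apply/near_enormP; exists d => // M /hd.
  rewrite (dotpC _ M) (dotpC _ N) -/c ltr_norml /W /= => /andP[h _].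
  by move: h; clear; move: (dotp M _) => q; lra.
pose B : set 'rV[R]_n := [set M | dotp M (z - y) <= c / 2].
(* [Nk k] supports at the nearest point of [x k], which lies within [2 * enorm (x k - y)] of [y].
   Hence [dotp (Nk k) (z - y)] is eventually at most [c / 2], which no vector of [W] satisfies. *)
have FB : \forall k \near \oo, B (Nk k).
  have Bn : 0 < 2 * enorm (y - w) + 1 by rewrite ltr_wpDl ?mulr_ge0 ?enorm_ge0.
  have e0 : 0 < c / 2 / (2 * enorm (y - w) + 1) by rewrite !divr_gt0.
  have := near_infty_natSinv_lt (PosNum e0); apply: filterS => k /=.
  rewrite ltr_pdivlMr// => hk; rewrite /B /=.
  have hP := nearestP Omega_open Omega0 Omega_convex (xe k).
  have -> : z - y = (z - nearest Omega (x k)) + (nearest Omega (x k) - y) by rewrite addrA subrK.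
  rewrite dotpDr; have := nu_obtuse Omega_open Omega0 Omega_convex (xe k) Cz.
  have := cauchy_schwarz (Nk k) (nearest Omega (x k) - y); rewrite enorm_nu// mul1r.
  have : enorm (nearest Omega (x k) - y) <= 2 * (k.+1%:R^-1 * enorm (y - w)).
    have xy : enorm (x k - y) = k.+1%:R^-1 * enorm (y - w).
      by rewrite /x addrC addKr enormZ gtr0_norm ?invr_gt0.
    apply: (le_trans (enorm_triangle (x k) _ _)); rewrite xy mulr_natl mulr2n lerD2r.
    by rewrite enormC hP.2 -xy; apply: delta_le; case: Sy.
  have : 0 < k.+1%:R^-1 :> R by rewrite invr_gt0.
  move: hk; rewrite -/(Nk k) mulrDr mulr1 mulrCA.
  move: (k.+1%:R^-1) (k.+1%:R^-1 * enorm (y - w)) => a b.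
  lra.
have [M [BM WM]] := clN _ _ FB nW.
by move: WM; rewrite /W /= ltNge => /negP; apply.
Qed.

(** A boundary curve through [y] stays behind the supporting hyperplane for both signs of its
    parameter, so its velocity is orthogonal to [N]. *)
Lemma supporting_outer_normal y N : S y -> supporting y N -> is_outer_normal Omega y N.
Proof.
move=> Sy [N1 hN]; split => //.
  move=> v [g [g0 gS /is_derive1_enormP gd]].
  apply/eqP; rewrite -normr_le0; apply/ler_addgt0Pl => e e0; rewrite addr0.
  have [d d0 hd] := gd _ e0; move/near0P : gS => [r r0 hr].
  pose t := Num.min d r / 2.
  have m0 : 0 < Num.min d r by rewrite lt_min d0.
  have t0 : 0 < t by rewrite divr_gt0.
  have tm : t < Num.min d r by rewrite /t ltr_pdivrMr// ltr_pMr// ltr1n.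
  move: tm; rewrite lt_min => /andP[td tr].
  have key s : `|s| = t -> s * dotp N v <= e * t.
    move=> st; have := hd s; rewrite st => /(_ td); rewrite g0 => h.
    have := hN _ (hr s _).1; rewrite st => /(_ tr) h1.
    have := cauchy_schwarz (- N) (g s - y - s *: v); rewrite enormN N1 mul1r dotpNl dotpBr dotpZr => h2.
    lra.
  have k1 := key t (gtr0_norm t0).
  have := key (- t); rewrite normrN (gtr0_norm t0) => /(_ erefl) k2.
  rewrite -(ler_pM2l t0) -{1}(gtr0_norm t0) -normrM ler_norml; lra.
near=> t; move=> /hN; rewrite addrC addKr dotpZr -enorm_sqr N1 expr1n mulr1.
by apply/negP; rewrite -ltNge; near: t; exact: nbhs_right_gt.
Unshelve. all: by end_near. Qed.

End supporting_normals.

(** * The outer normal as the unique supporting normal *)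

Section outer_normal_field.
Context {R : realType} {m : nat} (Omega : set 'rV[R]_m.+1).
Hypotheses (Omega_open : open Omega) (Omega0 : Omega !=set0)
  (Omega_convex : is_convex Omega) (Omega_C2 : C2_boundary Omega).
Implicit Types (x y z w N : 'rV[R]_m.+1).
Local Notation S := (boundary Omega).
Local Notation nu := (unit_normal_field Omega).

Let C_convex : segment_closed (closure Omega).
Proof. by apply: closure_segment; exact: is_convex_segment. Qed.

(* A boundary curve with velocity [- (w - y + a N)], followed by the chord towards
   the interior point [w], has midpoint on the ray [y - t N]; that point lies in the
   closure of [Omega] by convexity. *)
Lemma inward_not_exterior y N : S y -> supporting Omega y N ->
  (forall u, dotp N u = 0 -> tangent S y u) ->
  ~ (\forall t \near 0^'+, exterior Omega (y + t *: (- N))).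
Proof.
move=> Sy sN tanN hext; have [w Ow] := Omega0.
have : \forall t \near (0 : R), 0 < t -> exterior Omega (y + t *: (- N)) by exact: hext.
move=> /near0P[d3 d30 hd3].
have := supporting_interior Omega_open sN Ow; have [N1 _] := sN.
move/open_enormP : (Omega_open) => /(_ _ Ow)[r r0 hr].
(* [a] is the distance from [w] to the supporting hyperplane, so [w - y + a *: N] is orthogonal to
   [N]. *)
rewrite -oppr_gt0; set a := - dotp N (w - y) => a0.
have [|g [g0 gS /is_derive1_enormP gd]] := tanN (- (w - y + a *: N)).
  by rewrite dotpNr dotpDr dotpZr -enorm_sqr N1 expr1n mulr1 /a subrr oppr0.
have r2 : 0 < r / 2 by rewrite divr_gt0.
have [d2 d20 hd2] := gd _ r2; move/near0P : gS => [d1 d10 hd1].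
pose s := Num.min (Num.min 1 d1) (Num.min d2 (2 * d3 / a)) / 2.
have m0 : 0 < Num.min (Num.min 1 d1) (Num.min d2 (2 * d3 / a)).
  by rewrite !lt_min ltr01 d10 d20 divr_gt0// mulr_gt0.
have s0 : 0 < s by rewrite divr_gt0.
have : s < Num.min (Num.min 1 d1) (Num.min d2 (2 * d3 / a)).
  by rewrite /s ltr_pdivrMr// ltr_pMr// ltrDl.
rewrite !lt_min -!andbA ltr_pdivlMr// => /and4P[s1 sd1 sd2 sd3].
pose rem := g s - y - s *: (- (w - y + a *: N)).
have rem_le : enorm rem <= r / 2 * s.
  by have := hd2 s; rewrite gtr0_norm// g0; exact.
(* Perturbing [w] inside [Omega] cancels the remainder of the curve, so the midpoint falls exactly
   on the ray. *)
pose w' := w - s^-1 *: rem.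
have Ow' : Omega w'.
  apply: hr; rewrite /w' addrAC subrr add0r enormN enormZ gtr0_norm ?invr_gt0//.
  rewrite mulrC ltr_pdivrMr// (le_lt_trans rem_le)// ltr_pM2r//.
  by rewrite ltr_pdivrMr// ltr_pMr// ltrDl.
have Cgs : closure Omega (g s) by have [] : S (g s) by apply: hd1; rewrite gtr0_norm.
have Cq : closure Omega (y + s *: (w' - y)).
  apply: C_convex; [by case: Sy|exact: subset_closure|exact: ltW|exact: ltW].
have half0 : 0 <= 2^-1 :> R by rewrite invr_ge0.
have half1 : 2^-1 <= 1 :> R by rewrite invf_le1// ler1n.
have := C_convex Cgs Cq half0 half1.
have -> : g s + 2^-1 *: (y + s *: (w' - y) - g s) = y + (s * a / 2) *: (- N).
  rewrite /w' /rem; apply/rowP => i; rewrite !mxE; field.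
  by rewrite gt_eqF.
apply: hd3; last by rewrite divr_gt0// mulr_gt0.
by rewrite gtr0_norm ?divr_gt0 ?mulr_gt0// ltr_pdivrMr// (mulrC d3).
Qed.

(** [N] is orthogonal to the tangent vectors, hence a nonzero multiple of [M y], and every vector
    orthogonal to [M y] is tangent. *)
Lemma tangent_supporting y N : S y -> supporting Omega y N ->
  forall u, dotp N u = 0 -> tangent S y u.
Proof.
move=> Sy sN u Nu; have [M [H [d [d0 _ _ hM tanM]]]] := boundary_normal_field Omega_C2 Sy.
have [|M0 Nc] := hM _ Sy; first by rewrite subrr enorm0.
have [_ tN _] := supporting_outer_normal Sy sN.
have [c cE] := Nc _ tN; apply: tanM; apply/eqP; move/eqP: Nu; rewrite cE dotpZl mulf_eq0.
case/orP => // /eqP c0; move: sN => [+ _]; rewrite cE c0 scale0r enorm0 => /eqP.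
by rewrite eq_sym oner_eq0.
Qed.

(** Both vectors are unit multiples of [M y], hence equal or opposite; [inward_not_exterior] rules
    out the opposite sign. *)
Lemma outer_normal_unique y N N' : S y -> supporting Omega y N ->
  is_outer_normal Omega y N' -> N' = N.
Proof.
move=> Sy sN [N'1 tN' exN'].
have [M [H [d [d0 _ _ hM tanM]]]] := boundary_normal_field Omega_C2 Sy.
have [|M0 Nc] := hM _ Sy; first by rewrite subrr enorm0.
have [N1 tN _] := supporting_outer_normal Sy sN.
have [c cE] := Nc _ tN; have [c' c'E] := Nc _ tN'.
have c0 : c != 0.
  by apply: contra_eq_neq N1 => c0; rewrite cE c0 scale0r enorm0 eq_sym oner_eq0.
have N'N : N' = (c' / c) *: N by rewrite cE scalerA divfK.
move: N'1; rewrite N'N enormZ N1 mulr1 => k1.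
have [k0|k0] := leP 0 (c' / c); first by rewrite -[X in X *: _](ger0_norm k0) k1 scale1r.
exfalso; apply: (inward_not_exterior Sy sN (tangent_supporting Sy sN)).
have -> : - N = N' by rewrite N'N -scaleN1r -k1 ltr0_norm// opprK.
exact: exN'.
Qed.

Lemma outer_normalP y : S y -> supporting Omega y (outer_normal Omega y).
Proof.
move=> Sy; have [N sN] := supporting_exists Omega_open Omega0 Omega_convex Sy.
have h : is_outer_normal Omega y N by exact: supporting_outer_normal.
have := xgetI (0 : 'rV[R]_m.+1) (h : [set nu | is_outer_normal Omega y nu] N).
by rewrite -/(outer_normal Omega y) => /(outer_normal_unique Sy sN) ->.
Qed.

Lemma supporting_eq y N : S y -> supporting Omega y N -> N = outer_normal Omega y.
Proof.
move=> Sy sN; apply: (outer_normal_unique Sy (outer_normalP Sy)).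
exact: supporting_outer_normal.
Qed.

Lemma unit_normal_fieldP x : exterior Omega x ->
  nu x = outer_normal Omega (nearest Omega x).
Proof.
move=> ex; apply: supporting_eq; first by have [] := nearestP Omega_open Omega0 Omega_convex ex.
by split; [exact: enorm_nu|move=> z; exact: nu_obtuse].
Qed.

Local Opaque outer_normal.

(** Sum of the supporting inequalities at [y] and [z]; the sign of the curvatures comes from
    here. *)
Lemma outer_normal_monotone y z : S y -> S z ->
  0 <= dotp (outer_normal Omega z - outer_normal Omega y) (z - y).
Proof.
move=> Sy Sz; have [_ /(_ z)] := outer_normalP Sy; have [_ /(_ y)] := outer_normalP Sz.
rewrite (dotpBl (outer_normal Omega z)) => /(_ Sy.1) h1 /(_ Sz.1) h2.
rewrite subr_ge0; apply: (le_trans h2).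
by rewrite -oppr_le0 -dotpNr opprB.
Qed.

End outer_normal_field.

Local Opaque delta nearest unit_normal_field outer_normal.

(** * The Gauss map and principal curvatures *)

Section projection_away.
Context {R : realType} {n : nat} (N : 'rV[R]_n).
Implicit Types x : 'rV[R]_n.
Hypothesis NN : dotp N N = 1.

Definition tangential : 'M[R]_n := 1%:M - N^T *m N.

Lemma mul_tangential x : x *m tangential = x - dotp x N *: N.
Proof.
rewrite /tangential mulmxBr mulmx1 mulmxA; congr (_ - _).
by rewrite -mul_scalar_mx; congr (_ *m _); apply/matrixP => i j; rewrite !ord1 -dotpE mxE.
Qed.

Lemma tr_tangential : tangential^T = tangential.
Proof. by rewrite /tangential linearB/= trmx1 trmx_mul trmxK. Qed.

Lemma mulN_tangential : N *m tangential = 0.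
Proof. by rewrite mul_tangential NN scale1r subrr. Qed.

Lemma enorm_tangential x : enorm (x *m tangential) <= enorm x.
Proof.
rewrite mul_tangential; apply: enorm_le.
rewrite !(dotpBl, dotpBr, dotpZl, dotpZr) NN (dotpC N x).
have := sqr_ge0 (dotp x N); lra.
Qed.

End projection_away.

Section weingarten.
Context {R : realType}.

(* The remainder of the Gauss map of a level set: [M] is a (not normalized)
   normal field with [M y = N y], differentiable at [y] with derivative [H]. *)
Lemma normalized_expansion n (N Nz Mz h : 'rV[R]_n) (H : 'M[R]_n) (q K e : R) :
  dotp N N = 1 -> dotp Nz Nz = 1 -> 0 < q -> Nz = q *: Mz ->
  1 <= K -> enorm (h *m H) <= K * enorm h -> enorm (N *m H) <= K ->
  enorm (Mz - N) <= K * enorm h -> enorm (Mz - N - h *m H) <= e * enorm h ->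
  dotp N h <= 0 -> 0 <= dotp Nz h -> 2 * K * enorm h <= 1 ->
  enorm (Nz - N - h *m (tangential N *m H *m tangential N)) <=
    16 * K ^+ 2 * enorm h ^+ 2 + e * enorm h.
Proof.
move=> NN NzNz q0 NzE K1 hH NH MzN he Nh Nzh hsmall.
have eN : enorm N = 1 by exact: enorm_dotp1.
have eNz : enorm Nz = 1 by exact: enorm_dotp1.
have h0 := enorm_ge0 h.
have qM : q * enorm Mz = 1 by rewrite -eNz NzE enormZ gtr0_norm.
have Mz1 : `|enorm Mz - 1| <= K * enorm h.
  by rewrite -eN; exact: le_trans (enorm_dist _ _) MzN.
have q2 : q <= 2.
  have M2 : 2^-1 <= enorm Mz by move: Mz1; rewrite ler_norml; lra.
  by have := ler_wpM2l (ltW q0) M2; rewrite qM ler_pdivrMr// mul1r.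
have q1 : `|q - 1| <= 2 * K * enorm h.
  have -> : q - 1 = q * (1 - enorm Mz) by rewrite mulrBr mulr1 qM.
  rewrite normrM (gtr0_norm q0) distrC -mulrA.
  by apply: ler_pM => //; exact: ltW.
pose D := Nz - N.
have DE : D = (q - 1) *: N + q *: (Mz - N).
  by rewrite /D NzE; apply/rowP => i; rewrite !mxE; ring.
have Dle : enorm D <= 4 * K * enorm h.
  rewrite DE (le_trans (enormD _ _))// !enormZ eN mulr1 (gtr0_norm q0).
  have : q * enorm (Mz - N) <= 2 * (K * enorm h) by apply: ler_pM => //; [exact: ltW|exact: enorm_ge0].
  lra.
(* A difference of unit vectors has a normal component of second order. *)
have DN : dotp D N = - (dotp D D / 2).
  by rewrite /D !(dotpBl, dotpBr) NN NzNz (dotpC N Nz); field.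
have DN_le : enorm (dotp D N *: N) <= 8 * K ^+ 2 * enorm h ^+ 2.
  rewrite enormZ eN mulr1 DN normrN ger0_norm ?divr_ge0 ?dotp_ge0// -enorm_sqr.
  have : enorm D ^+ 2 <= (4 * K * enorm h) ^+ 2.
    rewrite ler_pXn2r// nnegrE ?enorm_ge0// !mulr_ge0//; lra.
  rewrite !exprMn; lra.
(* The two sign hypotheses on [h] give [0 <= - dotp N h <= dotp (Nz - N) h], so the normal part of
   the displacement is also of second order. *)
have hN_le : `|dotp h N| <= 4 * K * enorm h * enorm h.
  rewrite dotpC ler0_norm//.
  have -> : - dotp N h = dotp D h - dotp Nz h by rewrite /D dotpBl; ring.
  rewrite lerBlDr ler_wpDr//.
  by apply: (le_trans (cauchy_schwarz _ _)); rewrite ler_wpM2r.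
(* [D] is split into normal and tangential parts. Since [tangential N] kills [N], only the expansion
   of [Mz - N] and three second-order errors remain. *)
have -> : D - h *m (tangential N *m H *m tangential N) =
    dotp D N *: N + (q - 1) *: ((Mz - N) *m tangential N)
    + ((Mz - N - h *m H) *m tangential N + dotp h N *: (N *m H *m tangential N)).
  have D2 : D = dotp D N *: N + D *m tangential N by rewrite mul_tangential addrC subrK.
  have h2 : h *m tangential N = h - dotp h N *: N by rewrite mul_tangential.
  rewrite {1}D2 {2}DE mulmxDl -!scalemxAl mulN_tangential// scaler0 add0r.
  rewrite !mulmxA h2 !mulmxBl -!scalemxAl.
  by move: (N *m _) (Mz *m _) (N *m H *m _) (h *m H *m _) => A1 A2 A3 A4; apply/rowP => i; rewrite !mxE; ring.
apply: (le_trans (enormD _ _)).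
have t1 : enorm (dotp D N *: N + (q - 1) *: ((Mz - N) *m tangential N)) <=
    8 * K ^+ 2 * enorm h ^+ 2 + 2 * K ^+ 2 * enorm h ^+ 2.
  apply: (le_trans (enormD _ _)); apply: lerD => //; rewrite enormZ.
  have -> : 2 * K ^+ 2 * enorm h ^+ 2 = 2 * K * enorm h * (K * enorm h) by ring.
  apply: ler_pM => //; first exact: enorm_ge0.
  exact: le_trans (enorm_tangential NN _) MzN.
have t2 : enorm ((Mz - N - h *m H) *m tangential N + dotp h N *: (N *m H *m tangential N)) <=
    e * enorm h + 4 * K ^+ 2 * enorm h ^+ 2.
  apply: (le_trans (enormD _ _)); apply: lerD.
    exact: le_trans (enorm_tangential NN _) he.
  rewrite enormZ; have -> : 4 * K ^+ 2 * enorm h ^+ 2 = 4 * K * enorm h * enorm h * K by ring.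
  apply: ler_pM => //; first exact: enorm_ge0.
  exact: le_trans (enorm_tangential NN _) NH.
have : 0 <= K ^+ 2 * enorm h ^+ 2 by rewrite mulr_ge0 ?sqr_ge0.
move: t1 t2; move: (enorm (dotp D N *: N + _)) (enorm (_ + dotp h N *: _)) => a b.
move: (K ^+ 2) (enorm h ^+ 2) (e * enorm h) => A B C; rewrite -!mulrA.
move: (A * B) => AB; lra.
Qed.

End weingarten.

Section gauss_map.
Context {R : realType} {m : nat} (Omega : set 'rV[R]_m.+1).
Hypotheses (Omega_open : open Omega) (Omega0 : Omega !=set0)
  (Omega_convex : is_convex Omega) (Omega_C2 : C2_boundary Omega).
Implicit Types (x y z w : 'rV[R]_m.+1).
Local Notation S := (boundary Omega).
Local Notation N := (outer_normal Omega).

(** Once scaled to agree with [N] at [y], the graph normal is a positive multiple of [N] nearby, and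
    normalizing projects its differential onto the tangent space. The projection on the other side
    costs only second order, displacements along the boundary being tangential to first order; it
    makes [B] symmetric. *)
Lemma outer_normal_expansion y : S y ->
  exists B : 'M[R]_m.+1, [/\ B^T = B, N y *m B = 0 &
    forall e, 0 < e -> exists2 d, 0 < d & forall z, S z -> enorm (z - y) < d ->
      enorm (N z - N y - (z - y) *m B) <= e * enorm (z - y)].
Proof.
move=> Sy; have [M [H [d0 [d00 HT Mexp hM tanM]]]] := boundary_normal_field Omega_C2 Sy.
have sN z : S z -> supporting Omega z (N z) by exact: outer_normalP.
have [N1 _] := sN _ Sy.
have NN : dotp (N y) (N y) = 1 by rewrite -enorm_sqr N1 expr1n.
have NM z : S z -> enorm (z - y) < d0 -> exists c, N z = c *: M z.
  move=> Sz zd; have [_] := hM _ Sz zd; apply => v tv.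
  by have [_ /(_ _ tv)] := supporting_outer_normal Sz (sN _ Sz).
have [|c cE] := NM _ Sy; first by rewrite subrr enorm0.
have c0 : c != 0.
  by apply: contra_eq_neq N1 => c0; rewrite cE c0 scale0r enorm0 eq_sym oner_eq0.
pose M' z := c *: M z; pose H' := c *: H.
have M'exp e : 0 < e -> exists2 d', 0 < d' & forall z, enorm (z - y) < d' ->
    enorm (M' z - N y - (z - y) *m H') <= e * enorm (z - y).
  move=> e0; have e'0 : 0 < e / `|c| by rewrite divr_gt0// normr_gt0.
  have [d' d'0 hd'] := Mexp _ e'0; exists d' => // z zd.
  rewrite cE /M' /H' -scalemxAr -!scalerBr enormZ -ler_pdivlMl ?normr_gt0//.
  by rewrite mulrA [_^-1 * e]mulrC; exact: hd'.
have [w Ow] := Omega0.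
have a0 := supporting_interior Omega_open (sN _ Sy) Ow.
have [K1 K10 hK1] := mulmx_enorm_bound H'.
pose K := K1 + 1.
have K_1 : 1 <= K by rewrite lerDr ltW.
exists (tangential (N y) *m H' *m tangential (N y)); split.
- by rewrite !trmx_mul tr_tangential linearZ/= HT mulmxA.
- by rewrite !mulmxA mulN_tangential// !mul0mx.
move=> e e0; have e2 : 0 < e / 2 by rewrite divr_gt0.
have [d1 d10 hd1] := M'exp _ e2; have [d2 d20 hd2] := M'exp 1 ltr01.
pose b := - dotp (N y) (w - y).
have b0 : 0 < b by rewrite oppr_gt0.
pose C := K * (enorm (w - y) + 1) + 1.
have K0 : 0 < K by exact: lt_le_trans ltr01 K_1.
have C0 : 0 < C by rewrite ltr_wpDl// mulr_ge0 ?(ltW K0)// addr_ge0 ?enorm_ge0.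
(* [d3] preserves the sign of [dotp (M' z) (w - z)]; [d4] meets the smallness condition of
   [normalized_expansion] and brings its quadratic term below [e / 2 * enorm (z - y)]. *)
pose d3 := Num.min 1 (b / C).
have d30 : 0 < d3 by rewrite lt_min ltr01 divr_gt0.
pose d4 := Num.min (2 * K)^-1 (e / 2 / (16 * K ^+ 2)).
have d40 : 0 < d4.
  by rewrite lt_min invr_gt0 !divr_gt0 ?mulr_gt0 ?exprn_gt0.
exists (Num.min (Num.min d0 d1) (Num.min d2 (Num.min d3 d4))).
  rewrite lt_min; apply/andP; split; first by rewrite lt_min d00.
  by rewrite lt_min d20/= lt_min d30; exact: d40.
move=> z Sz; rewrite 3!lt_min => /andP[/andP[zd0 zd1]] /andP[zd2]; rewrite lt_min => /andP[zd3 zd4].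
have {hd1} h1 := hd1 _ zd1; have {hd2} h2 := hd2 _ zd2.
have hH := hK1 (z - y).
have MzN : enorm (M' z - N y) <= K * enorm (z - y).
  rewrite -(subrK ((z - y) *m H') (M' z - N y)) (le_trans (enormD _ _))//.
  by rewrite /K mulrDl addrC lerD.
have h0 := enorm_ge0 (z - y).
have KE : K1 <= K by rewrite lerDl.
have [c' c'E] := NM _ Sz zd0.
have NzE : N z = (c' / c) *: M' z by rewrite /M' scalerA divfK.
have [Nz1 _] := sN _ Sz.
have NzNz : dotp (N z) (N z) = 1 by rewrite -enorm_sqr Nz1 expr1n.
(* Collinearity leaves the sign of [c' / c] open. Near [y] both [M' z] and [N z] have a negative
   product with [w - z], so the ratio is positive. *)
have M'w : dotp (M' z) (w - z) < 0.
  have -> : dotp (M' z) (w - z) = - b + (dotp (M' z - N y) (w - z) - dotp (N y) (z - y)).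
    by rewrite /b !(dotpBl, dotpBr); ring.
  rewrite addrC subr_lt0.
  have l1 : dotp (M' z - N y) (w - z) <= K * enorm (z - y) * (enorm (w - y) + 1).
    apply: (le_trans (cauchy_schwarz _ _)); apply: ler_pM => //; try exact: enorm_ge0.
    apply: (le_trans (enorm_triangle y _ _)); rewrite lerD2l enormC ltW//.
    by apply: (lt_le_trans zd3); rewrite ge_min lexx.
  have l2 : - dotp (N y) (z - y) <= enorm (z - y).
    by rewrite -dotpNr (le_trans (cauchy_schwarz _ _))// N1 mul1r enormN.
  apply: (le_lt_trans (lerD l1 l2)).
  have -> : K * enorm (z - y) * (enorm (w - y) + 1) + enorm (z - y) = enorm (z - y) * C by rewrite /C; ring.
  by rewrite -ltr_pdivlMr// (lt_le_trans zd3)// ge_min lexx orbT.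
have q0 : 0 < c' / c.
  have := supporting_interior Omega_open (sN _ Sz) Ow.
  by rewrite NzE dotpZl; rewrite nmulr_llt0.
have NyH : enorm (N y *m H') <= K.
  by apply: (le_trans (hK1 _)); rewrite N1 mulr1.
have Nh : dotp (N y) (z - y) <= 0 by apply: (sN _ Sy).2; case: Sz.
have Nzh : 0 <= dotp (N z) (z - y).
  by rewrite -oppr_le0 -dotpNr opprB; apply: (sN _ Sz).2; case: Sy.
have K2 : 2 * K * enorm (z - y) <= 1.
  rewrite mulrC -ler_pdivlMr ?mulr_gt0// mul1r ltW// (lt_le_trans zd4)//.
  by rewrite ge_min lexx.
apply: (le_trans (normalized_expansion NN NzNz q0 NzE K_1 (le_trans hH (ler_wpM2r h0 KE)) NyH MzN h1 Nh Nzh K2)).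
rewrite [leRHS](_ : _ = e / 2 * enorm (z - y) + e / 2 * enorm (z - y)); last by rewrite -mulrDl -splitr.
rewrite lerD2r [enorm _ ^+ 2]expr2 mulrA ler_wpM2r// mulrC -ler_pdivlMr ?mulr_gt0 ?exprn_gt0//.
by rewrite ltW// (lt_le_trans zd4)// ge_min lexx orbT.
Qed.

End gauss_map.

(** * Principal curvatures as eigenvalues of the differential of the normal *)

Section principal_curvatures.
Context {R : realType} {m : nat} (Omega : set 'rV[R]_m.+1).
Hypotheses (Omega_open : open Omega) (Omega0 : Omega !=set0)
  (Omega_convex : is_convex Omega) (Omega_C2 : C2_boundary Omega).
Implicit Types (x y z w : 'rV[R]_m.+1).
Local Notation S := (boundary Omega).
Local Notation N := (outer_normal Omega).
Local Notation nu := (unit_normal_field Omega).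

Let gauss_map_differential y (B : 'M[R]_m.+1) :=
  [/\ B^T = B, N y *m B = 0 &
    forall e, 0 < e -> exists2 d, 0 < d & forall z, S z -> enorm (z - y) < d ->
      enorm (N z - N y - (z - y) *m B) <= e * enorm (z - y)].

(** The chain rule is carried out by hand, since [B] controls the normal only along the boundary. *)
Lemma curve_gauss_derivative y B v g : gauss_map_differential y B ->
  is_curve S y v g -> is_derive (0 : R) (1 : R) (N \o g) (v *m B).
Proof.
move=> [_ _ hB] [g0 gS /is_derive1_enormP gd]; apply/is_derive1_enormP => e e0.
have [K K0 hK] := mulmx_enorm_bound B.
have V0 : 0 < enorm v + 1 by rewrite ltr_wpDl ?enorm_ge0.
have e1 : 0 < e / 2 / (enorm v + 1) by rewrite !divr_gt0.
have e2 : 0 < e / 2 / K by rewrite !divr_gt0.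
have [d1 d10 hd1] := hB _ e1; have [d2 d20 hd2] := gd _ e2.
have [d3 d30 hd3] := gd _ ltr01; move/near0P : gS => [d4 d40 hd4].
exists (Num.min (Num.min d2 d3) (Num.min d4 (d1 / (enorm v + 1)))).
  by rewrite !lt_min d20 d30 d40 divr_gt0.
move=> t; rewrite !lt_min -!andbA ltr_pdivlMr// => /and4P[td2 td3 td4 td1].
have := hd2 _ td2; have := hd3 _ td3; rewrite g0 mul1r /= g0 => h3 h2.
have gt : enorm (g t - y) <= `|t| * (enorm v + 1).
  rewrite -(subrK (t *: v) (g t - y)) (le_trans (enormD _ _))// enormZ.
  by rewrite mulrDr mulr1 addrC lerD.
have h1 := hd1 _ (hd4 _ td4) (le_lt_trans gt td1).
have -> : N (g t) - N y - t *: (v *m B) =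
   (N (g t) - N y - (g t - y) *m B) + (g t - y - t *: v) *m B.
  by rewrite (mulmxBl (g t - y)) -scalemxAl addrA subrK.
apply: (le_trans (enormD _ _)); rewrite [in leRHS](splitr e) mulrDl lerD//.
  apply: (le_trans h1); apply: (le_trans (ler_wpM2l (ltW e1) gt)).
  by rewrite mulrCA divfK ?gt_eqF// mulrC.
apply: (le_trans (hK _)); apply: (le_trans (ler_wpM2l (ltW K0) h2)).
by rewrite mulrA [K * _]mulrC divfK// gt_eqF.
Qed.

Lemma tangent_normal y v : S y -> tangent S y v -> dotp (N y) v = 0.
Proof.
move=> Sy tv; have sN := outer_normalP Omega_open Omega0 Omega_convex Omega_C2 Sy.
by have [_ /(_ _ tv)] := supporting_outer_normal Sy sN.
Qed.

(** An orthonormal eigenbasis of [B] in the complement of [N y] consists of tangent vectors, and its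
    eigenvalues are principal curvatures. *)
Lemma principal_curvatures_exist y : S y ->
  exists kappa, is_principal_curvatures Omega y kappa.
Proof.
move=> Sy.
have [B hB] := outer_normal_expansion Omega_open Omega0 Omega_convex Omega_C2 Sy.
have [BT NB _] := hB.
have sN := outer_normalP Omega_open Omega0 Omega_convex Omega_C2 Sy.
have NN : dotp (N y) (N y) = 1 by have [N1 _] := sN; rewrite -enorm_sqr N1 expr1n.
have [V [d [VV VN Vd]]] := @spectral_orthonormal R m.+1 m B (N y) BT NB NN (ltnSn m).
exists (\row_i d i), (fun i => row i V); split.
  move=> i j; rewrite dotpE; have /matrixP/(_ i j) := VV.
  by rewrite !mxE => <-; apply: eq_bigr => k _; rewrite !mxE.
move=> i; split.
  apply: (tangent_supporting Omega_C2 Sy sN).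
  by rewrite dotpC dotpE -row_mul VN !mxE.
by move=> g cg; rewrite mxE -Vd; exact: curve_gauss_derivative hB cg.
Qed.

(** Whatever principal directions the choice operator returns, they are eigenvectors of [B]: the
    derivative of the normal along one curve is unique. *)
Lemma principal_directionP y B kappa (v : 'I_m -> 'rV[R]_m.+1) i : S y ->
  gauss_map_differential y B ->
  is_deriv_along S N y (v i) (kappa *: v i) -> v i *m B = kappa *: v i.
Proof.
move=> Sy hB [[g cg] /(_ _ cg) dg].
have dB := curve_gauss_derivative hB cg.
by rewrite -(@derive_val _ _ _ _ _ _ _ dB) (@derive_val _ _ _ _ _ _ _ dg).
Qed.

(** Along a curve with velocity [v], [outer_normal_monotone] reads
    [0 <= t ^ 2 * kappa + o(t ^ 2)]. *)
Lemma principal_curvature_ge0 y kappa v : S y -> dotp v v = 1 ->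
  is_deriv_along S N y v (kappa *: v) -> 0 <= kappa.
Proof.
move=> Sy vv [[g cg] /(_ _ cg) /is_derive1_enormP dN].
have v1 : enorm v = 1 by exact: enorm_dotp1.
have [g0 gS /is_derive1_enormP dg] := cg.
apply/ler_addgt0Pl => e e0.
have k2 : 0 < `|kappa| + 2 by rewrite ltr_wpDl.
(* The remainders of the curve and of the normal are at most [r * t]; as [r <= 1], the cross terms
   add up to at most [r * (|kappa| + 2) * t ^ 2]. *)
pose r := Num.min 1 (e / (`|kappa| + 2)).
have r0 : 0 < r by rewrite lt_min ltr01 divr_gt0.
have r1 : r <= 1 by rewrite ge_min lexx.
have re : r * (`|kappa| + 2) <= e by rewrite -ler_pdivlMr// ge_min lexx orbT.
have [d1 d10 hd1] := dN _ r0; have [d2 d20 hd2] := dg _ r0.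
move/near0P : gS => [d3 d30 hd3].
have [t t0] : exists2 t, 0 < t & t < Num.min d1 (Num.min d2 d3).
  have m0 : 0 < Num.min d1 (Num.min d2 d3) by rewrite !lt_min d10 d20.
  exists (Num.min d1 (Num.min d2 d3) / 2); first by rewrite divr_gt0.
  by rewrite ltr_pdivrMr// ltr_pMr// ltrDl.
have ta : `|t| = t by rewrite gtr0_norm.
rewrite !lt_min -ta => /and3P[td1 td2 td3].
have := hd1 _ td1; have := hd2 _ td2; rewrite /= g0 ta.
rewrite scalerA => p1 q1.
have := outer_normal_monotone Omega_open Omega0 Omega_convex Omega_C2 Sy (hd3 _ td3).
have [p pE] : exists p : 'rV[R]_m.+1, g t - y = t *: v + p.
  by exists (g t - y - t *: v); rewrite [RHS]addrC subrK.
have [q qE] : exists q : 'rV[R]_m.+1, N (g t) - N y = (t * kappa) *: v + q.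
  by exists (N (g t) - N y - (t * kappa) *: v); rewrite [RHS]addrC subrK.
rewrite pE (addrC (t *: v)) addrK in p1; rewrite qE (addrC (_ *: v)) addrK in q1.
rewrite pE qE.
rewrite dotpDl !dotpDr !dotpZl !dotpZr vv mulr1.
have a1 := cauchy_schwarz_norm v p; have a2 := cauchy_schwarz_norm q v.
have a3 := cauchy_schwarz q p; have pq : enorm q * enorm p <= r * t * (r * t).
  by apply: ler_pM => //; exact: enorm_ge0.
rewrite v1 mul1r in a1; rewrite v1 mulr1 in a2.
have b1 : t * kappa * dotp v p <= t * `|kappa| * (r * t).
  apply: (le_trans (ler_norm _)); rewrite (normrM (t * kappa)) (normrM t) ta ler_pM ?mulr_ge0 ?normr_ge0 ?(ltW t0)//.
  exact: le_trans a1 p1.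
have b2 : t * dotp q v <= t * (r * t).
  rewrite ler_pM2l//; exact: le_trans (ler_norm _) (le_trans a2 q1).
have b3 := le_trans a3 pq.
move=> h; have t20 : 0 < t * t by rewrite mulr_gt0.
rewrite -(pmulr_rge0 _ t20).
have b4 : r * t * (r * t) <= r * (t * t).
  rewrite (_ : r * t * (r * t) = r * (r * (t * t))); last by ring.
  by rewrite ler_wpM2l ?(ltW r0)// ler_piMl// ltW.
have b5 : t * t * (r * (`|kappa| + 2)) <= t * t * e by rewrite ler_wpM2l// ltW.
move: b1 b2 b3 b4 b5 h; clear; move: (dotp q p) (dotp q v) (dotp v p) (`|kappa|) => A B C D.
lra.
Qed.

Lemma principal_curvaturesP y : S y ->
  is_principal_curvatures Omega y (principal_curvatures Omega y).
Proof.
by move=> /principal_curvatures_exist[k hk]; exact: (xgetI 0 hk).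
Qed.

Lemma kappa_tilde_ge0 x : exterior Omega x -> 0 <= kappa_tilde Omega x.
Proof.
move=> ex; have [Sy _] := nearestP Omega_open Omega0 Omega_convex ex.
have [v [vv vk]] := principal_curvaturesP Sy.
have d0 := delta_gt0 Omega0 ex.
apply: sumr_ge0 => i _.
have k0 : 0 <= principal_curvatures Omega (nearest Omega x) 0 i.
  by apply: principal_curvature_ge0 (vk i) => //; rewrite vv eqxx.
by rewrite divr_ge0// addr_ge0// mulr_ge0// ltW.
Qed.

End principal_curvatures.

(** * The divergence of the unit normal field *)

Section unit_normal_derivative.
Context {R : realType}.

(* In a principal direction the displacements of the point ([w]), of its nearest
   point ([eta]) and of the normal ([D]) satisfy [D ~ k eta] and [w ~ eta + d D],
   whence [D ~ k / (1 + d k) w]. *)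
Lemma curvature_component (d d' k eta r w D : R) : 0 <= k -> 0 < d ->
  D = k * eta + r -> w = eta + d' * D ->
  `|D - k / (1 + d * k) * w| <= `|r| + k * `|d - d'| * `|D|.
Proof.
move=> k0 d0 DE wE.
have p0 : 0 < 1 + d * k by rewrite ltr_pwDl// mulr_ge0// ltW.
have p1 : 1 <= 1 + d * k by rewrite lerDl mulr_ge0// ltW.
have E : (1 + d * k) * (D - k / (1 + d * k) * w) = r + k * (d - d') * D.
  have -> : r = D - k * eta by rewrite DE; ring.
  by rewrite wE; field; rewrite gt_eqF.
have -> : D - k / (1 + d * k) * w = (1 + d * k)^-1 * (r + k * (d - d') * D).
  by rewrite -E mulrA mulVf ?mul1r// gt_eqF.
rewrite normrM gtr0_norm ?invr_gt0//.
apply: (le_trans (_ : _ <= 1 * `|r + k * (d - d') * D|)).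
  by rewrite ler_wpM2r// invf_le1.
rewrite mul1r (le_trans (ler_normD _ _))// lerD2l !normrM (ger0_norm k0)//.
Qed.

Lemma orthonormal_expand m (v : 'I_m -> 'rV[R]_m.+1) (N x : 'rV[R]_m.+1) :
  (forall i j, dotp (v i) (v j) = (i == j)%:R) -> (forall i, dotp (v i) N = 0) ->
  dotp N N = 1 -> x = dotp x N *: N + \sum_i dotp x (v i) *: v i.
Proof.
move=> vv vN NN; apply/rowP => b; rewrite !mxE summxE.
have h := orthonormal_complete vv vN NN.
transitivity (\sum_a x 0 a * (a == b)%:R).
  by rewrite (bigD1 b)//= eqxx mulr1 big1 ?addr0// => a /negbTE ->; rewrite mulr0.
transitivity (\sum_a (x 0 a * N 0 a * N 0 b + \sum_i x 0 a * v i 0 a * v i 0 b)).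
  apply: eq_bigr => a _; rewrite -h mulrDr mulrA mulr_sumr; congr (_ + _).
  by apply: eq_bigr => i _; rewrite mulrA.
rewrite big_split/= exchange_big/=; congr (_ + _).
  by rewrite mulr_suml.
by apply: eq_bigr => i _; rewrite mxE mulr_suml.
Qed.

Context {m : nat} (Omega : set 'rV[R]_m.+1).
Hypotheses (Omega_open : open Omega) (Omega0 : Omega !=set0)
  (Omega_convex : is_convex Omega) (Omega_C2 : C2_boundary Omega).
Implicit Types (x y z w : 'rV[R]_m.+1).
Local Notation nu := (unit_normal_field Omega).

(** Since the nearest point is already known to be Lipschitz, its displacement is at most [enorm w],
    and the relation between point, nearest point and normal is solved direction by direction
    ([curvature_component]). The bound [lam i <= (delta Omega x)^-1] holds for curvatures of any
    size and replaces their continuity later on. *)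
Lemma unit_normal_expansion x : exterior Omega x ->
  exists (v : 'I_m -> 'rV[R]_m.+1) (lam : 'I_m -> R),
  [/\ forall i j, dotp (v i) (v j) = (i == j)%:R,
     forall i, 0 <= lam i <= (delta Omega x)^-1,
     \sum_i lam i = kappa_tilde Omega x &
     forall e, 0 < e -> exists2 d, 0 < d & forall w, enorm w < d ->
       exterior Omega (x + w) /\
       enorm (nu (x + w) - nu x - \sum_i (lam i * dotp w (v i)) *: v i) <= e * enorm w].
Proof.
move=> ex; have hx := nearestP Omega_open Omega0 Omega_convex ex; have [Sy _] := hx.
set y := nearest Omega x in Sy hx *.
have d0 := delta_gt0 Omega0 ex; set dx := delta Omega x in d0 *.
have [B hB] := outer_normal_expansion Omega_open Omega0 Omega_convex Omega_C2 Sy.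
have [BT NB Bexp] := hB.
have [v [vv vk]] := principal_curvaturesP Omega_open Omega0 Omega_convex Omega_C2 Sy.
set kappa := principal_curvatures Omega y in vk *.
have k0 i : 0 <= kappa 0 i.
  apply: (principal_curvature_ge0 Omega_open Omega0 Omega_convex Omega_C2 Sy _ (vk i)).
  by rewrite vv eqxx.
have vB i : v i *m B = kappa 0 i *: v i by exact: (principal_directionP Sy hB (vk i)).
have nuE := unit_normal_fieldP Omega_open Omega0 Omega_convex Omega_C2.
have vN i : dotp (v i) (nu x) = 0.
  rewrite nuE// dotpC; apply: (tangent_normal Omega_open Omega0 Omega_convex Omega_C2 Sy).
  by case: (vk i).
have nn : dotp (nu x) (nu x) = 1 by rewrite -enorm_sqr enorm_nu// expr1n.
pose lam i := kappa 0 i / (1 + dx * kappa 0 i).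
exists v, lam; split => //.
  move=> i; have p0 : 0 < 1 + dx * kappa 0 i by rewrite ltr_pwDl// mulr_ge0// ltW.
  rewrite /lam divr_ge0 ?(ltW p0)//= ler_pdivrMr// mulrDr mulr1 mulrA mulVf ?gt_eqF// mul1r.
  by rewrite lerDr invr_ge0 ltW.
have [K K0 hK] := mulmx_enorm_bound B.
pose T := \sum_i kappa 0 i.
have T0 : 0 <= T by apply: sumr_ge0.
move=> e e0.
(* The [m.+1] first-order errors, one per principal direction and one along the normal, share
   [e / 2]; the other half pays for the terms quadratic in [w], through [d3]. *)
pose e1 := Num.min 1 (e / (2 * m.+1%:R)).
have e10 : 0 < e1 by rewrite lt_min ltr01 divr_gt0// mulr_gt0.
have [d1 d10 hd1] := Bexp _ e10.
have [d2 d20 hd2] : exists2 d, 0 < d & forall w, enorm w < d -> exterior Omega (x + w).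
  have /open_enormP/(_ _ ex)[d dpos hd] := @exterior_open _ _ Omega.
  by exists d => // w wd; apply: hd; rewrite addrC addKr.
pose d3 := e / 2 / (T * (K + 1) + 1).
have TK : 0 < T * (K + 1) + 1 by rewrite ltr_wpDl// mulr_ge0// addr_ge0// ltW.
have d30 : 0 < d3 by rewrite !divr_gt0.
exists (Num.min d1 (Num.min d2 d3)); first by rewrite !lt_min d10 d20.
move=> w; rewrite lt_min => /andP[wd1]; rewrite lt_min => /andP[wd2 wd3].
have ez := hd2 _ wd2; split => //.
have [Sz _] := nearestP Omega_open Omega0 Omega_convex ez.
pose eta := nearest Omega (x + w) - y.
have eta_le : enorm eta <= enorm w.
  apply: (le_trans (nearest_lipschitz Omega_open Omega0 Omega_convex ez ex)).
  by rewrite addrC addKr.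
pose D := nu (x + w) - nu x; pose r := D - eta *m B.
have r_le : enorm r <= e1 * enorm w.
  rewrite /r /D !nuE//; apply: (le_trans (hd1 _ Sz (le_lt_trans eta_le wd1))).
  by rewrite ler_wpM2l// ltW.
have D_le : enorm D <= (K + 1) * enorm w.
  have -> : D = eta *m B + r by rewrite /r addrC subrK.
  apply: (le_trans (enormD _ _)); rewrite mulrDl lerD//.
    by apply: (le_trans (hK _)); rewrite ler_wpM2l// ltW.
  by apply: (le_trans r_le); rewrite ler_wpM2r ?enorm_ge0// ge_min lexx.
pose dz := delta Omega (x + w).
have dd : `|dx - dz| <= enorm w.
  by apply: (le_trans (delta_lipschitz Omega0 _ _)); rewrite opprD addrA subrr add0r enormN.
have wE : w = eta + dz *: D + (dz - dx) *: nu x.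
  have gen (p q a b : 'rV[R]_m.+1) (s t : R) :
     q + t *: b - (p + s *: a) = (q - p) + t *: (b - a) + (t - s) *: a by vring.
  rewrite /eta /D -gen -!(unit_normal_fieldE Omega0)//.
  by rewrite addrC addKr.
have comp i : `|dotp D (v i) - lam i * dotp w (v i)| <= e1 * enorm w + kappa 0 i * (enorm w * ((K + 1) * enorm w)).
  apply: (le_trans (@curvature_component dx dz (kappa 0 i) (dotp eta (v i)) (dotp r (v i)) (dotp w (v i)) (dotp D (v i)) (k0 i) d0 _ _)).
  - rewrite /r (dotpBl D) dotp_mulmx BT vB dotpZr; ring.
  - by rewrite {1}wE (dotpDl (eta + dz *: D)) (dotpDl eta) (dotpZl dz) (dotpZl (dz - dx)) (dotpC (nu x)) vN mulr0 addr0.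
  have v1 : enorm (v i) = 1 by apply: enorm_dotp1; rewrite vv eqxx.
  apply: lerD.
    by apply: (le_trans (cauchy_schwarz_norm _ _)); rewrite v1 mulr1.
  rewrite -mulrA ler_wpM2l//; apply: ler_pM => //.
  by apply: (le_trans (cauchy_schwarz_norm _ _)); rewrite v1 mulr1.
have DN : `|dotp D (nu x)| <= e1 * enorm w.
  have -> : dotp D (nu x) = dotp r (nu x).
    have nB : nu x *m B = 0 by rewrite (nuE _ ex).
    by rewrite /r (dotpBl D) dotp_mulmx BT nB dotp0r subr0.
  by apply: (le_trans (cauchy_schwarz_norm _ _)); rewrite enorm_nu// mulr1.
rewrite -/D {1}(orthonormal_expand D vv vN nn) -addrA -sumrB.
apply: (le_trans (enormD _ _)).
have w0 := enorm_ge0 w.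
have s1 : enorm (\sum_i (dotp D (v i) *: v i - (lam i * dotp w (v i)) *: v i)) <=
    \sum_i (e1 * enorm w + kappa 0 i * (enorm w * ((K + 1) * enorm w))).
  elim/big_ind2 : _ => [|a b c f h1 h2|i _]; first by rewrite enorm0.
    by rewrite (le_trans (enormD _ _))// lerD.
  rewrite -scalerBl enormZ.
  have -> : enorm (v i) = 1 by apply: enorm_dotp1; rewrite vv eqxx.
  by rewrite mulr1; exact: comp.
have s0 : enorm (dotp D (nu x) *: nu x) <= e1 * enorm w by rewrite enormZ enorm_nu// mulr1.
apply: (le_trans (lerD s0 s1)).
rewrite big_split/= sumr_const card_ord -mulr_suml -/T addrA -[e1 * enorm w]mulr1n -mulrnDr add1n.
rewrite [leRHS](_ : _ = e / 2 * enorm w + e / 2 * enorm w); last by rewrite -mulrDl -splitr.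
apply: lerD.
  have e1m : e1 * m.+1%:R <= e / 2.
    rewrite -ler_pdivlMr//; apply: (@le_trans _ _ (e / (2 * m.+1%:R))).
      by rewrite ge_min lexx orbT.
    by rewrite invfM mulrA.
  have -> : e1 * enorm w *+ m.+1 = e1 * m.+1%:R * enorm w by rewrite -[LHS]mulr_natr mulrAC.
  by rewrite ler_wpM2r.
rewrite (_ : T * _ = T * (K + 1) * enorm w * enorm w); last by ring.
rewrite ler_wpM2r//; apply: (le_trans (_ : _ <= (T * (K + 1) + 1) * enorm w)).
  by rewrite ler_wpM2r// lerDl.
by rewrite mulrC -ler_pdivlMr// ltW.
Qed.

(** The divergence is the trace of the expansion: the squared coordinates of each unit vector [v i]
    sum to 1. *)
Lemma unit_normal_divergence x : exterior Omega x ->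
  exists D : 'I_m.+1 -> R,
  [/\ forall k, is_derive x (delta_mx 0 k) (fun z => nu z 0 k) (D k),
      forall k, `|D k| <= m%:R / delta Omega x &
      \sum_k D k = kappa_tilde Omega x].
Proof.
move=> ex; have [v [lam [vv lam_bd lamE nu_exp]]] := unit_normal_expansion ex.
have v1 i : enorm (v i) = 1 by apply: enorm_dotp1; rewrite vv eqxx.
exists (fun k => \sum_i lam i * v i 0 k ^+ 2); split => [k|k|].
- apply/is_derive_line0/is_derive1P => e e0; have [d d0 hd] := nu_exp _ e0.
  exists d => // t t0 td; have := hd (t *: delta_mx 0 k).
  rewrite enormZ enorm_delta mulr1 => /(_ td)[_]; apply: le_trans.
  rewrite (le_trans _ (coord_le_enorm _ k))// scale0r addr0.
  rewrite le_eqVlt; apply/orP; left; apply/eqP; congr (`| _ |).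
  rewrite !mxE summxE; congr (_ - _); rewrite [LHS]mulr_sumr; apply: eq_bigr => i _.
  by rewrite !mxE dotpZl (dotpC _ (v i)) dotp_delta; ring.
- rewrite ger0_norm; last first.
    by apply: sumr_ge0 => i _; rewrite mulr_ge0 ?sqr_ge0//; have /andP[] := lam_bd i.
  apply: (@le_trans _ _ (\sum_(i < m) (delta Omega x)^-1)).
    apply: ler_sum => i _; have /andP[l0 l1] := lam_bd i.
    rewrite -[leRHS]mulr1 ler_pM ?sqr_ge0//.
    rewrite -real_normK ?num_real// -(expr1n _ 2) ler_pXn2r ?nnegrE// -(v1 i).
    exact: coord_le_enorm.
  by rewrite sumr_const card_ord mulr_natl.
- rewrite -lamE exchange_big/=; apply: eq_bigr => i _.
  rewrite -mulr_sumr -[RHS]mulr1; congr (_ * _).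
  by rewrite -(expr1n _ 2) -(v1 i) enorm_sqr; apply: eq_bigr => k _; rewrite expr2.
Qed.

End unit_normal_derivative.

(** * Lebesgue measure on row vectors *)

Section measurability.
Context {R : realType} {n : nat}.
Implicit Types (x : 'rV[R]_n) (U : set 'rV[R]_n).

(* A countable basis of the topology: cubes with rational centre [p.1] and
   half-side [1 / (p.2 + 1)]. *)
Let cube (p : 'rV[rat]_n * nat) : set 'rV[R]_n :=
  [set x | forall i, `|x 0 i - ratr (p.1 0 i)| < p.2.+1%:R^-1].

Let measurable_cube p : measurable (cube p).
Proof.
have -> : cube p = \bigcap_(i in [set: 'I_n]) (@rV_coord R n i @^-1`
    `]ratr (p.1 0 i) - p.2.+1%:R^-1, ratr (p.1 0 i) + p.2.+1%:R^-1[).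
  apply/seteqP; split => [x h i _|x h i] /=.
    by have := h i; rewrite ltr_distl /rV_coord in_itv.
  by have := h i I; rewrite /= /rV_coord in_itv/= ltr_distl.
apply: fin_bigcap_measurable => // i _; rewrite -[X in measurable X]setTI.
exact: measurable_rV_coord.
Qed.

Lemma open_rV_measurable U : open U -> measurable U.
Proof.
move=> oU.
pose A (k : nat) : set 'rV[R]_n :=
  if unpickle k is Some p then if `[< cube p `<=` U >] then cube p else set0 else set0.
have -> : U = \bigcup_k A k.
  apply/seteqP; split => [x Ux|x [k _]]; last first.
    rewrite /A; case: unpickle => // p; case: asboolP => // h; exact: h.
  move/open_enormP : oU => /(_ _ Ux)[e e0 he].
  have e'0 : 0 < e / (2 * n.+1%:R) by rewrite divr_gt0// mulr_gt0.
  have [k _ hk] := near_infty_natSinv_lt (PosNum e'0).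
  have {hk} ke := hk k (leqnn k); rewrite /= in ke.
  have k0 : 0 < k.+1%:R^-1 :> R by rewrite invr_gt0.
  have hq i : exists q : rat, `|x 0 i - ratr q| < k.+1%:R^-1.
    have /rat_in_itvoo[q] : x 0 i - k.+1%:R^-1 < x 0 i + k.+1%:R^-1.
      by move: k0; move: (k.+1%:R^-1) => c c0; lra.
    by rewrite in_itv/= => hq; exists q; rewrite ltr_distlC.
  have [q hq'] := choice hq.
  pose p : 'rV[rat]_n * nat := (\row_i q i, k).
  have cx : cube p x by move=> i; rewrite mxE; exact: hq'.
  exists (pickle p) => //; rewrite /A pickleK; case: asboolP => // -[].
  move=> z cz; apply: he; apply: (le_lt_trans (enorm_le_norm _)).
  have zx : `|z - x| <= 2 * k.+1%:R^-1.
    rewrite [leLHS]/Num.Def.normr/= mx_normrE; apply: bigmax_le => [|[j i] _ /=].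
      by rewrite mulr_ge0// ltW.
    rewrite (ord1 j) !mxE.
    have -> : z 0 i - x 0 i = (z 0 i - ratr (p.1 0 i)) - (x 0 i - ratr (p.1 0 i)) by ring.
    apply: (le_trans (ler_normB _ _)); rewrite mulr_natl mulr2n.
    by apply: lerD; [exact: ltW (cz i)|exact: ltW (cx i)].
  have := ke; rewrite ltr_pdivlMr ?mulr_gt0// => ke'.
  apply: (le_lt_trans (_ : _ <= n.+1%:R * (2 * k.+1%:R^-1))).
    by apply: ler_pM => //; rewrite ler_nat.
  by move: ke'; rewrite mulrCA mulrA mulrC.
apply: bigcup_measurable => k _; rewrite /A; case: unpickle => // p.
by case: asboolP.
Qed.

Lemma continuous_open_measurable U (f : 'rV[R]_n -> R) : open U ->
  (forall x, U x -> {for x, continuous f}) -> measurable_fun U f.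
Proof.
move=> oU cf; apply: (measurability _ (RGenOInfty.measurableE R)) => _ [_ [a ->] <-].
apply: open_rV_measurable; apply/open_enormP => y [Uy]; rewrite /= in_itv/= andbT => ay.
have e0 : 0 < f y - a by rewrite subr_gt0.
have [d1 d10 hd1] := (proj1 (open_enormP _) oU) _ Uy.
have [d2 d20 hd2] := (proj1 (continuous_enormP _ _) (cf _ Uy)) _ e0.
exists (Num.min d1 d2); first by rewrite lt_min d10.
move=> x; rewrite lt_min => /andP[xd1 xd2]; split; first exact: hd1.
have := hd2 _ xd2; rewrite /= in_itv/= andbT ltr_norml => /andP[+ _].
by move: (f x) (f y) => p q; lra.
Qed.

Lemma continuous_rV_measurable (f : 'rV[R]_n -> R) :
  continuous f -> measurable_fun setT f.
Proof. by move=> cf; apply: continuous_open_measurable => [|x _]; [exact: openT|exact: cf]. Qed.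

End measurability.

(** * Translation invariance of Lebesgue measure *)

Section translation.
Context {R : realType}.

Lemma lebesgue_measure_translate (r : R) (A : set R) : measurable A ->
  pushforward (@lebesgue_measure R) (fun x : measurableTypeR R => (x + r : measurableTypeR R)) A = lebesgue_measure A.
Proof.
move=> mA; apply/esym/lebesgue_measure_unique => //=; first exact: measurable_funD.
move=> mt _ [[a b]] _ <-.
rewrite /pushforward (_ : _ @^-1` _ = `]a - r, b - r]%classic); last first.
  by apply/seteqP; split => x /=; rewrite !in_itv/= ltrBlDr lerBrDr.
rewrite !lebesgue_measure_itv/= !lte_fin ltrD2r; case: ifP => // _.
by congr EFin; ring.
Qed.

Lemma ge0_integral_lebesgue_translate (r : R) (f : R -> \bar R) :
  measurable_fun [set: R] f -> (forall x, (0 <= f x)%E) ->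
  (\int[@lebesgue_measure R]_x f (x + r)%R = \int[@lebesgue_measure R]_x f x)%E.
Proof.
move=> mf f0.
have mt : measurable_fun setT (fun x : measurableTypeR R => (x + r : measurableTypeR R)).
  exact: measurable_funD.
transitivity (\int[pushforward (@lebesgue_measure R) (fun x : measurableTypeR R => ((x : R) + r)%R : measurableTypeR R)]_x f x)%E.
  by rewrite ge0_integral_pushforward.
by apply: eq_measure_integral => A mA _; exact: lebesgue_measure_translate.
Qed.

Lemma measurable_rV_translate n (v : 'rV[R]_n) : measurable_fun setT (fun x : 'rV[R]_n => x + v).
Proof.
apply: measurable_rVP => i.
rewrite (_ : _ \o _ = (fun x => rV_coord i x + v 0 i)).
  by apply: measurable_funD => //; exact: measurable_rV_coord.
by apply/funext => x; rewrite /= /rV_coord mxE.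
Qed.

Lemma lebesgue_rV_translate n (v : 'rV[R]_n) (A : set 'rV[R]_n) : measurable A ->
  lebesgue_rV R n ((fun x => x + v) @^-1` A) = lebesgue_rV R n A.
Proof.
elim: n v A => [|n ih] v A mA.
  congr (lebesgue_rV R 0 _); apply/seteqP; split => x /=;
  by rewrite (_ : x + v = x)//; apply/rowP; case.
pose v' : 'rV[R]_n := \row_i v 0 (lift ord0 i).
have mcA : measurable (@rV_cons R n @^-1` A).
  by rewrite -[X in measurable X]setTI; exact: measurable_rV_cons.
(* By conversion, the measure in dimension [n.+1] integrates the measures of sections.
   One-dimensional invariance handles the first coordinate of [v], induction the others. *)
rewrite -[LHS]/(\int[@lebesgue_measure R]_x lebesgue_rV R n (xsection (@rV_cons R n @^-1` ((fun x => (x + v)%R) @^-1` A)) x))%E.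
rewrite -[RHS]/(\int[@lebesgue_measure R]_x lebesgue_rV R n (xsection (@rV_cons R n @^-1` A) x))%E.
rewrite -(@ge0_integral_lebesgue_translate (v 0 ord0) (fun x => lebesgue_rV R n (xsection (@rV_cons R n @^-1` A) x))); last 2 first.
- exact: measurable_fun_xsection.
- by move=> x; exact: measure_ge0.
apply: eq_integral => x _.
rewrite -[RHS](ih v'); last exact: measurable_xsection.
congr (lebesgue_rV R n _); apply/seteqP.
have E y : rV_cons (x, y) + v = rV_cons (x + v 0 ord0, y + v').
  apply/rowP => i; rewrite mxE; case: (unliftP ord0 i) => [j|] ->.
    by rewrite !rV_consS !mxE.
  by rewrite !rV_cons0.
by split => y /=; rewrite /xsection/= !inE /= E.
Qed.

Lemma integral_lebesgue_rV_translate n (v : 'rV[R]_n) (f : 'rV[R]_n -> \bar R) :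
  measurable_fun [set: 'rV[R]_n] f ->
  (lebesgue_rV R n).-integrable [set: 'rV[R]_n] (fun x => f (x + v)) ->
  (\int[lebesgue_rV R n]_x f (x + v)%R = \int[lebesgue_rV R n]_x f x)%E.
Proof.
move=> mf intf; have mt := measurable_rV_translate v.
transitivity (\int[pushforward (lebesgue_rV R n) (fun x : 'rV[R]_n => (x + v)%R)]_x f x)%E.
  by rewrite (integral_pushforward mt).
by apply: eq_measure_integral => A mA _; exact: lebesgue_rV_translate.
Qed.

End translation.

(** * Vanishing of the integral of a bounded partial derivative *)

Section integral_of_derivative.
Context {R : realType} {n : nat}.
Local Notation mu := (lebesgue_rV R n).

(** Written with [const_mx] so that it is literally a box of [lebesgue_rV_box] and
    [measurable_rV_box]. *)
Definition origin_box (M : R) : set 'rV[R]_n :=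
  [set x | forall i, x 0 i \in `[(const_mx (- M) : 'rV[R]_n) 0 i, (const_mx M : 'rV[R]_n) 0 i]].

Lemma origin_boxP M x : origin_box M x <-> forall i, `|x 0 i| <= M.
Proof.
by split => h i; have := h i; rewrite !mxE in_itv/= ler_norml.
Qed.

Lemma origin_box_finite M : 0 <= M -> (mu (origin_box M) < +oo)%E.
Proof.
move=> M0; rewrite /origin_box lebesgue_rV_box ?ltry// => i; rewrite !mxE; lra.
Qed.

Lemma integrable_bounded_support (f : 'rV[R]_n -> R) (M C : R) :
  0 <= M -> measurable_fun setT f -> (forall x, `|f x| <= C) ->
  (forall x, ~ origin_box M x -> f x = 0) -> mu.-integrable setT (EFin \o f).
Proof.
move=> M0 mf fC f0; have mB : measurable (origin_box M) by exact: measurable_rV_box.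
have -> : EFin \o f = (EFin \o f) \_ (origin_box M).
  apply/funext => x; rewrite patchE; case: ifPn => // /negP; rewrite inE => h.
  by rewrite /= f0.
apply/(integrable_mkcond _ mB); apply: measurable_bounded_integrable => //.
- exact: origin_box_finite.
- exact: measurable_funTS.
- exists C; split; first exact: num_real.
  by move=> c Cc x _ /=; rewrite (le_trans (fC x))// ltW.
Qed.

(** The mean value theorem turns the bound on [g] into a uniform bound on the difference quotients,
    hence a dominating function. Measurability of [g], as a pointwise limit, is recorded because
    that of [kappa_tilde] rests on it. *)
Lemma integral_partial_eq0 (i : 'I_n) (G g : 'rV[R]_n -> R) (M C : R) :
  0 <= M -> continuous G -> (forall x, ~ origin_box M x -> G x = 0) ->
  (forall x, is_derive x (delta_mx 0 i) G (g x)) -> (forall x, `|g x| <= C) ->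
  [/\ measurable_fun setT g, mu.-integrable setT (EFin \o g) &
      (\int[mu]_x (g x)%:E = 0)%E].
Proof.
move=> M0 cG G0 dG gC; pose e : 'rV[R]_n := delta_mx 0 i.
have mG : measurable_fun setT G by exact: continuous_rV_measurable.
pose h (k : nat) : R := k.+1%:R^-1.
have h0 k : 0 < h k by rewrite invr_gt0.
(* Steps of length at most 1 keep every translate supported in the box of half-side [M + 1]. *)
have h1 k : h k <= 1 by rewrite invf_le1// ler1n.
pose f k (x : 'rV[R]_n) := (h k)^-1 * (G (x + h k *: e) - G x).
have mGt k : measurable_fun setT (fun x : 'rV[R]_n => G (x + h k *: e)).
  by apply: measurableT_comp => //; exact: measurable_rV_translate.
have mf k : measurable_fun setT (f k).
  by apply: measurable_funM => //; exact: measurable_funB.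
have fC k x : `|f k x| <= C.
  have [|t th] := @partial_MVT _ _ G x i (h k); first by move=> t _; exact: ex_derive.
  rewrite -/e /f => ->; rewrite mulrA mulVf ?gt_eqF// mul1r /partial.
  by rewrite (@derive_val _ _ _ _ _ _ _ (dG _)).
have G0t k x : ~ origin_box (M + 1) x -> G (x + h k *: e) = 0.
  move=> hx; apply: G0 => /origin_boxP hM; apply: hx; apply/origin_boxP => j.
  have := hM j; rewrite !mxE => hj.
  have -> : x 0 j = (x 0 j + h k * (e 0 j)) - h k * e 0 j by rewrite addrK.
  apply: (le_trans (ler_normB _ _)); rewrite lerD//; first by rewrite !mxE in hj *.
  rewrite normrM (gtr0_norm (h0 k)) -[leRHS]mul1r ler_pM ?(ltW (h0 k))//.
  by apply: (le_trans (coord_le_enorm _ _)); rewrite enorm_delta.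
have f0 k x : ~ origin_box (M + 1) x -> f k x = 0.
  move=> hx; rewrite /f G0t// G0 ?subrr ?mulr0//.
  move=> /origin_boxP hM; apply: hx; apply/origin_boxP => j.
  by apply: (le_trans (hM j)); rewrite lerDl.
have cf x : f ^~ x @ \oo --> g x.
  have dx : is_derive (0 : R) (1 : R) (fun s : R => G (x + s *: e)) (g x).
    exact: (proj1 (is_derive_line0 G x e (g x)) (dG x)).
  apply/cvgrPdist_le => eps eps0.
  move/is_derive1P : dx => /(_ _ eps0)[d d0 hd].
  have := near_infty_natSinv_lt (PosNum d0); apply: filterS => k /= kd.
  have := hd (h k); rewrite gtr0_norm// => /(_ (h0 k) kd).
  rewrite scale0r addr0 => hh; rewrite /f distrC.
  have -> : (h k)^-1 * (G (x + h k *: e) - G x) - g x =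
      (h k)^-1 * (G (x + h k *: e) - G x - h k *: g x).
    by rewrite [RHS]mulrBr /GRing.scale/= mulrA mulVf ?mul1r// gt_eqF.
  by rewrite normrM gtr0_norm ?invr_gt0// ler_pdivrMl// mulrC.
have mg : measurable_fun setT g.
  by apply: (measurable_fun_cvg (h := f)) => //= x _; exact: cf.
have g0 x : ~ origin_box (M + 1) x -> g x = 0.
  move=> hx; have := cf x; rewrite (_ : f ^~ x = cst 0); last by apply/funext => k; exact: f0.
  by move=> /cvg_lim <-//; rewrite lim_cst.
have M1 : 0 <= M + 1 by rewrite addr_ge0.
have [B hB] : exists B, forall x, `|G x| <= B.
  have cB : compact (origin_box M).
    have -> : origin_box M = [set v : 'rV[R]_n | forall i, `[(- M), M]%classic (v ord0 i)].
      by apply/seteqP; split => x h' j; have := h' j; rewrite /= !mxE.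
    exact: (@rV_compact R n (fun=> `[(- M), M]%classic) (fun=> @segment_compact R (- M) M)).
  have /compact_bounded[B [_ hB]] : compact (G @` origin_box M).
    by apply: continuous_compact => //; exact: continuous_subspaceT.
  exists (`|B| + 1) => x; have [xB|/G0 ->] := pselect (origin_box M x).
    by apply: (hB (`|B| + 1)); [rewrite (le_lt_trans (ler_norm _))// ltrDl|exists x].
  by rewrite normr0 addr_ge0.
have intG : mu.-integrable setT (EFin \o G) by exact: (integrable_bounded_support M0 mG hB G0).
have intGt k : mu.-integrable setT (EFin \o (fun x : 'rV[R]_n => G (x + h k *: e))).
  apply: (integrable_bounded_support M1 (mGt k) (fun x => hB _)).
  by move=> x /(G0t k).
have C0 : 0 <= C by exact: le_trans (normr_ge0 _) (gC 0).
have intg : mu.-integrable setT (EFin \o g) by exact: (integrable_bounded_support M1 mg gC g0).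
have mB : measurable (origin_box (M + 1)) by exact: measurable_rV_box.
split => //.
have intf k : (\int[mu]_x (f k x)%:E = 0)%E.
  pose Gt (x : 'rV[R]_n) := G (x + h k *: e).
  rewrite (_ : (fun x => (f k x)%:E) =
      (fun x => (((h k)^-1)%:E * ((EFin \o Gt) \- (EFin \o G)) x)%E)); last first.
    by apply/funext => x; rewrite /f EFinM EFinB.
  rewrite integralZl//; last exact: (integrableB measurableT (intGt k) intG).
  rewrite (integralB measurableT (intGt k) intG).
  have := @integral_lebesgue_rV_translate R n (h k *: e) (EFin \o G)
    (measurableT_comp (@EFin_measurable R setT) mG) (intGt k).
  rewrite /= => ->; rewrite subee ?mule0//.
  exact: (integrable_fin_num measurableT intG).
have intI : mu.-integrable setT (EFin \o (fun x => C * \1_(origin_box (M + 1)) x)).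
  apply: (@integrable_bounded_support _ (M + 1) C) => //.
  - by apply: measurable_funM => //; exact: measurable_indic.
  - move=> x; rewrite indicE; case: (_ \in _); rewrite ?mulr1 ?mulr0 ?normr0// ger0_norm//.
  - by move=> x hx; rewrite indicE memNset// mulr0.
have dom k x : (`|(f k x)%:E| <= (C * \1_(origin_box (M + 1)%R) x)%R%:E)%E.
  rewrite /= lee_fin; have [hx|hx] := pselect (origin_box (M + 1) x).
    by rewrite indicE mem_set// mulr1; exact: fC.
  by rewrite f0// normr0 indicE memNset// mulr0.
have cvg_EFin_fun x : (fun k => (f k x)%:E) @ \oo --> (g x)%:E.
  by apply: cvg_EFin; [exact: nearW|exact: cf].
have [_ _] := @dominated_convergence _ _ R mu setT measurableT (fun k x => (f k x)%:E)
  (EFin \o g) (EFin \o (fun x => C * \1_(origin_box (M + 1)) x))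
  (fun k => measurableT_comp (@EFin_measurable R setT) (mf k))
  (measurableT_comp (@EFin_measurable R setT) mg)
  (aeW _ (fun x _ => cvg_EFin_fun x)) intI
  (aeW _ (fun x k _ => dom k x)).
rewrite (_ : [sequence _]_n = cst 0%E); last by apply/funext => k; exact: intf.
by move=> /cvg_lim <-//; rewrite lim_cst.
Qed.

End integral_of_derivative.

(** * The Hardy inequality *)

Lemma continuous_compf {R : realType} (T : topologicalType) (f : T -> R) (g : R -> R) (x : T) :
  {for x, continuous f} -> {for f x, continuous g} ->
  {for x, continuous (fun z => g (f z))}.
Proof. by move=> cf cg; exact: (@continuous_comp T R R f g x cf cg). Qed.

(** * Powers of absolute values and the pointwise inequality *)

Section absolute_powers.
Context {R : realType}.
Implicit Types (p r s t : R).

Lemma powR_small r e : 0 < r -> 0 < e ->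
  exists2 d, 0 < d & forall t, `|t| < d -> `|t| `^ r <= e.
Proof.
move=> r0 e0; exists (e `^ r^-1); first exact: powR_gt0.
move=> t td; have : `|t| `^ r <= (e `^ r^-1) `^ r.
  by rewrite ge0_ler_powR ?nnegrE ?powR_ge0// ltW.
by rewrite -powRrM mulVf ?gt_eqF// powRr1// ltW.
Qed.

Definition dabs_powR p s : R := p * `|s| `^ (p - 1) * Num.sg s.

Lemma is_derive_abs_powR p s : 1 < p ->
  is_derive s (1 : R) (fun t => `|t| `^ p) (dabs_powR p s).
Proof.
move=> p1; rewrite /dabs_powR; have [s0|s0|->] := ltgtP s 0.
- rewrite ltr0_sg// mulrN1 ltr0_norm//.
  apply: (near_eq_is_derive (f := (fun t => t `^ p) \o -%R)).
    near=> t; rewrite /= ltr0_norm//; near: t; exact: lt_nbhsl.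
  rewrite -mulrN1; apply: is_derive1_comp.
  by apply: is_derive1_powR; rewrite oppr_gt0.
- rewrite gtr0_sg// mulr1 gtr0_norm//.
  apply: (near_eq_is_derive (f := fun t => t `^ p)).
    near=> t; rewrite /= gtr0_norm//; near: t; exact: lt_nbhsr.
  exact: is_derive1_powR.
- rewrite sgr0 mulr0; apply/is_derive1P => e e0.
  have p1' : 0 < p - 1 by rewrite subr_gt0.
  have [d d0 hd] := powR_small p1' e0; exists d => // t t0 td.
  rewrite normr0 powR0 ?gt_eqF ?(lt_trans ltr01)// scaler0 !subr0 ger0_norm ?powR_ge0//.
  by rewrite -(@mulr_powRB1 _ `|t| p)// ?(lt_trans ltr01)// mulrC ler_wpM2r// hd.
Unshelve. all: by end_near. Qed.

Lemma continuous_abs_powR r s : 0 < r -> {for s, continuous (fun t => `|t| `^ r)}.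
Proof.
move=> r0; have [->|s0] := eqVneq s 0.
  apply/cvgrPdist_lt => e e0; have e2 : 0 < e / 2 by rewrite divr_gt0.
  have [d d0 hd] := powR_small r0 e2; apply/near0P; exists d => // t td.
  rewrite normr0 powR0 ?gt_eqF// sub0r normrN ger0_norm ?powR_ge0//.
  by rewrite (le_lt_trans (hd _ td))// ltr_pdivrMr// ltr_pMr// ltr1n.
have cp : {for `|s|, continuous (fun a : R => a `^ r)}.
  apply: differentiable_continuous; apply/derivable1_diffP.
  by apply: derivable_powR; rewrite in_itv/= andbT normr_gt0.
apply: continuous_compf cp; exact: (@norm_continuous R R^o).
Qed.

Lemma measurable_sg : measurable_fun [set: R] (@Num.sg R).
Proof.
apply: nondecreasing_measurable => // x y xy.
case: (ltgtP x 0) xy => [x0|x0|->] xy.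
- rewrite (ltr0_sg x0); have [y0|y0|->] := ltgtP y 0; rewrite ?(ltr0_sg y0) ?(gtr0_sg y0) ?sgr0//; lra.
- by rewrite !gtr0_sg// (lt_le_trans x0).
- rewrite sgr0; have [y0|y0|->] := ltgtP y 0; rewrite ?(gtr0_sg y0) ?sgr0//.
  by move: xy; rewrite leNgt y0.
Qed.

Lemma is_derive_abs_powR_comp p (g : R -> R) a dg : 1 < p -> g 0 = a ->
  is_derive (0 : R) (1 : R) g dg ->
  is_derive (0 : R) (1 : R) (fun s => `|g s| `^ p) (dabs_powR p a * dg).
Proof.
move=> p1 <- hg; have h := is_derive_abs_powR (g 0) p1.
exact: (@is_derive1_comp _ (fun t => `|t| `^ p) g 0 _ _ h hg).
Qed.

Lemma is_derive_powR_comp r (g : R -> R) a dg : 0 < a -> g 0 = a ->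
  is_derive (0 : R) (1 : R) g dg ->
  is_derive (0 : R) (1 : R) (fun s => g s `^ r) (r * a `^ (r - 1) * dg).
Proof.
move=> a0 ga hg; rewrite -ga in a0 *.
have h := is_derive1_powR r a0.
exact: (@is_derive1_comp _ (fun t => t `^ r) g 0 _ _ h hg).
Qed.

Lemma is_derive_mul3 (u v w : R -> R) a b c du dv dw : u 0 = a -> v 0 = b -> w 0 = c ->
  is_derive (0 : R) (1 : R) u du -> is_derive (0 : R) (1 : R) v dv ->
  is_derive (0 : R) (1 : R) w dw ->
  is_derive (0 : R) (1 : R) (fun s => u s * (v s * w s))
    (du * (b * c) + a * (dv * c + b * dw)).
Proof.
move=> <- <- <- hu hv hw; have h := is_deriveM hu (is_deriveM hv hw).
apply: (is_derive_eq h); rewrite -[(v * w) 0]/(v 0 * w 0) /GRing.scale/=; ring.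
Qed.

(** Young's inequality for [E] and [(c * b) ^ (p - 1)], whose power with the conjugate exponent is
    [(c * b) ^ p]. *)
Lemma young_hardy p E b w c : 1 < p -> 0 <= E -> 0 <= b -> w <= E ->
  c = (p - 1) / p ->
  c `^ (p - 1) * (p * w * b `^ (p - 1)) <= E `^ p + (p - 1) * (c `^ p * b `^ p).
Proof.
move=> p1 E0 b0 wE cE.
have p0 : 0 < p by exact: lt_trans p1.
have p10 : 0 < p - 1 by rewrite subr_gt0.
have c0 : 0 < c by rewrite cE divr_gt0.
pose q := p / (p - 1).
have q0 : 0 < q by rewrite divr_gt0.
have pq : p^-1 + q^-1 = 1.
  by rewrite /q invf_div; field; rewrite gt_eqF.
pose B := (c * b) `^ (p - 1).
have Bq : B `^ q = (c * b) `^ p.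
  by rewrite /B -powRrM /q [_ * (p / _)]mulrC divfK// gt_eqF.
have := conjugate_powR E0 (powR_ge0 (c * b) (p - 1)) p0 q0 pq.
rewrite -/B Bq -powRM ?(ltW c0)// => h.
have BE : B = c `^ (p - 1) * b `^ (p - 1) by rewrite /B powRM// ltW.
have -> : c `^ (p - 1) * (p * w * b `^ (p - 1)) = p * (w * B) by rewrite BE; ring.
have h1 : p * (w * B) <= p * (E * B).
  by rewrite ler_pM2l// ler_wpM2r// powR_ge0.
apply: (le_trans h1).
have -> : E `^ p + (p - 1) * (c * b) `^ p = p * (E `^ p / p + (c * b) `^ p / q).
  by rewrite /q; field; rewrite !gt_eqF.
by rewrite ler_pM2l.
Qed.

(** [F], [d], [t], [E], [v], [sg] stand for [|f|], the distance, [kappa_tilde], the length of the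
    gradient of [f], its product with the unit normal, and the sign of [f]. In terms of [b = F / d]
    every product of powers of [F] and [d] becomes a power of [b], up to a factor [d] in the
    curvature term. *)
Lemma hardy_pointwise p F d t E v sg : 1 < p -> 0 <= F -> 0 < d -> 0 <= E ->
  `|v| <= E -> `|sg| <= 1 ->
  ((p - 1) / p) `^ p * ((1 - p * t * d / (p - 1)) * (F `^ p / d `^ p)) <=
  E `^ p - ((p - 1) / p) `^ (p - 1) *
    (t * (F `^ p * d `^ (1 - p)) + p * F `^ (p - 1) * sg * v * d `^ (1 - p)
     + (1 - p) * (F `^ p * d `^ (- p))).
Proof.
move=> p1 F0 d0 E0 vE sg1.
have p0 : 0 < p by exact: lt_trans p1.
have p10 : 0 < p - 1 by rewrite subr_gt0.
set c := (p - 1) / p; have c0 : 0 < c by rewrite divr_gt0.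
pose b := F / d; have b0 : 0 <= b by rewrite divr_ge0// ltW.
have di : 0 <= d^-1 by rewrite invr_ge0 ltW.
have dp q : d^-1 `^ q = d `^ (- q) by rewrite -powR_inv1 ?(ltW d0)// -powRrM mulN1r.
have bp q : b `^ q = F `^ q * d `^ (- q) by rewrite /b powRM// dp.
have X1 : F `^ p / d `^ p = b `^ p by rewrite bp powRN.
have X2 : F `^ p * d `^ (1 - p) = d * b `^ p.
  have d1p : d `^ (1 - p) = d `^ 1 * d `^ (- p) by apply: powRD; apply/implyP => _; rewrite gt_eqF.
  by rewrite bp mulrCA d1p powRr1// ltW.
have X3 : F `^ (p - 1) * d `^ (1 - p) = b `^ (p - 1) by rewrite bp opprB.
have X4 : F `^ p * d `^ (- p) = b `^ p by rewrite bp.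
have sv : - (sg * v) <= E.
  rewrite (le_trans (ler_norm _))// normrN normrM -[leRHS]mul1r ler_pM//.
have sv' : sg * v <= E.
  rewrite (le_trans (ler_norm _))// normrM -[leRHS]mul1r ler_pM//.
have := young_hardy p1 E0 b0 sv' (erefl c).
have cc : c `^ p = c `^ (p - 1) * c by rewrite mulrC mulr_powRB1// ltW.
have -> : p * F `^ (p - 1) * sg * v * d `^ (1 - p) = p * (sg * v) * (F `^ (p - 1) * d `^ (1 - p)) by ring.
rewrite X1 X2 X3 X4 cc.
move: (b `^ p) (b `^ (p - 1)) (c `^ (p - 1)) (E `^ p) => X Y A Z h.
have -> : A * c * ((1 - p * t * d / (p - 1)) * X) = A * c * X - A * t * d * X.
  by rewrite /c; field; rewrite !gt_eqF.
have -> : Z - A * (t * (d * X) + p * (sg * v) * Y + (1 - p) * X) =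
  (Z - A * (p * (sg * v) * Y) + (p - 1) * (A * X)) - A * t * d * X by ring.
rewrite lerD2r.
(* This is [c = (p - 1) * (1 - c)], the equation satisfied by the constant. *)
have E1 : A * c * X = (p - 1) * (A * X) - (p - 1) * (A * c * X).
  by rewrite /c; field; rewrite gt_eqF.
by rewrite E1; move: h; move: (A * (p * (sg * v) * Y)) ((p - 1) * (A * X)) ((p - 1) * (A * c * X)) => a1 a2 a3; lra.
Qed.

End absolute_powers.

(** * The flux field, its divergence and the integrated inequality *)

Section hardy.
Context {R : realType} {m : nat} (Omega : set 'rV[R]_m.+1).
Hypotheses (Omega_open : open Omega) (Omega0 : Omega !=set0)
  (Omega_convex : is_convex Omega) (Omega_C2 : C2_boundary Omega).
Variables (p : R) (f : 'rV[R]_m.+1 -> R).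
Hypotheses (p1 : 1 < p) (f_Cc : Cc_infty (exterior Omega) f).
Implicit Types (x y z w : 'rV[R]_m.+1).
Local Notation nu := (unit_normal_field Omega).
Local Notation d := (delta Omega).
Local Notation X := (exterior Omega).
Local Notation mu := (lebesgue_rV R m.+1).

Let K := closure [set x | f x != 0].
Let cK : compact K. Proof. by case: f_Cc. Qed.
Let KX : K `<=` X. Proof. by case: f_Cc. Qed.
Let p0 : 0 < p. Proof. exact: lt_trans p1. Qed.
Let p10 : 0 < p - 1. Proof. by rewrite subr_gt0. Qed.

Let f0 x : ~ K x -> f x = 0.
Proof.
by move=> nK; apply/eqP; apply: contrapT => fx; apply: nK; apply: subset_closure; exact/negP.
Qed.

Let f0_near x : ~ K x -> \forall z \near x, f z = 0.
Proof.
move=> nK; have : nbhs x (~` K).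
  by apply: open_nbhs_nbhs; split => //; exact/closed_openC/closed_closure.
by apply: filterS => z; exact: f0.
Qed.

Let f_cont : continuous f.
Proof. by have [/(_ 0%N) [cf _] _ _] := f_Cc; move=> x; exact: cf. Qed.

Let f_deriv x i : is_derive x (delta_mx 0 i) f (partial i f x).
Proof.
have [/(_ 1%N) [_ /(_ i)[df _]] _ _] := f_Cc.
by apply: derivableP; exact: df.
Qed.

Let partial_cont i : continuous (partial i f).
Proof. by have [/(_ 1%N) [_ /(_ i)[_ [cf _]]] _ _] := f_Cc; move=> x; exact: cf. Qed.

Let partial0 x i : ~ K x -> partial i f x = 0.
Proof.
move=> /f0_near h; rewrite /partial (near_eq_derive (g := cst 0))//.
by rewrite derive_cst.
Qed.

Lemma delta_continuous x : {for x, continuous d}.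
Proof.
apply/continuous_enormP => e e0; exists e => // z ze.
exact: le_lt_trans (delta_lipschitz Omega0 z x) ze.
Qed.

Lemma unit_normal_continuous x i : X x -> {for x, continuous (fun z => nu z 0 i)}.
Proof.
move=> ex; have d0 := delta_gt0 Omega0 ex.
apply/continuous_enormP => e e0.
have /open_enormP/(_ _ ex)[r r0 hr] := @exterior_open _ _ Omega.
exists (Num.min r (e * d x / 3)); first by rewrite lt_min r0 divr_gt0// mulr_gt0.
move=> z; rewrite lt_min => /andP[/hr ez zd].
have -> : nu z 0 i - nu x 0 i = (nu z - nu x) 0 i by rewrite [RHS]mxE [X in _ = _ + X]mxE.
apply: (le_lt_trans (coord_le_enorm _ _)).
apply: (le_lt_trans (nu_lipschitz Omega_open Omega0 Omega_convex ex ez)).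
rewrite mulrC mulrA ltr_pdivrMr// -ltr_pdivlMr//.
Qed.

(** [G i] is the [i]-th component of the field, with [nu] for the gradient of the distance. On the
    closure of [Omega] it is 0 because [f] vanishes there. *)
Let Phi x := `|f x| `^ p * d x `^ (1 - p).
Let G i x := nu x 0 i * Phi x.

Lemma delta_derivative x i : X x -> is_derive x (delta_mx 0 i) d (nu x 0 i).
Proof.
move=> ex; have d0 := delta_gt0 Omega0 ex.
apply/is_derive_line0/is_derive1P => e e0.
have /open_enormP/(_ _ ex)[r r0 hr] := @exterior_open _ _ Omega.
exists (Num.min r (e * d x / 3)); first by rewrite lt_min r0 divr_gt0// mulr_gt0.
move=> t t0; rewrite lt_min => /andP[tr td].
have te : enorm (t *: (delta_mx 0 i : 'rV[R]_m.+1)) = `|t| by rewrite enormZ enorm_delta mulr1.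
have ez : X (x + t *: delta_mx 0 i) by apply: hr; rewrite addrC addKr te.
have := delta_expand Omega_open Omega0 Omega_convex ex ez.
rewrite dotpZr dotp_delta te scale0r addr0 => h; apply: (le_trans h).
rewrite expr2 mulrA ler_wpM2r// mulrC mulrA ler_pdivrMr// -ler_pdivlMr// ltW//.
Qed.

Let dG i x (Dx : R) :=
  Dx * Phi x + nu x 0 i * (dabs_powR p (f x) * partial i f x * d x `^ (1 - p)
    + `|f x| `^ p * ((1 - p) * d x `^ (- p) * nu x 0 i)).

Lemma flux_derivative x i Dx : X x ->
  is_derive x (delta_mx 0 i) (fun z => nu z 0 i) Dx ->
  is_derive x (delta_mx 0 i) (G i) (dG i x Dx).
Proof.
move=> ex dnu; have d0 := delta_gt0 Omega0 ex; apply/is_derive_line0.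
set e := delta_mx 0 i in dnu *.
have x0 : x + (0 : R) *: e = x by rewrite scale0r addr0.
have fx0 : f (x + (0 : R) *: e) = f x by rewrite x0.
have dx0 : d (x + (0 : R) *: e) = d x by rewrite x0.
have nx0 : nu (x + (0 : R) *: e) 0 i = nu x 0 i by rewrite x0.
have h1 : is_derive (0 : R) (1 : R) (fun s => nu (x + s *: e) 0 i) Dx.
  exact: (proj1 (is_derive_line0 (fun z => nu z 0 i) x e Dx) dnu).
have h2 : is_derive (0 : R) (1 : R) (fun s => f (x + s *: e)) (partial i f x).
  exact: (proj1 (is_derive_line0 f x e _) (f_deriv x i)).
have h3 : is_derive (0 : R) (1 : R) (fun s => d (x + s *: e)) (nu x 0 i).
  exact: (proj1 (is_derive_line0 d x e _) (delta_derivative i ex)).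
have h4 := is_derive_abs_powR_comp p1 fx0 h2.
have h5 := is_derive_powR_comp (1 - p) d0 dx0 h3.
have h6 := is_derive_mul3 nx0 (congr1 (fun t => `|t| `^ p) fx0)
  (congr1 (fun t => t `^ (1 - p)) dx0) h1 h4 h5.
by move: h6; rewrite (_ : 1 - p - 1 = - p); last by rewrite addrAC subrr add0r.
Qed.

Lemma flux0 i z : f z = 0 -> G i z = 0.
Proof. by rewrite /G /Phi => ->; rewrite normr0 powR0 ?gt_eqF// mul0r mulr0. Qed.

Lemma flux_derivative0 x i : ~ K x -> is_derive x (delta_mx 0 i) (G i) 0.
Proof.
move=> nK.
have c0 : is_derive x (delta_mx 0 i) (cst (0 : R) : 'rV[R]_m.+1 -> R) (0 : R) by exact: is_derive_cst.
apply: (near_eq_is_derive _ c0).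
by apply: filterS (f0_near nK) => z fz; rewrite flux0.
Qed.

Lemma abs_f_powR_continuous r x : 0 < r -> {for x, continuous (fun z => `|f z| `^ r)}.
Proof.
move=> r0; by apply: (@continuous_compf _ _ f (fun t => `|t| `^ r)); [exact: f_cont|exact: continuous_abs_powR].
Qed.

Lemma delta_powR_continuous r x : X x -> {for x, continuous (fun z => d z `^ r)}.
Proof.
move=> ex; have d0 := delta_gt0 Omega0 ex.
have cp : {for d x, continuous (fun a : R => a `^ r)}.
  apply: differentiable_continuous; apply/derivable1_diffP.
  by apply: derivable_powR; rewrite in_itv/= andbT.
exact: (@continuous_compf _ _ d (fun a : R => a `^ r) x (@delta_continuous x) cp).
Qed.

Lemma Phi_continuous x : X x -> {for x, continuous Phi}.
Proof.
move=> ex; apply: continuous_mulf.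
  exact: abs_f_powR_continuous.
exact: delta_powR_continuous.
Qed.

Lemma flux_continuous i : continuous (G i).
Proof.
move=> x; have [Kx|nK] := pselect (K x).
  apply: continuous_mulf; [exact: unit_normal_continuous (KX Kx)|exact: Phi_continuous (KX Kx)].
apply/continuous_enormP => e e0; have /near_enormP[r r0 hr] := f0_near nK.
exists r => // z /hr fz; rewrite (flux0 i fz) (flux0 i (f0 nK)) subrr normr0.
exact: e0.
Qed.

Lemma compact_bound (h : 'rV[R]_m.+1 -> R) : (forall x, K x -> {for x, continuous h}) ->
  exists2 B, 0 <= B & forall x, K x -> `|h x| <= B.
Proof.
move=> ch; have ch' : {within K, continuous h}.
  apply: continuous_in_subspaceT => x; rewrite inE => Kx; exact: ch.
have /compact_bounded[B [_ hB]] := continuous_compact ch' cK.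
exists (`|B| + 1) => [|x Kx]; first by rewrite addr_ge0.
by apply: (hB (`|B| + 1)); [rewrite (le_lt_trans (ler_norm _))// ltrDl|exists x].
Qed.

Lemma flux_is_derive i x : is_derive x (delta_mx 0 i) (G i) (partial i (G i) x).
Proof.
apply: derivableP; have [Kx|nK] := pselect (K x).
  have [D [dD _ _]] := unit_normal_divergence Omega_open Omega0 Omega_convex Omega_C2 (KX Kx).
  exact: (@ex_derive _ _ _ _ _ _ _ (flux_derivative (KX Kx) (dD i))).
exact: (@ex_derive _ _ _ _ _ _ _ (flux_derivative0 i nK)).
Qed.

Lemma flux_partial0 i x : ~ K x -> partial i (G i) x = 0.
Proof. by move=> /(flux_derivative0 i) h; exact: (@derive_val _ _ _ _ _ _ _ h). Qed.

Lemma flux_divergence x : X x -> \sum_i partial i (G i) x =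
  kappa_tilde Omega x * (`|f x| `^ p * d x `^ (1 - p))
  + p * `|f x| `^ (p - 1) * Num.sg (f x) * dotp (gradient f x) (nu x) * d x `^ (1 - p)
  + (1 - p) * (`|f x| `^ p * d x `^ (- p)).
Proof.
move=> ex.
have [D [dD _ <-]] := unit_normal_divergence Omega_open Omega0 Omega_convex Omega_C2 ex.
have E i : partial i (G i) x = D i * Phi x
    + dabs_powR p (f x) * d x `^ (1 - p) * (gradient f x 0 i * nu x 0 i)
    + (1 - p) * (`|f x| `^ p * d x `^ (- p)) * (nu x 0 i * nu x 0 i).
  have h := flux_derivative ex (dD i).
  rewrite /partial (@derive_val _ _ _ _ _ _ _ h) /dG [gradient _ _ _ _]mxE.
  by move: (Phi x) (nu x 0 i) (partial i f x) (dabs_powR _ _) => a1 a2 a3 a4; ring.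
under eq_bigr do rewrite E.
rewrite !big_split/= -mulr_suml -!mulr_sumr -/(dotp _ _) -/(dotp (nu x) (nu x)).
have -> : dotp (nu x) (nu x) = 1 by rewrite -enorm_sqr enorm_nu// expr1n.
rewrite mulr1; congr (_ + _ + _).
by rewrite /dabs_powR; move: (dotp _ _) (Num.sg _) => a1 a2; ring.
Qed.

(** The derivative of [nu] is dominated by [m / delta], so each term is controlled by a function
    continuous on the compact support of [f]. *)
Lemma flux_partial_bound i : exists C, forall x, `|partial i (G i) x| <= C.
Proof.
have [B1 B10 h1] : exists2 B, 0 <= B & forall x, K x -> `|Phi x * (d x)^-1| <= B.
  apply: compact_bound => x Kx; have ex := KX Kx; apply: continuous_mulf.
    exact: Phi_continuous.
  apply: continuous_invf; last exact: delta_continuous.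
  by rewrite gt_eqF// delta_gt0.
have [B2 B20 h2] : exists2 B, 0 <= B & forall x, K x ->
    `| `|f x| `^ (p - 1) * partial i f x * d x `^ (1 - p)| <= B.
  apply: compact_bound => x Kx; have ex := KX Kx; apply: continuous_mulf.
    apply: continuous_mulf; first exact: abs_f_powR_continuous.
    exact: partial_cont.
  exact: delta_powR_continuous.
have [B3 B30 h3] : exists2 B, 0 <= B & forall x, K x -> `| `|f x| `^ p * d x `^ (- p)| <= B.
  apply: compact_bound => x Kx; have ex := KX Kx; apply: continuous_mulf.
    exact: abs_f_powR_continuous.
  exact: delta_powR_continuous.
exists (m%:R * B1 + (p * B2 + (p - 1) * B3)) => x.
have [Kx|nK] := pselect (K x); last first.
  by rewrite flux_partial0// normr0 !addr_ge0// mulr_ge0// ltW.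
have ex := KX Kx; have d0 := delta_gt0 Omega0 ex.
have [D [dD Db _]] := unit_normal_divergence Omega_open Omega0 Omega_convex Omega_C2 ex.
have h := flux_derivative ex (dD i).
rewrite /partial (@derive_val _ _ _ _ _ _ _ h) /dG.
have nu1 : `|nu x 0 i| <= 1 by rewrite (le_trans (coord_le_enorm _ _))// enorm_nu.
have Phi0 : 0 <= Phi x by rewrite mulr_ge0 ?powR_ge0.
apply: (le_trans (ler_normD _ _)); apply: lerD.
  rewrite normrM (ger0_norm Phi0); apply: (le_trans (ler_wpM2r Phi0 (Db i))).
  rewrite -mulrA ler_wpM2l// mulrC; exact: le_trans (ler_norm _) (h1 _ Kx).
rewrite normrM; apply: (le_trans (_ : _ <= 1 * `|dabs_powR p (f x) * partial i f x * d x `^ (1 - p)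
    + `|f x| `^ p * ((1 - p) * d x `^ (- p) * nu x 0 i)|)).
  by rewrite ler_wpM2r.
rewrite mul1r; apply: (le_trans (ler_normD _ _)); apply: lerD.
  have -> : dabs_powR p (f x) * partial i f x * d x `^ (1 - p) =
     p * (`|f x| `^ (p - 1) * partial i f x * d x `^ (1 - p)) * Num.sg (f x) by rewrite /dabs_powR; ring.
  rewrite normrM -[leRHS]mulr1 ler_pM//; last by rewrite normr_sg lern1 leq_b1.
  by rewrite normrM gtr0_norm// ler_pM2l// h2.
have -> : `|f x| `^ p * ((1 - p) * d x `^ (- p) * nu x 0 i) =
   - (p - 1) * (`|f x| `^ p * d x `^ (- p)) * nu x 0 i by ring.
rewrite normrM -[leRHS]mulr1 ler_pM// normrM normrN (gtr0_norm p10).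
by rewrite ler_pM2l// h3.
Qed.

Lemma support_in_box : exists2 M, 0 <= M & forall x, ~ origin_box M x -> ~ K x.
Proof.
have [B B0 hB] : exists2 B, 0 <= B & forall x, K x -> `|enorm x| <= B.
  by apply: compact_bound => x _; exact: continuous_enorm.
exists B => // x nx Kx; apply: nx; apply/origin_boxP => i.
by rewrite (le_trans (coord_le_enorm _ _))// (le_trans (ler_norm _))// hB.
Qed.

Lemma integral_exterior (h : 'rV[R]_m.+1 -> R) : (forall x, ~ K x -> h x = 0) ->
  (\int[mu]_(x in X) (h x)%:E = \int[mu]_x (h x)%:E)%E.
Proof.
move=> h0; rewrite integral_mkcond; congr (integral _ _ _).
apply/funext => x; rewrite patchE; case: ifPn => // /negP; rewrite inE => nX.
by rewrite h0// => /KX.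
Qed.

Let L x := enorm (gradient f x) `^ p.
Let W x := (1 - p * kappa_tilde Omega x * d x / (p - 1)) * (`|f x| `^ p / d x `^ p).
Let c : R := (p - 1) / p.

Let L0 x : ~ K x -> L x = 0.
Proof.
move=> nK; rewrite /L (_ : gradient f x = 0) ?enorm0 ?powR0 ?gt_eqF//.
by apply/rowP => i; rewrite !mxE partial0.
Qed.

Let W0 x : ~ K x -> W x = 0.
Proof. by move=> nK; rewrite /W f0// normr0 powR0 ?gt_eqF// mul0r mulr0. Qed.

Lemma hardy_integrand_le x :
  c `^ p * W x <= L x - c `^ (p - 1) * \sum_i partial i (G i) x.
Proof.
have [Kx|nK] := pselect (K x); last first.
  rewrite W0// L0// big1 ?mulr0 ?subrr// => i _; exact: flux_partial0.
have ex := KX Kx; have d0 := delta_gt0 Omega0 ex.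
rewrite flux_divergence//; apply: hardy_pointwise => //.
- exact: enorm_ge0.
- by apply: (le_trans (cauchy_schwarz_norm _ _)); rewrite enorm_nu// mulr1.
- by rewrite normr_sg lern1 leq_b1.
Qed.

Lemma gradient_power_continuous : continuous L.
Proof.
have -> : L = (fun t => `|t| `^ p) \o (@Num.sqrt R \o (fun x => \sum_i partial i f x * partial i f x)).
  apply/funext => x; rewrite /L /= ger0_norm ?sqrtr_ge0// /enorm /dotp.
  by congr (Num.sqrt _ `^ p); apply: eq_bigr => i _; rewrite mxE.
move=> x; apply: continuous_comp; last exact: continuous_abs_powR.
apply: continuous_comp; last exact: sqrt_continuous.
by apply: continuous_sum_fin => i; apply: continuous_mulf; exact: partial_cont.
Qed.

Lemma flux_integral i : [/\ measurable_fun setT (partial i (G i)),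
   mu.-integrable setT (EFin \o partial i (G i)) & (\int[mu]_x (partial i (G i) x)%:E = 0)%E].
Proof.
have [M M0 hM] := support_in_box; have [C hC] := flux_partial_bound i.
apply: (@integral_partial_eq0 _ _ i (G i) _ M C) => //.
- exact: flux_continuous.
- by move=> x /hM /f0; exact: flux0.
- by move=> x; exact: flux_is_derive.
Qed.

(** [flux_divergence] is solved for the curvature term: on the exterior, [W] is a combination of
    continuous functions, [Num.sg] of [f] and the measurable partial derivatives of the flux. *)
Lemma hardy_integrand_measurable : measurable_fun setT W.
Proof.
have mX : measurable X by apply: open_rV_measurable; exact: exterior_open.
have -> : W = W \_ X.
  apply/funext => x; rewrite patchE; case: ifPn => // /negP; rewrite inE => nX.
  by rewrite W0// => /KX.
apply/(measurable_restrictT _ mX).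
pose T2 x := p * `|f x| `^ (p - 1) * Num.sg (f x) * dotp (gradient f x) (nu x) * d x `^ (1 - p).
pose T3 x := `|f x| `^ p * d x `^ (- p).
apply: (eq_measurable_fun (fun x => T3 x - p / (p - 1) * (\sum_i partial i (G i) x - T2 x - (1 - p) * T3 x))).
  move=> x; rewrite inE => ex; have d0 := delta_gt0 Omega0 ex.
  rewrite flux_divergence// -/(T2 x) -/(T3 x).
  have E1 : d x `^ (1 - p) = d x * d x `^ (- p).
    have -> : d x `^ (1 - p) = d x `^ 1 * d x `^ (- p) by apply: powRD; apply/implyP => _; rewrite gt_eqF.
    by rewrite powRr1// ltW.
  rewrite /W -powRN E1 /T3.
  move: (`|f x| `^ p) (d x `^ (- p)) (T2 x) (d x) (kappa_tilde _ _) => a1 a2 a3 a4 a5.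
  by field; rewrite gt_eqF.
have oX : open X by exact: exterior_open.
have mT3 : measurable_fun X T3.
  apply: continuous_open_measurable => // x ex; apply: continuous_mulf.
    exact: abs_f_powR_continuous.
  exact: delta_powR_continuous.
have mf : measurable_fun [set: 'rV[R]_m.+1] f by exact: continuous_rV_measurable.
have mT2 : measurable_fun X T2.
  apply: measurable_funM; last first.
    by apply: continuous_open_measurable => // x ex; exact: delta_powR_continuous.
  apply: measurable_funM; last first.
    apply: continuous_open_measurable => // x ex; apply: continuous_sum_fin => i.
    apply: continuous_mulf; last exact: unit_normal_continuous.
    rewrite (_ : (fun z => gradient f z 0 i) = partial i f); first exact: partial_cont.
    by apply/funext => z; rewrite mxE.
  apply: measurable_funM; last first.
    by apply: measurable_funTS; apply: measurableT_comp => //; exact: measurable_sg.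
  apply: measurable_funM => //.
  by apply: continuous_open_measurable => // x ex; exact: abs_f_powR_continuous.
apply: measurable_funB => //; apply: measurable_funM => //.
apply: measurable_funB; last exact: measurable_funM.
apply: measurable_funB => //; apply: measurable_sum => i.
by apply: measurable_funTS; have [] := flux_integral i.
Qed.

(** [kappa_tilde * delta] is bounded uniformly, the divergence being a sum of [m.+1] terms of size
    at most [m / delta]. *)
Lemma hardy_integrand_bound : exists C, forall x, `|W x| <= C.
Proof.
have [B B0 hB] : exists2 B, 0 <= B & forall x, K x -> `| `|f x| `^ p * d x `^ (- p)| <= B.
  apply: compact_bound => x Kx; have ex := KX Kx; apply: continuous_mulf.
    exact: abs_f_powR_continuous.
  exact: delta_powR_continuous.
pose A : R := 1 + p / (p - 1) * (m.+1%:R * m%:R).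
have A0 : 0 <= A 
  by rewrite /A addr_ge0// mulr_ge0 ?(divr_ge0 (ltW p0) (ltW p10))// mulr_ge0.
exists (A * B) => x; have [Kx|nK] := pselect (K x); last by rewrite W0// normr0 mulr_ge0.
have ex := KX Kx; have d0 := delta_gt0 Omega0 ex.
have [D [_ Db DE]] := unit_normal_divergence Omega_open Omega0 Omega_convex Omega_C2 ex.
have kd : `|kappa_tilde Omega x * d x| <= m.+1%:R * m%:R.
  rewrite normrM (gtr0_norm d0) -ler_pdivlMr// -DE (le_trans (ler_norm_sum _ _ _))//.
  apply: (le_trans (ler_sum _ (fun i _ => Db i))).
  by rewrite sumr_const card_ord -[leLHS]mulr_natl mulrA.
rewrite /W normrM ler_pM//; last by rewrite -powRN; exact: hB.
rewrite (le_trans (ler_normB _ _))// normr1 lerD2l.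
have -> : p * kappa_tilde Omega x * d x / (p - 1) = p / (p - 1) * (kappa_tilde Omega x * d x) by ring.
by rewrite normrM gtr0_norm ?divr_gt0// ler_pM2l// divr_gt0.
Qed.

(** Subtracting [c ^ (p - 1)] times the divergence does not change the integral of [L], and the
    comparison becomes pointwise. The integrals are extended real numbers, so each use of linearity
    rests on integrability. *)
Lemma hardy_inequality :
  ((c `^ p)%:E * \int[mu]_(x in X) (W x)%:E <= \int[mu]_(x in X) (L x)%:E)%E.
Proof.
rewrite !integral_exterior//.
have [M M0 hM] := support_in_box.
have [CW hCW] := hardy_integrand_bound.
have intW : mu.-integrable setT (EFin \o W).
  apply: (integrable_bounded_support M0 hardy_integrand_measurable hCW).
  by move=> x /hM /W0.
have [CL _ hCL] := compact_bound (fun x _ => gradient_power_continuous (x := x)).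
have intL : mu.-integrable setT (EFin \o L).
  apply: (@integrable_bounded_support _ _ L M `|CL|) => //.
  - exact: continuous_rV_measurable gradient_power_continuous.
  - move=> x; have [Kx|/L0 ->] := pselect (K x); last by rewrite normr0.
    by rewrite (le_trans (hCL _ Kx))// ler_norm.
  - by move=> x /hM /L0.
have intG : mu.-integrable setT (fun x => \sum_i (partial i (G i) x)%:E)%E.
  by apply: integrable_sum => // i _; have [] := flux_integral i.
have intcG : mu.-integrable setT (fun x => (c `^ (p - 1))%:E * \sum_i (partial i (G i) x)%:E)%E.
  exact: integrableZl.
rewrite -integralZl//.
have -> : (\int[mu]_x (L x)%:E = \int[mu]_x ((L x)%:E - (c `^ (p - 1))%:E * \sum_i (partial i (G i) x)%:E))%E.
  rewrite (integralB measurableT intL intcG) integralZl// integral_sum//; last first.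
    by move=> i; have [] := flux_integral i.
  rewrite big1 ?mule0 ?sube0// => i _; by have [] := flux_integral i.
apply: le_integral => //.
- exact: (integrableZl measurableT _ intW).
- exact: (integrableB measurableT intL intcG).
- move=> x _; rewrite sumEFin -!EFinM -EFinB lee_fin; exact: hardy_integrand_le.
Qed.

End hardy.

Unset Implicit Arguments.

Theorem theorem4 (R : realType) (n : nat) (Omega : set 'rV[R]_n) (p : R)
    (hn : (2 <= n)%N) (hdom : is_domain Omega) (hconv : is_convex Omega)
    (hC2 : C2_boundary Omega) (hp : 1 < p) :
  [/\ forall x, exterior Omega x -> exists! y, is_nearest Omega x y,
      forall x, exterior Omega x -> 0 <= kappa_tilde Omega x &
      forall f, Cc_infty (exterior Omega) f ->
      (\int[lebesgue_rV R n]_(x in exterior Omega)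
          (enorm (gradient f x) `^ p)%:E
       >= (((p - 1) / p) `^ p)%:E *
          \int[lebesgue_rV R n]_(x in exterior Omega)
            ((1 - p * kappa_tilde Omega x * delta Omega x / (p - 1)) *
             (`|f x| `^ p / delta Omega x `^ p))%:E)%E].
Proof.
(* With [n = m.+1] the index type of the curvatures, ['I_n.-1], is convertible to ['I_m]. *)
case: n Omega hn hdom hconv hC2 => [//|m] Omega _ [] Omega0 oO _ cO C2; split.
- move=> x ex; have [y hy] := nearest_exists oO Omega0 cO ex.
  by exists y; split=> // y'; exact: is_nearest_uniq.
- by move=> x; exact: kappa_tilde_ge0.
- by move=> f fC; exact: (hardy_inequality oO Omega0 cO C2 hp fC).
Qed.
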